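(* Let $A>0$ and $\alpha<0$, and let $\Omega_0\subset\mathbb{R}^2$ be a square of area $A$. Then $\Omega_0$ is a local maximiser, with respect to the Hausdorff distance up to isometry, of the first Robin eigenvalue $\lambda_1(\cdot,\alpha)$ among quadrilaterals of area $A$; that is, there exists $\delta>0$ such that for every quadrilateral $\Omega\subset\mathbb{R}^2$ of area $A$ with $d_H(\Omega,\Omega_0)<\delta$ one has $\lambda_1(\Omega,\alpha)\le\lambda_1(\Omega_0,\alpha)$.
   Context: For a bounded polygonal domain $\Omega\subset\mathbb{R}^2$ and $\alpha\in\mathbb{R}$, $\lambda_1(\Omega,\alpha)$ denotes the first eigenvalue of the Robin problem $-\Delta u=\lambda u$ in $\Omega$, $\frac{\partial u}{\partial\nu}+\alpha u=0$ on $\partial\Omega$ ($\nu$ the outward unit normal), given by $$\lambda_1(\Omega,\alpha)=\min_{u\in H^1(\Omega),\,u\ne0}\frac{\int_\Omega|\nabla u|^2\,dx+\alpha\int_{\partial\Omega}|u|^2\,d\sigma}{\int_\Omega|u|^2\,dx},$$ with the boundary integral understood in the sense of traces. A quadrilateral is the (open) interior region of a simple four-sided polygon, not necessarily convex. $d_H(\Omega,\Omega_0)$ is the Hausdorff distance up to isometry, i.e. the infimum over isometries $T$ of $\mathbb{R}^2$ of the Hausdorff distance between (the closures of) $\Omega$ and $T(\Omega_0)$. *)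

(* Defs.v *)
From HB Require Import structures.
From mathcomp Require Import all_boot all_order all_algebra.
From mathcomp Require Import all_classical all_reals all_analysis.

Set Implicit Arguments.
Unset Strict Implicit.
Unset Printing Implicit Defensive.

Import Order.TTheory GRing.Theory Num.Theory.
Import numFieldNormedType.Exports.

Local Open Scope classical_set_scope.
Local Open Scope ring_scope.

(* The plane is the product R * R; its library norm is the
   sup norm, which is used only for its topology and its bounded sets.
   Lengths and distances are Euclidean, through [edist]. *)

Section Plane.
Context {R : realType}.
Implicit Types (x y : R * R) (X Y : set (R * R)).

Definition edist x y : R :=
  Num.sqrt ((x.1 - y.1) ^+ 2 + (x.2 - y.2) ^+ 2).

Definition edist_set x Y : \bar R := ereal_inf [set (edist x y)%:E | y in Y].

Definition hausdorff_dist X Y : \bar R :=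
  maxe (ereal_sup [set edist_set x Y | x in X])
       (ereal_sup [set edist_set y X | y in Y]).

Definition isometry (T : R * R -> R * R) : Prop :=
  forall x y, edist (T x) (T y) = edist x y.

Definition hausdorff_dist_iso X Y : \bar R :=
  ereal_inf [set hausdorff_dist (closure X) (closure (T @` Y)) | T in isometry].

Definition area :
    {measure set (measurableTypeR R * measurableTypeR R) -> \bar R} :=
  (@lebesgue_measure R \x @lebesgue_measure R)%E.

End Plane.

Section Polygon.
Context {R : realType} {n : nat}.
(* A closed polygonal curve with n sides is given by its vertices in cyclic
   order; side i joins vertex i to vertex i + 1 modulo n. *)
Implicit Type p : 'I_n -> R * R.

Definition side p (i : 'I_n) (t : R) : R * R :=
  p i + t *: (p (ordS i) - p i).

Definition side_length p (i : 'I_n) : R := edist (p i) (p (ordS i)).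

Definition polygon_curve p : set (R * R) :=
  [set x | exists i, exists2 t, 0 <= t <= 1 & x = side p i t].

(* The closed curve obtained by running through the sides, each parametrised
   by [0, 1[, has no self-intersection; in particular no side is reduced to
   a point. *)
Definition simple_polygon p : Prop :=
  forall (i j : 'I_n) (s t : R), 0 <= s < 1 -> 0 <= t < 1 ->
    side p i s = side p j t -> i = j /\ s = t.

(* The interior region in the sense of the Jordan curve theorem: the union of
   the bounded connected components of the complement of the curve. *)
Definition polygon_interior p : set (R * R) :=
  [set x | (~` polygon_curve p) x /\
     bounded_set (connected_component (~` polygon_curve p) x)].

(* Integral with respect to arc length. *)
Definition boundary_integral p (f : R * R -> \bar R) : \bar R :=
  (\sum_(i < n) (side_length p i)%:E *
     \int[lebesgue_measure]_(t in `[0%R, 1%R]) f (side p i t))%E.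

End Polygon.

Section Sobolev.
Context {R : realType}.
Implicit Types (u phi : R * R -> R) (Omega : set (R * R)).

Definition partial1 u : R * R -> R := fun x => 'D_((1, 0) : R * R) u x.
Definition partial2 u : R * R -> R := fun x => 'D_((0, 1) : R * R) u x.

Fixpoint Ck (k : nat) u : Prop :=
  continuous u /\
  if k is k'.+1 then
    [/\ forall x, derivable u x ((1, 0) : R * R),
        forall x, derivable u x ((0, 1) : R * R),
        Ck k' (partial1 u) & Ck k' (partial2 u)]
  else True.

Definition test_function Omega phi : Prop :=
  (forall k, Ck k phi) /\
  exists K : set (R * R),
    [/\ compact K, K `<=` Omega & forall x, ~ K x -> phi x = 0].

Definition in_L2 Omega u : Prop :=
  measurable_fun (Omega : set (measurableTypeR R * measurableTypeR R)) u /\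
  (\int[area]_(x in Omega) ((u x) ^+ 2)%:E < +oo)%E.

Definition L2_cvg Omega (v : nat -> R * R -> R) u : Prop :=
  (\int[area]_(x in Omega) ((v m x - u x) ^+ 2)%:E)%E @[m --> \oo] --> 0%E.

Definition weak_gradient Omega u (u1 u2 : R * R -> R) : Prop :=
  forall phi, test_function Omega phi ->
    Rintegral area Omega (fun x => u x * partial1 phi x) =
      - Rintegral area Omega (fun x => u1 x * phi x) /\
    Rintegral area Omega (fun x => u x * partial2 phi x) =
      - Rintegral area Omega (fun x => u2 x * phi x).

Definition in_H1 Omega u (u1 u2 : R * R -> R) : Prop :=
  [/\ in_L2 Omega u, in_L2 Omega u1, in_L2 Omega u2 &
      weak_gradient Omega u u1 u2].

End Sobolev.

Section Robin.
Context {R : realType} {n : nat}.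
Implicit Types (p : 'I_n -> R * R) (u g : R * R -> R).

Definition in_L2_boundary p g : Prop :=
  (forall i, measurable_fun (`[0, 1] : set R) (fun t => g (side p i t))) /\
  (boundary_integral p (fun x => ((g x) ^+ 2)%:E) < +oo)%E.

(* g is the trace of u, an element of H^1 with weak gradient (u1, u2): the
   trace operator is the continuous extension, from H^1 of the interior to L^2
   of the boundary, of the map sending (the restriction to the interior of) a
   C^1 function on the plane to its restriction to the boundary. Such functions
   are dense in H^1 of a polygonal, hence Lipschitz, domain. Only the values of
   g on the boundary matter. *)
Definition trace p u (u1 u2 : R * R -> R) g : Prop :=
  in_L2_boundary p g /\
  exists v : nat -> R * R -> R,
    [/\ forall m, Ck 1 (v m),
        L2_cvg (polygon_interior p) v u,
        L2_cvg (polygon_interior p) (fun m => partial1 (v m)) u1,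
        L2_cvg (polygon_interior p) (fun m => partial2 (v m)) u2 &
        boundary_integral p (fun x => ((v m x - g x) ^+ 2)%:E)
          @[m --> \oo] --> 0%E].

Definition rayleigh_quotient p (alpha : R) u (u1 u2 g : R * R -> R) : R :=
  (Rintegral area (polygon_interior p) (fun x => (u1 x) ^+ 2 + (u2 x) ^+ 2) +
   alpha * fine (boundary_integral p (fun x => ((g x) ^+ 2)%:E))) /
  Rintegral area (polygon_interior p) (fun x => (u x) ^+ 2).

(* The minimum of the Rayleigh quotient, written as an infimum in \bar R so that
   it is meaningful without presupposing attainment.
   u ranges over the nonzero elements of H^1, u1 and u2 over representatives
   of its weak derivatives, g over representatives of its trace. *)
Definition robin_eigenvalue p (alpha : R) : \bar R :=
  ereal_inf [set r : \bar R | exists u u1 u2 g : R * R -> R,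
    [/\ in_H1 (polygon_interior p) u u1 u2,
        ~ {ae area, forall x, polygon_interior p x -> u x = 0},
        trace p u u1 u2 g &
        r = (rayleigh_quotient p alpha u u1 u2 g)%:E]].

End Robin.

Section Quadrilateral.
Context {R : realType}.
Implicit Type p : 'I_4 -> R * R.

Definition square p : Prop :=
  [/\ simple_polygon p,
      forall i, side_length p (ordS i) = side_length p i &
      forall i : 'I_4,
        let a := p (ordS i) - p i in
        let b := p (ordS (ordS i)) - p (ordS i) in
        a.1 * b.1 + a.2 * b.2 = 0].

End Quadrilateral.

(* Main.v *)
Require Import Defs.
From mathcomp Require Import all_boot all_order all_algebra.
From mathcomp Require Import all_classical all_reals all_analysis.
From mathcomp Require Import measurable_realfun ring lra.
Import Order.TTheory GRing.Theory Num.Theory.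
Import numFieldNormedType.Exports.
Local Open Scope classical_set_scope.
Local Open Scope ring_scope.

(** Let the square have side 2h, let beta = - alpha > 0, let X, Y be
coordinates along its axes, and choose k > 0 with k tanh (k h) = beta
([robin_T_root], where H = 2kh). The function u = cosh (kX) cosh (kY) is
positive, satisfies Laplace u = 2k^2 u, and its outward normal derivative on
the sides of the square is beta u. Hence the eigenvalue of the square is
- 2k^2. That it is at least - 2k^2 ([robin_lower_square]) follows from
Picone's identity: for every v it compares the flux of v^2 grad u / u through
the boundary with the energy of v ([boundary_le_energy]), and the resulting
inequality passes from C^1 functions to H^1 by density
([robin_eigenvalue_lower]).

For a quadrilateral close to the square the same u, written in a suitable
frame, is a trial function. Since div (u grad u) = |grad u|^2 + 2k^2 u^2, its
Rayleigh quotient is at most - 2k^2 as soon as the flux of u grad u through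
the boundary is at most beta times the boundary integral of u^2
([robin_eigenvalue_upper]). So everything reduces to an inequality between
integrals over four segments. The vertices of any quadrilateral are
o + s a + r d + s r g with signs s, r, and the frame can be rotated so that the
second coordinate of a equals the first coordinate of d ([normal_frame]).
In coordinates scaled by 2k, a = (H + c, b), d = (b, H + c'), g = (g1, g2)
with five small parameters, and having the area of the square means
(H + c) (H + c') - b^2 = H^2. The first-order part of the difference of
the two boundary integrals is a multiple of c + c', which this constraint
makes quadratic; the total quadratic form in the five parameters is
then negative definite, and it dominates the cubic remainder
([side_sum_nonpos], [robin_upper_near_square]).

It remains to see that a simple quadrilateral that is close to the square in
the Hausdorff distance has its vertices close to the corners, in
cyclic order. The interior region is contained in every half-plane
that contains the vertices, because a point beyond such a half-plane can
escape to infinity; this yields a vertex near each corner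
([vertex_near_corner]). The order is cyclic because in a simple
quadrilateral one of the diagonals separates the other two vertices
([simple_split], [cyclic_labelling]). The quadrilateral is then convex,
its interior region is the intersection of four half-planes
([convex_quad_interior]), and the divergence theorem on it follows from
the case of a triangle ([divergence_triangle]), where it is the fundamental
theorem of calculus in affine coordinates. *)

(** * Affine changes of variables in the plane *)

Section Measure.
Context {R : realType}.
Local Notation mR := (measurableTypeR R).
Local Notation mu := (@lebesgue_measure R).

Lemma measurable_affine (c d : R) :
  measurable_fun [set: mR] ((fun s => c * s + d) : mR -> mR).
Proof.
apply: (@measurable_funD _ mR R setT (fun s => c * s) (cst d)) => //.
exact: mulrl_measurable.
Qed.

Definition affine_measure (c d : R) : {measure set mR -> \bar R} :=
  mscale (NngNum (normr_ge0 c))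
    (measure_function_pushforward__canonical__measure_function_Measure mu (measurable_affine c d)).

(** Lebesgue measure is determined by its values on half-open intervals, where
    the claim is the effect of an affine map on lengths. *)
Lemma lebesgue_measure_affine (c d : R) (A : set mR) : c != 0 ->
  measurable A -> mu A = affine_measure c d A.
Proof.
move=> c0 mA; apply: lebesgue_measure_unique => // _ [[a b]] _ <-.
pose f : mR -> mR := fun s => c * s + d.
transitivity (`|c|%:E * mu (f @^-1` `]a, b]))%E; last by [].
 have [c1|c1|c1] := ltgtP c 0; last by rewrite c1 eqxx in c0.
- have -> : f @^-1` `]a, b] =
    [set` Interval (BLeft ((b - d) / c)) (BLeft ((a - d) / c))].
    apply/seteqP; split => x /=; rewrite /f !in_itv /= ler_ndivrMr// ltr_ndivlMr// => /andP[h1 h2]; apply/andP; split; nra.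
  rewrite !lebesgue_measure_itv /= !lte_fin ltr_ndivlMr// ltr0_norm//.
  rewrite mulrVK ?unitfE// ltrD2r.
  case: ifP => _; rewrite ?mule0// -!EFinB -EFinM; congr (_%:E); field; exact: c0.
- have -> : f @^-1` `]a, b] =
    [set` Interval (BRight ((a - d) / c)) (BRight ((b - d) / c))].
    apply/seteqP; split => x /=; rewrite /f !in_itv /= ler_pdivlMr// ltr_pdivrMr// => /andP[h1 h2]; apply/andP; split; nra.
  rewrite !lebesgue_measure_itv /= !lte_fin ltr_pdivlMr// gtr0_norm//.
  rewrite mulrVK ?unitfE// ltrD2r.
  case: ifP => _; rewrite ?mule0// -!EFinB -EFinM; congr (_%:E); field; exact: c0.
Qed.

Lemma ge0_integral_affine (c d : R) (G : R -> \bar R) : c != 0 ->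
  measurable_fun [set: mR] G -> (forall x, 0 <= G x)%E ->
  (\int[mu]_x G x = `|c|%:E * \int[mu]_x G (c * x + d)%R)%E.
Proof.
move=> c0 mG G0.
rewrite (eq_measure_integral (affine_measure c d)); last first.
  by move=> A mA _; exact: lebesgue_measure_affine.
rewrite ge0_integral_mscale//=; congr (_ * _)%E.
rewrite ge0_integral_pushforward//.
exact: measurable_affine.
Qed.

Local Notation mP := (mR * mR)%type.

(** An open set is the union of the countably many rational rectangles that it
    contains. *)
Lemma open_measurable_plane (O : set (R * R)) : open O ->
  measurable (O : set mP).
Proof.
move=> oO.
pose B (q : rat * rat * rat * rat) : set mP :=
  [set` Interval (BRight (ratr q.1.1.1 : R)) (BLeft (ratr q.1.1.2))] `*`
  [set` Interval (BRight (ratr q.1.2 : R)) (BLeft (ratr q.2))].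
have -> : O = \bigcup_(q in [set q | B q `<=` O]) B q.
  apply/seteqP; split => [x Ox|x [q /= + Bx]]; last by apply.
  have := open_nbhs_nbhs (conj oO Ox) => /nbhs_ballP [e /= e0 xeO].
  have [a] := @rat_in_itvoo R (x.1 - e) x.1 ltac:(lra).
  have [b] := @rat_in_itvoo R x.1 (x.1 + e) ltac:(lra).
  have [c] := @rat_in_itvoo R (x.2 - e) x.2 ltac:(lra).
  have [d] := @rat_in_itvoo R x.2 (x.2 + e) ltac:(lra).
  rewrite !in_itv /= => /andP[d1 d2] /andP[c1 c2] /andP[b1 b2] /andP[a1 a2].
  exists (a, b, c, d); last by rewrite /B /= !in_itv /= a2 b1 c2 d1.
  move=> y [] /=; rewrite !in_itv /= => /andP[h1 h2] /andP[h3 h4].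
  by apply: xeO; split; rewrite /ball /= ltr_norml; apply/andP; split; lra.
rewrite bigcup_mkcond; apply: countable_bigcupT_measurable; first exact: countableP.
move=> q; case: ifP => // _; apply: measurableX; exact: measurable_itv.
Qed.

Lemma continuous_measurable_plane (f : R * R -> R) (D : set (R * R)) :
  measurable (D : set mP) -> continuous f -> measurable_fun (D : set mP) f.
Proof.
move=> mD cf; apply: (measurability _ (RGenOpens.measurableE R)) => //.
move=> /= _ [_ [a [b ->] <-]]; apply: measurableI => //.
apply: open_measurable_plane; apply: open_comp; last exact: interval_open.
by move=> x _; exact: cf.
Qed.

End Measure.

Section AffinePlane.
Context {R : realType}.
Local Notation mR := (measurableTypeR R).
Local Notation mu := (@lebesgue_measure R).
Local Notation mP := (mR * mR)%type.

Definition lin (p q r : R) (z : R * R) : R := p * z.1 + q * z.2 + r.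

Lemma continuous_lin p q r : continuous (lin p q r).
Proof.
move=> z; rewrite /lin; apply: cvgD; last exact: cvg_cst.
apply: cvgD; (apply: cvgM; first exact: cvg_cst); [exact: cvg_fst | exact: cvg_snd].
Qed.

Lemma measurable_lin p q r : measurable_fun [set: mP] (lin p q r).
Proof. by apply: continuous_measurable_plane => //; exact: continuous_lin. Qed.

Lemma measurable_comp_lin (G : R * R -> \bar R) p q r p' q' r' :
  measurable_fun [set: mP] G ->
  measurable_fun [set: mP] (fun z => G (lin p q r z, lin p' q' r' z)).
Proof.
move=> mG; apply: (measurableT_comp mG).
apply: (@measurable_fun_pair _ _ _ mP mR mR); exact: measurable_lin.
Qed.

(** Two substitutions in one variable, each inside an integral exchanged by
    Tonelli; e.1 and J / e.1 are the pivots of the matrix with columns e, f. *)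
Lemma ge0_integral_plane_affine_aux (G : R * R -> \bar R) (a e f : R * R) :
  measurable_fun [set: mP] G -> (forall z, 0 <= G z)%E ->
  e.1 * f.2 - e.2 * f.1 != 0 -> e.1 != 0 ->
  (\int[area]_z G z = `|e.1 * f.2 - e.2 * f.1|%:E *
     \int[mu]_t \int[mu]_s G (a + s *: e + t *: f)%R)%E.
Proof.
move=> mG G0 J0 e0; set J := (X in (`|X|%:E)) in J0 *.
pose K (z : R * R) := G (lin 0 1 0 z, lin (f.2 - e.2 / e.1 * f.1) (e.2 / e.1) (a.2 - e.2 / e.1 * a.1) z).
have mK : measurable_fun [set: mP] K by exact: measurable_comp_lin.
have mGx x : measurable_fun [set: mR] (fun y => G (x, y)).
  apply: (measurableT_comp mG); exact: pair1_measurable.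
have mKx x : measurable_fun [set: mR] (fun t => K (t, x)).
  apply: (measurableT_comp mK); exact: pair2_measurable.
have mKt t : measurable_fun [set: mR] (fun x => K (t, x)).
  apply: (measurableT_comp mK); exact: pair1_measurable.
have step1 t : (`|e.1|%:E * \int[mu]_s G (a + s *: e + t *: f)%R = \int[mu]_x K (t, x))%E.
  rewrite (@ge0_integral_affine _ e.1 (a.1 + t * f.1) (fun x => K (t, x)))//; last by move=> x; exact: G0.
  congr (_ * _)%E; apply: eq_integral => s _; rewrite /K /lin /=; congr G.
  by case: a e f e0 {J J0 K mK mKx mKt} => [a1 a2] [e1 e2] [f1 f2] /= e0;
    congr pair; rewrite /= /GRing.scale /=; field.
have step2 x : (`|J / e.1|%:E * \int[mu]_t K (t, x) = \int[mu]_y G (x, y))%E.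
  rewrite (@ge0_integral_affine _ (J / e.1) (a.2 + (x - a.1) * (e.2 / e.1)) (fun y => G (x, y)))//; last first.
    by rewrite mulf_neq0// invr_eq0.
  congr (_ * _)%E; apply: eq_integral => t _; rewrite /K /lin /=; congr G.
  by rewrite /J; congr pair; field.
rewrite /area (@fubini_tonelli1 _ _ _ _ R mu mu G)// /fubini_F.
have -> : `|J| = `|J / e.1| * `|e.1| by rewrite -normrM mulfVK.
rewrite EFinM -muleA -ge0_integralZl//; last 2 first.
- pose H1 (t : mR) := ((`|e.1|^-1)%:E * fubini_F mu K t)%E.
  apply: (eq_measurable_fun H1).
    move=> t _; rewrite /H1 /fubini_F -step1 muleA -EFinM mulVf ?mul1e//.
    by rewrite normr_eq0.
  apply: measurable_funeM; apply: measurable_fun_fubini_tonelli_F => //.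
  by move=> z; exact: G0.
- by move=> t _; apply: integral_ge0 => s _; exact: G0.

under [in RHS]eq_integral do rewrite step1.
rewrite (@fubini_tonelli _ _ _ _ R mu mu K)//; last by move=> z; exact: G0.
rewrite -ge0_integralZl//; last 2 first.
- apply: (@measurable_fun_fubini_tonelli_G _ _ _ _ R mu K) => //.
  by move=> z; exact: G0.
- by move=> t _; apply: integral_ge0 => s _; exact: G0.

by apply: eq_integral => x _; rewrite step2.
Qed.

(** If e.1 = 0 then f.1 is a pivot, and e, f change places. *)
Lemma ge0_integral_plane_affine (G : R * R -> \bar R) (a e f : R * R) :
  measurable_fun [set: mP] G -> (forall z, 0 <= G z)%E ->
  e.1 * f.2 - e.2 * f.1 != 0 ->
  (\int[area]_z G z = `|e.1 * f.2 - e.2 * f.1|%:E *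
     \int[mu]_t \int[mu]_s G (a + s *: e + t *: f)%R)%E.
Proof.
move=> mG G0 J0.
have [e0|] := eqVneq e.1 0; last exact: ge0_integral_plane_affine_aux.
have f0 : f.1 != 0 by apply: contra_neq J0 => f0; rewrite e0 f0; ring.
have J0' : f.1 * e.2 - f.2 * e.1 != 0.
  by apply: contra_neq J0 => h; apply: oppr_inj; rewrite oppr0 -h; ring.
rewrite (ge0_integral_plane_affine_aux _ a f e mG G0 J0' f0).
have -> : `|f.1 * e.2 - f.2 * e.1| = `|e.1 * f.2 - e.2 * f.1|.
  by rewrite -normrN; congr (`|_|); ring.
congr (_ * _)%E.
pose K (z : R * R) := G (lin e.1 f.1 a.1 z, lin e.2 f.2 a.2 z).
have KE s t : G (a + s *: e + t *: f)%R = K (s, t).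
  by rewrite /K /lin; congr G; case: (a) (e) (f) => [? ?] [? ?] [? ?]; congr pair; rewrite /= /GRing.scale /=; ring.
have KE' s t : G (a + s *: f + t *: e)%R = K (t, s) by rewrite -KE; congr G; rewrite addrAC.
under eq_integral do under eq_integral do rewrite KE'.
under [RHS]eq_integral do under eq_integral do rewrite KE.
rewrite (@fubini_tonelli _ _ _ _ R mu mu K)//; last by move=> z; exact: G0.
exact: measurable_comp_lin.
Qed.
End AffinePlane.

(** * Continuously differentiable functions of two variables *)

Section C1.
Context {R : realType}.
Implicit Types (u v : R * R -> R).

Lemma is_derive_of_cvg (V : normedModType R) (f : V -> R) (x v : V) (d : R) :
  h^-1 *: (f (h *: v + x) - f x) @[h --> (0:R)^'] --> d -> is_derive x v f d.
Proof.
move=> h; apply: DeriveDef; first by apply/cvg_ex; exists d.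
exact: cvg_lim h.
Qed.

Lemma cvg_of_is_derive (V : normedModType R) (f : V -> R) (x v : V) (d : R) :
  is_derive x v f d -> h^-1 *: (f (h *: v + x) - f x) @[h --> (0:R)^'] --> d.
Proof. by move=> [df <-]; exact: df. Qed.

Lemma is_derive_line (f : R * R -> R) (a v : R * R) (t d : R) :
  is_derive (a + t *: v) v f d <-> is_derive t (1 : R) (fun s => f (a + s *: v)) d.
Proof.
have E : (fun h : R => h^-1 *: (f (h *: v + (a + t *: v)) - f (a + t *: v))) =
         (fun h : R => h^-1 *: (f (a + (h *: 1 + t) *: v) - f (a + t *: v))).
  apply/funext => h; congr (_ *: (f _ - _)).
  by rewrite scalerDl addrCA; congr (_ + (_ *: _ + _)); rewrite /GRing.scale /= mulr1.
by split => /cvg_of_is_derive H; apply: is_derive_of_cvg; move: H; rewrite E.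
Qed.

Lemma MVT_sym (f df : R -> R) (a b : R) : (forall s, is_derive s (1 : R) f (df s)) ->
  exists2 c, `|c - a| <= `|b - a| & f b - f a = df c * (b - a).
Proof.
move=> fd.
have cf (p q : R) : {within `[p, q], continuous f}.
  apply: continuous_subspaceT => s; apply: differentiable_continuous.
  by apply/derivable1_diffP; case: (fd s).
have [ab|ba|->] := ltgtP a b; last by exists b; rewrite ?subrr ?mulr0.
- have [c] := @MVT R f df a b ab (fun s _ => fd s) (cf _ _).
  rewrite in_itv /= => /andP[ac cb] E; exists c => //.
  by rewrite !gtr0_norm ?subr_gt0// lerD2r ltW.
- have [c] := @MVT R f df b a ba (fun s _ => fd s) (cf _ _).
  rewrite in_itv /= => /andP[ac cb] E; exists c => //; last by lra.
  by rewrite !ltr0_norm ?subr_lt0// lerN2 lerD2r ltW.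
Qed.

(** The partial derivatives are arguments, so that those of compound expressions
    are explicit formulas. *)
Definition C1 u (u1 u2 : R * R -> R) : Prop :=
  [/\ continuous u, continuous u1, continuous u2,
      forall x, is_derive x ((1, 0) : R * R) u (u1 x) &
      forall x, is_derive x ((0, 1) : R * R) u (u2 x)].

(** The increment is split along two sides of a coordinate rectangle; the mean
    value theorem applies on each, and the partials are continuous at x. *)
Lemma C1_is_derive u u1 u2 (x v : R * R) : C1 u u1 u2 ->
  is_derive x v u (v.1 * u1 x + v.2 * u2 x).
Proof.
move=> [_ c1 c2 d1 d2]; apply: is_derive_of_cvg.
have l1 (p : R * R) (t : R) : is_derive t (1 : R) (fun s => u (s, p.2)) (u1 (t, p.2)).
  have := (is_derive_line u (0, p.2) (1, 0) t (u1 (t, p.2))).1.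
  rewrite (_ : (0, p.2) + t *: (1, 0) = (t, p.2) :> R * R); last first.
    by congr pair; rewrite /= /GRing.scale /=; ring.
  move=> /(_ (d1 _)); congr (is_derive _ _ _ _); apply/funext => s; congr u.
  by congr pair; rewrite /= /GRing.scale /=; ring.
have l2 (p : R * R) (t : R) : is_derive t (1 : R) (fun s => u (p.1, s)) (u2 (p.1, t)).
  have := (is_derive_line u (p.1, 0) (0, 1) t (u2 (p.1, t))).1.
  rewrite (_ : (p.1, 0) + t *: (0, 1) = (p.1, t) :> R * R); last first.
    by congr pair; rewrite /= /GRing.scale /=; ring.
  move=> /(_ (d2 _)); congr (is_derive _ _ _ _); apply/funext => s; congr u.
  by congr pair; rewrite /= /GRing.scale /=; ring.
apply/cvgrPdist_le => e e0.
pose K : R := `|v.1| + `|v.2| + 1.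
have K0 : 0 < K by rewrite /K ltr_pwDr// addr_ge0.
have eK : 0 < e / K by exact: divr_gt0.
have /nbhs_ballP[r1 /= r10 H1] : \forall y \near x, `|u1 x - u1 y| <= e / K.
  by move: (c1 x) => /cvgrPdist_le; apply.
have /nbhs_ballP[r2 /= r20 H2] : \forall y \near x, `|u2 x - u2 y| <= e / K.
  by move: (c2 x) => /cvgrPdist_le; apply.
have nK : \forall h \near 0^', `|h : R| * K < r1 /\ `|h| * K < r2.
  have m0 : 0 < Num.min r1 r2 / K by rewrite divr_gt0// lt_min r10 r20.
  near=> h.
  have : `|h| < Num.min r1 r2 / K by near: h; exact: dnbhs0_lt.
  by rewrite ltr_pdivlMr// lt_min => /andP.
near=> h.
have [hr1 hr2] : `|h : R| * K < r1 /\ `|h| * K < r2 by near: h.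
have h0 : h != 0 by near: h; exact: nbhs_dnbhs_neq.
have [s hs Es] := MVT_sym _ _ x.1 (x.1 + h * v.1) (l1 (0, x.2 + h * v.2)).
have [t ht Et] := MVT_sym _ _ x.2 (x.2 + h * v.2) (l2 x).
move: hs ht; rewrite !(addrC x.1, addrC x.2) !addrK !normrM => hs ht.
have v1K : `|v.1| <= K by rewrite /K -addrA lerDl addr_ge0.
have v2K : `|v.2| <= K by rewrite /K addrAC lerDr addr_ge0.
have b1 : `|u1 x - u1 (s, x.2 + h * v.2)| <= e / K.
  apply: H1; split; rewrite /ball /= distrC; apply: le_lt_trans hr1.
    by apply: (le_trans hs); rewrite ler_wpM2l.
  by rewrite addrC addKr normrM ler_wpM2l.
have b2 : `|u2 x - u2 (x.1, t)| <= e / K.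
  apply: H2; split; rewrite /ball /= distrC; apply: le_lt_trans hr2.
    by rewrite subrr normr0 mulr_ge0// ltW.
  by apply: (le_trans ht); rewrite ler_wpM2l.
have -> : h^-1 *: (u (h *: v + x) - u x) =
    v.1 * u1 (s, x.2 + h * v.2) + v.2 * u2 (x.1, t).
  have -> : u (h *: v + x) - u x = (u (x.1 + h * v.1, x.2 + h * v.2) - u (x.1, x.2 + h * v.2))
     + (u (x.1, x.2 + h * v.2) - u (x.1, x.2)).
    rewrite addrA subrK -surjective_pairing; congr (u _ - _).
    by rewrite addrC; case: (x) (v) => [? ?] [? ?].
  rewrite /= in Es Et; rewrite Es Et /GRing.scale /=; field; exact: h0.
have -> : v.1 * u1 x + v.2 * u2 x - (v.1 * u1 (s, x.2 + h * v.2) + v.2 * u2 (x.1, t))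
  = v.1 * (u1 x - u1 (s, x.2 + h * v.2)) + v.2 * (u2 x - u2 (x.1, t)) by ring.
apply: (le_trans (ler_normD _ _)); rewrite !normrM.
apply: (@le_trans _ _ (`|v.1| * (e / K) + `|v.2| * (e / K))).
  by apply: lerD; apply: ler_wpM2l.
rewrite -mulrDl mulrA ler_pdivrMr// mulrC ler_pM2l// /K lerDl//.
Unshelve. all: by end_near.
Qed.

Lemma C1_line u u1 u2 (a v : R * R) (t : R) : C1 u u1 u2 ->
  is_derive t (1 : R) (fun s => u (a + s *: v))
    (v.1 * u1 (a + t *: v) + v.2 * u2 (a + t *: v)).
Proof. by move=> cu; apply/is_derive_line; exact: C1_is_derive. Qed.

Lemma Ck1_C1 u : Ck 1 u -> C1 u (partial1 u) (partial2 u).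
Proof.
move=> [cu [d1 d2 [c1 _] [c2 _]]]; split => // x; exact: derivableP.
Qed.

Lemma C1_partial u u1 u2 : C1 u u1 u2 -> partial1 u = u1 /\ partial2 u = u2.
Proof.
move=> [_ _ _ d1 d2]; split; apply/funext => x; rewrite /partial1 /partial2.
  by case: (d1 x).
by case: (d2 x).
Qed.

Lemma C1_Ck1 u u1 u2 : C1 u u1 u2 -> Ck 1 u.
Proof.
move=> cu; have [p1 p2] := C1_partial _ _ _ cu; move: cu => [cu c1 c2 d1 d2].
split => //; split => [x|x||].
- by case: (d1 x).
- by case: (d2 x).
- by rewrite p1.
- by rewrite p2.
Qed.

Lemma C1_lin (p q r : R) : C1 (lin p q r) (cst p) (cst q).
Proof.
split; [exact: continuous_lin|exact: cst_continuous|exact: cst_continuous| |] => x;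
  apply: is_derive_of_cvg; apply: (@cvg_near_cst _ _ _ _ _); near=> h.
- have h0 : h != 0 by near: h; exact: nbhs_dnbhs_neq.
  by rewrite /lin /= /GRing.scale /=; field.
- have h0 : h != 0 by near: h; exact: nbhs_dnbhs_neq.
  by rewrite /lin /= /GRing.scale /=; field.
Unshelve. all: by end_near.
Qed.

Lemma C1D u u1 u2 v v1 v2 : C1 u u1 u2 -> C1 v v1 v2 ->
  C1 (fun x => u x + v x) (fun x => u1 x + v1 x) (fun x => u2 x + v2 x).
Proof.
move=> [cu cu1 cu2 du1 du2] [cv cv1 cv2 dv1 dv2]; split => x.
- exact: (cvgD (cu x) (cv x)).
- exact: (cvgD (cu1 x) (cv1 x)).
- exact: (cvgD (cu2 x) (cv2 x)).
- exact: (is_deriveD (du1 x) (dv1 x)).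
- exact: (is_deriveD (du2 x) (dv2 x)).
Qed.

Lemma C1M u u1 u2 v v1 v2 : C1 u u1 u2 -> C1 v v1 v2 ->
  C1 (fun x => u x * v x) (fun x => u1 x * v x + u x * v1 x)
     (fun x => u2 x * v x + u x * v2 x).
Proof.
move=> [cu cu1 cu2 du1 du2] [cv cv1 cv2 dv1 dv2]; split => x.
- exact: (cvgM (cu x) (cv x)).
- exact: (cvgD (cvgM (cu1 x) (cv x)) (cvgM (cu x) (cv1 x))).
- exact: (cvgD (cvgM (cu2 x) (cv x)) (cvgM (cu x) (cv2 x))).
- apply: (is_derive_eq (is_deriveM (du1 x) (dv1 x))).
  by rewrite /GRing.scale /=; ring.
- apply: (is_derive_eq (is_deriveM (du2 x) (dv2 x))).
  by rewrite /GRing.scale /=; ring.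
Qed.

Lemma C1_comp u u1 u2 (phi dphi : R -> R) : C1 u u1 u2 ->
  (forall s, is_derive s (1 : R) phi (dphi s)) -> continuous dphi ->
  C1 (fun x => phi (u x)) (fun x => dphi (u x) * u1 x) (fun x => dphi (u x) * u2 x).
Proof.
move=> [cu cu1 cu2 du1 du2] dp cp.
have cphi : continuous phi.
  move=> s; apply: differentiable_continuous.
  by apply/derivable1_diffP; case: (dp s).
have chain w d x : is_derive x w u d -> is_derive x w (fun y => phi (u y)) (dphi (u x) * d).
  move=> dw.
  have dw' : is_derive (0 : R) (1 : R) (fun s => u (x + s *: w)) d.
    by apply/is_derive_line; rewrite scale0r addr0.
  have dx : is_derive (u (x + (0 : R) *: w)) (1 : R) phi (dphi (u x)).
    by rewrite scale0r addr0; exact: dp.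
  have := @is_derive1_comp R phi (fun s => u (x + s *: w)) 0 _ _ dx dw'.
  move=> H; have : is_derive (x + (0 : R) *: w) w (fun y => phi (u y)) (dphi (u x) * d).
    by apply/is_derive_line; apply: (is_derive_eq H).
  by rewrite scale0r addr0.
split => x; [exact: (continuous_comp (cu x) (cphi _)) | | | |].
- apply: cvgM; last exact: cu1. exact: (continuous_comp (cu x) (cp _)).
- apply: cvgM; last exact: cu2. exact: (continuous_comp (cu x) (cp _)).
- exact: chain.
- exact: chain.
Qed.

Lemma eq_C1 u u1 u2 v v1 v2 : C1 u u1 u2 -> u =1 v -> u1 =1 v1 -> u2 =1 v2 ->
  C1 v v1 v2.
Proof. by move=> cu /funext <- /funext <- /funext <-. Qed.

Lemma C1V u u1 u2 : C1 u u1 u2 -> (forall x, u x != 0) ->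
  C1 (fun x => (u x)^-1) (fun x => - (u x) ^- 2 * u1 x) (fun x => - (u x) ^- 2 * u2 x).
Proof.
move=> [cu cu1 cu2 du1 du2] u0; split => x.
- by apply: cvgV => //; exact: cu.
- apply: cvgM; last exact: cu1.
  apply: cvgN; apply: cvgV; first by rewrite expf_neq0.
  rewrite expr2; under eq_fun do rewrite expr2; apply: cvgM; exact: cu.
- apply: cvgM; last exact: cu2.
  apply: cvgN; apply: cvgV; first by rewrite expf_neq0.
  rewrite expr2; under eq_fun do rewrite expr2; apply: cvgM; exact: cu.
- have [ex de] := du1 x; apply: DeriveDef; first exact: derivableV.
  by rewrite deriveV// de.
- have [ex de] := du2 x; apply: DeriveDef; first exact: derivableV.
  by rewrite deriveV// de.
Qed.

Lemma FTC (F f : R -> R) (a b : R) : a <= b ->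
  (forall s, is_derive s (1 : R) F (f s)) -> continuous f ->
  (\int[@lebesgue_measure R]_(x in `[a, b]) (f x)%:E = (F b - F a)%:E)%E.
Proof.
rewrite le_eqVlt => /orP[/eqP <-|ab] dF cf.
  by rewrite set_itv1 integral_set1 subrr.
have cF : continuous F.
  move=> s; apply: differentiable_continuous.
  by apply/derivable1_diffP; case: (dF s).
rewrite EFinB; apply: continuous_FTC2 => //.
- exact: continuous_subspaceT.
- split => [x _| |]; first by case: (dF x).
  + by apply: cvg_at_right_filter; exact: cF.
  + by apply: cvg_at_left_filter; exact: cF.
- by move=> x _; rewrite derive1E; case: (dF x).
Qed.
End C1.

(** * The divergence theorem on a triangle *)

Section Triangle.
Context {R : realType}.
Local Notation mR := (measurableTypeR R).
Local Notation mu := (@lebesgue_measure R).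
Local Notation mP := (mR * mR)%type.
Implicit Types (a e f x : R * R).

Definition cross e f : R := e.1 * f.2 - e.2 * f.1.

(** The open triangle a, a + e, a + f, through the coordinates of x - a in the
    basis e, f given by Cramer's rule. *)
Definition triangle a e f : set (R * R) :=
  [set x | [/\ 0 < cross (x - a) f / cross e f, 0 < cross e (x - a) / cross e f
    & cross (x - a) f / cross e f + cross e (x - a) / cross e f < 1]].

Lemma triangle_coord a e f (s t : R) : cross e f != 0 ->
  triangle a e f (a + s *: e + t *: f) <-> [/\ 0 < s, 0 < t & s + t < 1].
Proof.
move=> J0; rewrite /triangle /=.
have -> : cross (a + s *: e + t *: f - a) f / cross e f = s.
  by move: J0; rewrite /cross /= /GRing.scale /= => J0; field.
have -> : cross e (a + s *: e + t *: f - a) / cross e f = t.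
  by move: J0; rewrite /cross /= /GRing.scale /= => J0; field.
by [].
Qed.

Lemma cross_coord a e f x : cross e f != 0 ->
  x = a + (cross (x - a) f / cross e f) *: e + (cross e (x - a) / cross e f) *: f.
Proof.
case: x a e f => [x1 x2] [a1 a2] [e1 e2] [f1 f2]; rewrite /cross /= => J0.
by congr pair; rewrite /= /GRing.scale /=; field.
Qed.

Lemma crossNE e f : cross f e = - cross e f.
Proof. by rewrite /cross; ring. Qed.

Lemma triangleC a e f : triangle a e f = triangle a f e.
Proof.
rewrite /triangle; apply/seteqP; split => x /=;
 rewrite !(crossNE f e) !(crossNE (x - a)) !invrN !mulrNN 1?addrC; move=> [A B C]; split => //;
 by rewrite ?(crossNE (x - a)) ?(crossNE _ (x - a)) ?mulrNN ?mulNr in A B C *; lra.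
Qed.

Lemma continuous_crossl a e (k : R) : continuous (fun x => cross (x - a) e / k).
Proof.
have -> : (fun x => cross (x - a) e / k) = lin (e.2 / k) (- e.1 / k) ((- a.1 * e.2 + a.2 * e.1) / k).
  by apply/funext => x; rewrite /cross /lin /=; ring.
exact: continuous_lin.
Qed.

Lemma continuous_crossr a e (k : R) : continuous (fun x => cross e (x - a) / k).
Proof.
have -> : (fun x => cross e (x - a) / k) = lin (- e.2 / k) (e.1 / k) ((a.1 * e.2 - a.2 * e.1) / k).
  by apply/funext => x; rewrite /cross /lin /=; ring.
exact: continuous_lin.
Qed.

Lemma open_superlevel (g : R * R -> R) (c : R) : continuous g -> open [set x | c < g x].
Proof.
move=> cg; rewrite (_ : [set x | _] = g @^-1` [set y | c < y])//.
by apply: open_comp; [move=> x _; exact: cg|exact: open_gt].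
Qed.

Lemma open_sublevel (g : R * R -> R) (c : R) : continuous g -> open [set x | g x < c].
Proof.
move=> cg; rewrite (_ : [set x | _] = g @^-1` [set y | y < c])//.
by apply: open_comp; [move=> x _; exact: cg|exact: open_lt].
Qed.

Lemma open_triangle a e f : open (triangle a e f).
Proof.
have -> : triangle a e f = [set x | 0 < cross (x - a) f / cross e f] `&`
    [set x | 0 < cross e (x - a) / cross e f] `&`
    [set x | cross (x - a) f / cross e f + cross e (x - a) / cross e f < 1].
  by apply/seteqP; split => x /= [] => [A B C|[A B] C].
apply: openI; first apply: openI.
- by apply: open_superlevel; exact: continuous_crossl.
- by apply: open_superlevel; exact: continuous_crossr.
- apply: open_sublevel => x; apply: cvgD; [exact: continuous_crossl|exact: continuous_crossr].
Qed.

Lemma measurable_triangle a e f : measurable (triangle a e f : set mP).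
Proof. by apply: open_measurable_plane; exact: open_triangle. Qed.

Lemma continuous_segment (g : R * R -> R) (a v : R * R) : continuous g ->
  continuous (fun s : R => g (a + s *: v)).
Proof.
move=> cg s; apply: continuous_comp; last exact: cg.
by apply: cvgD; [exact: cvg_cst|apply: cvgZr_tmp; exact: cvg_id].
Qed.

(** At a + s e + t f the integrand is the derivative in s of P, so the fundamental
    theorem of calculus computes the inner integral; positivity is for Tonelli. *)
Lemma ge0_integral_triangle_derive a e f P P1 P2 : cross e f != 0 ->
  C1 P P1 P2 ->
  (forall x, triangle a e f x -> 0 <= e.1 * P1 x + e.2 * P2 x) ->
  (\int[area]_(x in triangle a e f) (e.1 * P1 x + e.2 * P2 x)%:E =
   `|cross e f|%:E * \int[mu]_(t in `[0%R, 1%R])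
      (P (a + e + t *: (f - e)) - P (a + t *: f))%:E)%E.
Proof.
move=> J0 cP; pose g x := e.1 * P1 x + e.2 * P2 x; rewrite -/(g _) => g0.
have cg : continuous g.
  move=> x; case: cP => _ c1 c2 _ _.
  by apply: cvgD; (apply: cvgM; first exact: cvg_cst); [exact: c1|exact: c2].
set T := triangle a e f in g0 *.
pose G := (EFin \o g) \_ T.
have mT : measurable (T : set mP) by exact: measurable_triangle.
have GE s t : G (a + s *: e + t *: f) =
    if (0 < s) && (0 < t) && (s + t < 1) then (g (a + s *: e + t *: f))%:E else 0%E.
  rewrite /G patchE; case: ifPn => [|h].
    by move=> /set_mem /triangle_coord - /(_ J0) [-> -> ->].
  case: ifP => // /andP[/andP[s0 t0] st1].
  by rewrite mem_set in h => //; apply/triangle_coord.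
rewrite integral_mkcond -/G (ge0_integral_plane_affine G a e f)//; last 2 first.
- apply/(measurable_restrictT _ _).1 => //.
  by apply/measurable_EFinP; apply: continuous_measurable_plane.
- move=> x; rewrite /G patchE; case: ifPn => // /set_mem Tx; by rewrite lee_fin g0.
congr (_ * _)%E.
have sE s t : a + s *: e + t *: f = a + t *: f + s *: e by rewrite addrAC.
pose h t := P (a + e + t *: (f - e)) - P (a + t *: f).
have inner t : 0 < t < 1 -> (\int[mu]_s G (a + s *: e + t *: f)%R = (h t)%:E)%E.
  move=> /andP[t0 t1].
  transitivity (\int[mu]_(s in `[0%R, (1 - t)%R]) (g (a + t *: f + s *: e)%R)%:E)%E.
    rewrite integral_itv_bndoo; last first.
      apply/measurable_EFinP; apply: measurable_funTS; apply: continuous_measurable_fun.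
      exact: continuous_segment.
    rewrite [RHS]integral_mkcond; apply: eq_integral => s _; rewrite GE patchE.
    have -> : (s \in `]0, (1 - t)[%classic) = (0 < s) && (s < 1 - t).
      by apply/idP/idP => [/set_mem|k]; rewrite /= ?in_itv//; apply/mem_set; rewrite /= in_itv.
    by rewrite t0 andbT ltrBrDr sE.
  have dF s : is_derive s (1 : R) (fun s => P (a + t *: f + s *: e)) (g (a + t *: f + s *: e)).
    exact: (C1_line P P1 P2).
  have t1' : 0 <= 1 - t by rewrite subr_ge0 ltW.
  rewrite (FTC _ _ _ _ t1' dF); last exact: continuous_segment.
  congr (_%:E); rewrite /h scale0r addr0; congr (P _ - _).
  by rewrite scalerBr scalerBl scale1r addrACA -!addrA; congr (_ + _); rewrite addrC addrA.
have outer t : ~~ (0 < t < 1) -> (\int[mu]_s G (a + s *: e + t *: f)%R = 0)%E.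
  move=> t01; apply: integral0_eq => s _; rewrite GE; case: ifP => // /andP[/andP[s0 t0] st1].
  by exfalso; move: t01; rewrite t0 /= => /negP; apply; lra.
rewrite [RHS]integral_itv_bndoo; last first.
  apply/measurable_EFinP; apply: measurable_funTS; apply: continuous_measurable_fun => t.
  by case: cP => cP _ _ _ _; apply: cvgB; exact: continuous_segment.
rewrite [RHS]integral_mkcond; apply: eq_integral => t _; rewrite patchE.
case: ifPn => ht; last first.
  by rewrite outer//; apply: contra ht => k; apply/mem_set; rewrite /= in_itv.
by rewrite inner//; move/set_mem: ht; rewrite /= in_itv.
Qed.
End Triangle.

Section DivTriangle.
Context {R : realType}.
Local Notation mR := (measurableTypeR R).
Local Notation mu := (@lebesgue_measure R).
Local Notation mP := (mR * mR)%type.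
Implicit Types (a e f x : R * R) (B : set (R * R)).

Definition box (m : R) : set (R * R) := `[- m, m] `*` `[- m, m].

Lemma area_bounded_lty B m : measurable (B : set mP) -> B `<=` box m ->
  (area B < +oo)%E.
Proof.
move=> mB Bm.
have mm : measurable (box m : set mP) by apply: measurableX; exact: measurable_itv.
apply: (@le_lt_trans _ _ (area (box m))).
  by apply: le_measure => //; rewrite inE.
have -> : area (box m) = (mu `[(- m)%R, m] * mu `[(- m)%R, m])%E.
  by apply: product_measure1E; exact: measurable_itv.
by rewrite lte_mul_pinfty// ?lebesgue_measure_itv /= //; case: ifP => // _; rewrite -EFinB// ltry.
Qed.

Lemma bounded_continuous_box (g : R * R -> R) m : continuous g ->
  exists2 M : R, 0 <= M & forall x, box m x -> `|g x| <= M.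
Proof.
move=> cg.
have cb : compact (box m) by apply: compact_setX; exact: segment_compact.
have : compact (g @` box m).
  by apply: continuous_compact => //; exact: continuous_subspaceT.
move=> /compact_bounded [M [_ HM]].
exists (`|M| + 1) => // x bx; apply: HM; last by exists x.
by rewrite (le_lt_trans (ler_norm _))// ltrDl.
Qed.

Lemma integrable_bounded_continuous B m (g : R * R -> R) :
  measurable (B : set mP) -> B `<=` box m -> continuous g ->
  area.-integrable B (EFin \o g).
Proof.
move=> mB Bm cg; apply: measurable_bounded_integrable => //.
- exact: area_bounded_lty Bm.
- exact: continuous_measurable_plane.
- have [M M0 HM] := bounded_continuous_box g m cg.
  exists M; split; first exact: num_real.
  by move=> x Mx y By; apply: le_trans (HM _ (Bm _ By)) _; exact: ltW.
Qed.

Definition I01 (h : R -> R) : R := Rintegral mu `[0, 1] h.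

Lemma integrable01 (h : R -> R) : continuous h -> mu.-integrable `[0, 1] (EFin \o h).
Proof.
move=> ch; apply: continuous_compact_integrable; first exact: segment_compact.
exact: continuous_subspaceT.
Qed.

Lemma I01E (h : R -> R) : continuous h ->
  (\int[mu]_(t in `[0%R, 1%R]) (h t)%:E = (I01 h)%:E)%E.
Proof.
move=> ch; rewrite /I01 /Rintegral fineK//.
by apply: integrable_fin_num => //; exact: integrable01.
Qed.

Lemma I01D (h k : R -> R) : continuous h -> continuous k ->
  I01 (fun t => h t + k t) = I01 h + I01 k.
Proof. by move=> ch ck; apply: RintegralD => //; exact: integrable01. Qed.

Lemma I01B (h k : R -> R) : continuous h -> continuous k ->
  I01 (fun t => h t - k t) = I01 h - I01 k.
Proof. by move=> ch ck; apply: RintegralB => //; exact: integrable01. Qed.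

Lemma I01Z (c : R) (h : R -> R) : continuous h ->
  I01 (fun t => c * h t) = c * I01 h.
Proof. by move=> ch; apply: RintegralZl => //; exact: integrable01. Qed.

Lemma I01N (h : R -> R) : continuous h -> I01 (fun t => - h t) = - I01 h.
Proof.
move=> ch; rewrite -mulN1r -I01Z//; congr I01.
by apply/funext => t; rewrite mulN1r.
Qed.

Lemma le_I01 (h k : R -> R) : continuous h -> continuous k ->
  (forall t, 0 <= t <= 1 -> h t <= k t) -> I01 h <= I01 k.
Proof.
by move=> ch ck hk; apply: le_Rintegral => //; exact: integrable01.
Qed.

Lemma eq_I01 (h k : R -> R) : (forall t, 0 <= t <= 1 -> h t = k t) -> I01 h = I01 k.
Proof.
by move=> hk; apply: eq_Rintegral => t /set_mem /=; rewrite in_itv; exact: hk.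
Qed.

Lemma I01_rev (h : R -> R) : continuous h -> I01 (fun t => h (1 - t)) = I01 h.
Proof.
move=> ch; rewrite /I01 [RHS]Rintegration_by_substitution_onem ?ler01 ?lexx//; last exact: continuous_subspaceT.
by rewrite unstable.onem1.
Qed.

Lemma I01_FTC (F f : R -> R) : (forall s, is_derive s (1 : R) F (f s)) ->
  continuous f -> I01 f = F 1 - F 0.
Proof.
move=> dF cf; apply: EFin_inj; rewrite -I01E//.
exact: (FTC F f 0 1 ler01 dF cf).
Qed.

Lemma triangle_box a e f : cross e f != 0 ->
  exists m, triangle a e f `<=` box m.
Proof.
move=> J0.
exists (`|a.1| + `|e.1| + `|f.1| + (`|a.2| + `|e.2| + `|f.2|)) => x Tx.
move: (Tx); rewrite (cross_coord a e f x J0); move: (_ / _) => s; move: (_ / _) => t.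
move=> /(triangle_coord a e f _ _ J0)[s0 t0 st].
have H (p q r : R) : `|p + s * q + t * r| <= `|p| + `|q| + `|r|.
  apply: (le_trans (ler_normD _ _)); apply: lerD; last first.
    by rewrite normrM gtr0_norm// ler_piMl//; lra.
  apply: (le_trans (ler_normD _ _)); apply: lerD => //.
  by rewrite normrM gtr0_norm// ler_piMl//; lra.
split; rewrite /= in_itv /= -ler_norml; apply: (le_trans (H _ _ _)).
- by rewrite lerDl !addr_ge0.
- by rewrite lerDr !addr_ge0.
Qed.

Lemma integrable_triangle a e f (g : R * R -> R) : cross e f != 0 -> continuous g ->
  area.-integrable (triangle a e f) (EFin \o g).
Proof.
move=> J0 cg; have [m Tm] := triangle_box a e f J0.
by apply: (integrable_bounded_continuous _ m) => //; exact: measurable_triangle.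
Qed.

Lemma continuous_edges (P : R * R -> R) (a e f : R * R) : continuous P ->
  continuous (fun t : R => P (a + e + t *: (f - e)) - P (a + t *: f)).
Proof. by move=> cP t; apply: cvgB; exact: (continuous_segment P). Qed.

Lemma ge0_Rintegral_triangle_derive a e f P P1 P2 : cross e f != 0 -> C1 P P1 P2 ->
  (forall x, triangle a e f x -> 0 <= e.1 * P1 x + e.2 * P2 x) ->
  Rintegral area (triangle a e f) (fun x => e.1 * P1 x + e.2 * P2 x) =
   `|cross e f| * I01 (fun t => P (a + e + t *: (f - e)) - P (a + t *: f)).
Proof.
move=> J0 cP D0; rewrite /Rintegral (ge0_integral_triangle_derive _ _ _ P)//.
have cP0 : continuous P by case: cP.
by rewrite I01E//; exact: continuous_edges.
Qed.

Lemma continuous_directional P P1 P2 e : C1 P P1 P2 ->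
  continuous (fun x : R * R => e.1 * P1 x + e.2 * P2 x).
Proof.
case => _ c1 c2 _ _ x.
by apply: cvgD; (apply: cvgM; first exact: cvg_cst); [exact: c1|exact: c2].
Qed.

(** A linear function with a large constant derivative along e reduces this to
    the nonnegative case: it is added to P, then subtracted from both sides. *)
Lemma Rintegral_triangle_derive a e f P P1 P2 : cross e f != 0 -> C1 P P1 P2 ->
  Rintegral area (triangle a e f) (fun x => e.1 * P1 x + e.2 * P2 x) =
   `|cross e f| * I01 (fun t => P (a + e + t *: (f - e)) - P (a + t *: f)).
Proof.
move=> J0 cP; have [m Tm] := triangle_box a e f J0.
have cD := continuous_directional P P1 P2 e cP.
have [M M0 HM] := bounded_continuous_box _ m cD.
have e0 : e.1 ^+ 2 + e.2 ^+ 2 != 0.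
  apply: contra_neq J0; rewrite /cross => h.
  have [-> ->] : e.1 = 0 /\ e.2 = 0 by split; nra.
  by ring.
pose n := e.1 ^+ 2 + e.2 ^+ 2.
pose L := lin (M * (e.1 / n)) (M * (e.2 / n)) 0.
have cL : C1 L (cst (M * (e.1 / n))) (cst (M * (e.2 / n))) by exact: C1_lin.
have DL x : e.1 * cst (M * (e.1 / n)) x + e.2 * cst (M * (e.2 / n)) x = M.
  by rewrite /= /n; field.
have cM : continuous (fun _ : R * R => M) by exact: cst_continuous.
have intM : area.-integrable (triangle a e f) (EFin \o (fun _ : R * R => M)).
  exact: (integrable_triangle a e f (fun _ => M) J0 cM).
have := ge0_Rintegral_triangle_derive a e f _ _ _ J0 (C1D _ _ _ _ _ _ cP cL).
have -> : (fun x => e.1 * (P1 x + cst (M * (e.1 / n)) x) + e.2 * (P2 x + cst (M * (e.2 / n)) x))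
  = (fun x => (e.1 * P1 x + e.2 * P2 x) + M).
  by apply/funext => x; rewrite -[in RHS](DL x); ring.
rewrite RintegralD//; last 2 first.
- exact: measurable_triangle.
- exact: integrable_triangle.
have := ge0_Rintegral_triangle_derive a e f _ _ _ J0 cL.
have -> : (fun x => e.1 * cst (M * (e.1 / n)) x + e.2 * cst (M * (e.2 / n)) x) = (fun _ => M).
  by apply/funext => x; rewrite DL.
have D0 x : triangle a e f x ->
    0 <= e.1 * cst (M * (e.1 / n)) x + e.2 * cst (M * (e.2 / n)) x by rewrite DL.
move=> /(_ D0) -> H.
have cP0 : continuous P by case: cP.
have cL0 : continuous L by case: cL.
apply: (addIr (`|cross e f| * I01 (fun t => L (a + e + t *: (f - e)) - L (a + t *: f)))).
rewrite H; last first.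
  move=> x Tx; have := HM x (Tm x Tx); rewrite ler_norml => /andP[h _].
  have := DL x; rewrite /=; lra.
rewrite -mulrDr -I01D; [|exact: continuous_edges|exact: continuous_edges].
by congr (_ * I01 _); apply/funext => t; ring.
Qed.

(** The normal points to the right of the direction from p to q, hence outwards
    when a region is run through counterclockwise. *)
Definition flux (F1 F2 : R * R -> R) (p q : R * R) : R :=
  I01 (fun t => F1 (p + t *: (q - p)) * (q.2 - p.2) -
                F2 (p + t *: (q - p)) * (q.1 - p.1)).

Lemma continuous_flux (F1 F2 : R * R -> R) (p q : R * R) :
  continuous F1 -> continuous F2 ->
  continuous (fun t : R => F1 (p + t *: (q - p)) * (q.2 - p.2) -
                F2 (p + t *: (q - p)) * (q.1 - p.1)).
Proof.
move=> c1 c2 t; apply: cvgB; apply: cvgM; try exact: cvg_cst.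
  exact: (continuous_segment F1).
exact: (continuous_segment F2).
Qed.

Lemma fluxC (F1 F2 : R * R -> R) (p q : R * R) :
  continuous F1 -> continuous F2 -> flux F1 F2 q p = - flux F1 F2 p q.
Proof.
move=> c1 c2; rewrite /flux -I01_rev; last exact: continuous_flux.
rewrite -I01N; last exact: continuous_flux.
apply: eq_I01 => t _.
have -> : q + (1 - t) *: (p - q) = p + t *: (q - p).
  case: p q => [p1 p2] [q1 q2].
  by congr pair; rewrite /= /GRing.scale /=; ring.
by ring.
Qed.

(** Up to the factor cross e f, the divergence is the derivative along e of
    f.2 F1 - f.1 F2 plus the derivative along f of e.1 F2 - e.2 F1. *)
Lemma divergence_triangle a e f F1 F2 F11 F12 F21 F22 : cross e f != 0 ->
  C1 F1 F11 F12 -> C1 F2 F21 F22 ->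
  Rintegral area (triangle a e f) (fun x => F11 x + F22 x) =
  Num.sg (cross e f) * (flux F1 F2 a (a + e) + flux F1 F2 (a + e) (a + f)
    + flux F1 F2 (a + f) a).
Proof.
move=> J0 c1 c2; set J := cross e f in J0 *.
have cF1 : continuous F1 by case: c1.
have cF2 : continuous F2 by case: c2.
have C1lc (p q : R) : C1 (fun x => p * F1 x + q * F2 x)
    (fun x => p * F11 x + q * F21 x) (fun x => p * F12 x + q * F22 x).
  apply: eq_C1 (C1D _ _ _ _ _ _ (C1M _ _ _ _ _ _ (C1_lin 0 0 p) c1)
    (C1M _ _ _ _ _ _ (C1_lin 0 0 q) c2)) _ _ _ => x; rewrite /lin /=; ring.
have HP := Rintegral_triangle_derive a e f _ _ _ J0 (C1lc f.2 (- f.1)).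
have J0' : cross f e != 0 by rewrite crossNE oppr_eq0.
have HQ := Rintegral_triangle_derive a f e _ _ _ J0' (C1lc (- e.2) e.1).
rewrite (triangleC a f e) crossNE normrN -/J in HQ; rewrite -/J in HP.
have iP := integrable_triangle a e f _ J0 (continuous_directional _ _ _ e (C1lc f.2 (- f.1))).
have iQ := integrable_triangle a e f _ J0 (continuous_directional _ _ _ f (C1lc (- e.2) e.1)).
have mT := measurable_triangle a e f.
have c11 : continuous (fun x => F11 x + F22 x).
  by move=> x; case: c1 => _ k1 _ _ _; case: c2 => _ _ k2 _ _; apply: cvgD; [exact: k1|exact: k2].
have E : J * Rintegral area (triangle a e f) (fun x => F11 x + F22 x) =
    `|J| * (flux F1 F2 a (a + e) + flux F1 F2 (a + e) (a + f) + flux F1 F2 (a + f) a).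
  rewrite -RintegralZl//; last exact: integrable_triangle.
  transitivity (Rintegral area (triangle a e f) (fun x =>
    (e.1 * (f.2 * F11 x + - f.1 * F21 x) + e.2 * (f.2 * F12 x + - f.1 * F22 x)) +
    (f.1 * (- e.2 * F11 x + e.1 * F21 x) + f.2 * (- e.2 * F12 x + e.1 * F22 x)))).
    by congr Rintegral; apply/funext => x; rewrite /J /cross; ring.
  rewrite RintegralD// HP HQ -mulrDr; congr (_ * _).
  pose P x := f.2 * F1 x + - f.1 * F2 x; pose Q x := - e.2 * F1 x + e.1 * F2 x.
  have cP : continuous P by case: (C1lc f.2 (- f.1)).
  have cQ : continuous Q by case: (C1lc (- e.2) e.1).
  rewrite (fluxC _ _ a (a + f))// -/(P _) -/(Q _).
  rewrite (I01B (fun t => P (a + e + t *: (f - e))) (fun t => P (a + t *: f)));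
    [|exact: continuous_segment|exact: continuous_segment].
  rewrite (I01B (fun t => Q (a + f + t *: (e - f))) (fun t => Q (a + t *: e)));
    [|exact: continuous_segment|exact: continuous_segment].
  rewrite -(I01_rev (fun t => Q (a + f + t *: (e - f)))); last exact: continuous_segment.
  have -> : flux F1 F2 a (a + e) = - I01 (fun t => Q (a + t *: e)).
    rewrite -I01N; last exact: continuous_segment.
    by apply: eq_I01 => t _; rewrite (addrC a e) addrK /Q /=; ring.
  have -> : flux F1 F2 a (a + f) = I01 (fun t => P (a + t *: f)).
    by apply: eq_I01 => t _; rewrite (addrC a f) addrK /P /=; ring.
  have -> : flux F1 F2 (a + e) (a + f) = I01 (fun t => P (a + e + t *: (f - e))) +
      I01 (fun t => Q (a + f + (1 - t) *: (e - f))).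
    have sE t : a + f + (1 - t) *: (e - f) = a + e + t *: (f - e).
      case: a e f {J J0 C1lc HP J0' HQ iP iQ mT P Q cP cQ} => [a1 a2] [e1 e2] [f1 f2].
      by congr pair; rewrite /= /GRing.scale /=; ring.
    rewrite -I01D; last 2 first.
    - exact: continuous_segment.
    - by under eq_fun do rewrite sE; exact: continuous_segment.
    apply: eq_I01 => t _; rewrite sE /P /Q.
    have -> : a + f - (a + e) = f - e by rewrite opprD addrACA subrr add0r.
    by rewrite /=; ring.
  by ring.
rewrite -[LHS](mulKf J0) E mulrA; congr (_ * _).
by rewrite normrEsg mulrCA mulVf// mulr1.
Qed.
End DivTriangle.

(** * Topology of a quadrilateral curve *)

Section QuadTopology.
Context {R : realType}.
Implicit Types (a b c d x y : R * R) (K : set (R * R)).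

(** Twice the signed area of the triangle a b x: positive for x on the left of the
    line from a to b. *)
Definition orient a b x : R := cross (b - a) (x - a).

Definition segment a b : set (R * R) :=
  [set x | exists2 t, 0 <= t <= 1 & x = a + t *: (b - a)].

Definition quad_curve a b c d : set (R * R) :=
  segment a b `|` segment b c `|` segment c d `|` segment d a.

Lemma orientE a b x :
  orient a b x = lin (a.2 - b.2) (b.1 - a.1) (a.1 * b.2 - a.2 * b.1) x.
Proof. by rewrite /orient /cross /lin /=; ring. Qed.

Lemma continuous_orient a b : continuous (orient a b).
Proof.
have -> : orient a b = lin (a.2 - b.2) (b.1 - a.1) (a.1 * b.2 - a.2 * b.1).
  by apply/funext => x; exact: orientE.
exact: continuous_lin.
Qed.

Lemma orient_segment a b p q (t : R) :
  orient a b (p + t *: (q - p)) = (1 - t) * orient a b p + t * orient a b q.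
Proof. by rewrite /orient /cross /= /GRing.scale /=; ring. Qed.

Lemma lin_segment (k l m : R) p q (t : R) :
  lin k l m (p + t *: (q - p)) = (1 - t) * lin k l m p + t * lin k l m q.
Proof. by rewrite /lin /= /GRing.scale /=; ring. Qed.

Lemma orient_sum a b c x :
  orient a b x + orient b c x + orient c a x = orient a b c.
Proof. by rewrite /orient /cross /=; ring. Qed.

Lemma orient_cyc a b c : orient b c a = orient a b c.
Proof. by rewrite /orient /cross /=; ring. Qed.

Lemma orientC a b x : orient b a x = - orient a b x.
Proof. by rewrite /orient /cross /=; ring. Qed.

Lemma orient_swap a b c : orient a c b = - orient a b c.
Proof. by rewrite /orient /cross /=; ring. Qed.

Lemma orient0l a b : orient a b a = 0.
Proof. by rewrite /orient /cross /=; ring. Qed.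

Lemma orient0r a b : orient a b b = 0.
Proof. by rewrite /orient /cross /=; ring. Qed.

Lemma barycentric a b c x : orient a b c != 0 ->
  x = a + (orient c a x / orient a b c) *: (b - a) +
      (orient a b x / orient a b c) *: (c - a).
Proof.
move=> D0; rewrite {1}(cross_coord a (b - a) (c - a) x D0).
congr (_ + _ *: _ + _ *: _); congr (_ / _).
by rewrite /orient /cross /=; ring.
Qed.

Lemma segment_of_orient0 a b c x : 0 < orient a b c -> orient a b x = 0 ->
  0 <= orient b c x -> 0 <= orient c a x -> segment a b x.
Proof.
move=> D0 E h1 h2; exists (orient c a x / orient a b c).
  rewrite divr_ge0 ?(ltW D0)//= ler_pdivrMr// mul1r.
  by have := orient_sum a b c x; lra.
rewrite {1}(barycentric a b c x (lt0r_neq0 D0)) E mul0r scale0r addr0.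
by [].
Qed.

(** When the diagonal a c separates b from d, the last set adds the open diagonal
    to the two triangles on its sides. *)
Definition quad_region a b c d : set (R * R) :=
  [set x | [/\ 0 < orient a b x, 0 < orient b c x & orient a c x < 0]] `|`
  [set x | [/\ 0 < orient c d x, 0 < orient d a x & 0 < orient a c x]] `|`
  [set x | [/\ 0 < orient a b x, 0 < orient b c x, 0 < orient c d x & 0 < orient d a x]].

Lemma open_orient_gt0 a b : open [set x | 0 < orient a b x].
Proof. by apply: open_superlevel; exact: continuous_orient. Qed.

Lemma open_orient_lt0 a b : open [set x | orient a b x < 0].
Proof. by apply: open_sublevel; exact: continuous_orient. Qed.

Lemma open_quad_region a b c d : open (quad_region a b c d).
Proof.
apply: openU; first apply: openU.
- rewrite (_ : [set x | _] = [set x | 0 < orient a b x] `&` [set x | 0 < orient b c x] `&`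
    [set x | orient a c x < 0]); last by apply/seteqP; split => x /= [] => [? ? ?|[? ?] ?].
  by apply: openI; [apply: openI; exact: open_orient_gt0|exact: open_orient_lt0].
- rewrite (_ : [set x | _] = [set x | 0 < orient c d x] `&` [set x | 0 < orient d a x] `&`
    [set x | 0 < orient a c x]); last by apply/seteqP; split => x /= [] => [? ? ?|[? ?] ?].
  by apply: openI; [apply: openI; exact: open_orient_gt0|exact: open_orient_gt0].
- rewrite (_ : [set x | _] = [set x | 0 < orient a b x] `&` [set x | 0 < orient b c x] `&`
    [set x | 0 < orient c d x] `&` [set x | 0 < orient d a x]); last first.
    by apply/seteqP; split => x /= [] => [? ? ? ?|[[? ?] ?] ?].
  by repeat apply: openI; exact: open_orient_gt0.
Qed.

Lemma closed_orient_ge0 a b : closed [set x | 0 <= orient a b x].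
Proof.
rewrite (_ : [set x | _] = ~` [set x | orient a b x < 0]); last first.
  by apply/seteqP; split => x /=; rewrite leNgt => /negP.
by apply: open_closedC; exact: open_orient_lt0.
Qed.

Lemma orient_on_segment a b c x : 0 <= orient a b c -> segment a b x ->
  [/\ orient a b x = 0, 0 <= orient b c x & 0 <= orient c a x].
Proof.
move=> D0 [t /andP[t0 t1] ->]; rewrite !orient_segment.
rewrite (orient0l a b) (orient0r a b) (orient0l b c) (orient0r c a) (orient_cyc b c a) !(orient_cyc a b c).
by split; rewrite ?mulr0 ?addr0 ?add0r// mulr_ge0// subr_ge0.
Qed.

Lemma quad_region_curve a b c d x : 0 < orient a b c -> 0 < orient c d a ->
  quad_region a b c d x -> ~ quad_curve a b c d x.
Proof.
move=> D1 D3 H K.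
have D1' : 0 <= orient b c a by rewrite orient_cyc ltW.
have D3' : 0 <= orient d a c by rewrite orient_cyc ltW.
case: K => [[[]|]|].
- move=> /(orient_on_segment _ _ _ _ (ltW D1)) [E _]; rewrite (orientC a c) oppr_ge0 => h.
  by case: H => [[[]|[]]|[]]; lra.
- move=> /(orient_on_segment _ _ _ _ D1') [E]; rewrite (orientC a c) oppr_ge0 => h _.
  by case: H => [[[]|[]]|[]]; lra.
- move=> /(orient_on_segment _ _ _ _ (ltW D3)) [E _ h].
  by case: H => [[[]|[]]|[]]; lra.
- move=> /(orient_on_segment _ _ _ _ D3') [E h _].
  by case: H => [[[]|[]]|[]]; lra.
Qed.

Lemma quad_region_rot a b c d x : quad_region a b c d x <-> quad_region c d a b x.
Proof.
by split => -[[[h1 h2 h3]|[h1 h2 h3]]|[h1 h2 h3 h4]];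
  [left; right|left; left|right|left; right|left; left|right];
  split => //; move: h3; rewrite (orientC a c) ?oppr_gt0 ?oppr_lt0.
Qed.

Lemma quad_curve_rot a b c d x : quad_curve a b c d x <-> quad_curve c d a b x.
Proof.
split => -[[[h|h]|h]|h];
  [left; right|right|left; left; left|left; left; right
  |left; right|right|left; left; left|left; left; right] => //.
Qed.

Lemma closed_triangle_quad_region a b c d x : 0 < orient a b c -> 0 < orient c d a ->
  0 <= orient a b x -> 0 <= orient b c x -> orient a c x <= 0 ->
  ~ quad_curve a b c d x -> quad_region a b c d x.
Proof.
move=> D1 D3 h1 h2 h3 nKy.
have h3' : 0 <= orient c a x by rewrite orientC oppr_ge0.
move: h1; rewrite le_eqVlt => /orP[/eqP h1|h1].
  by case: nKy; left; left; left; apply: segment_of_orient0 D1 _ h2 h3'.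
move: h2; rewrite le_eqVlt => /orP[/eqP h2|h2].
  case: nKy; left; left; right; apply: (@segment_of_orient0 b c a) => //.
    by rewrite orient_cyc.
  exact: ltW.
move: h3; rewrite le_eqVlt => /orP[/eqP h3|h3]; last by left; left; split.
have := barycentric a b c x (lt0r_neq0 D1).
rewrite orientC h3 oppr0 mul0r scale0r addr0 => xE.
right; split => //; rewrite xE orient_segment.
  rewrite (orient0l c d) mulr0 addr0 mulr_gt0// subr_gt0 ltr_pdivrMr// mul1r.
  by have := orient_sum a b c x; rewrite (orientC a c) h3; lra.
by rewrite (orient0r d a) mulr0 add0r (orient_cyc c d a) mulr_gt0// divr_gt0.
Qed.

(** The boundary of the region lies on the curve, so off the curve the region is
    closed as well as open. *)
Lemma closure_quad_region a b c d x : 0 < orient a b c -> 0 < orient c d a ->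
  closure (quad_region a b c d) x -> ~ quad_curve a b c d x ->
  quad_region a b c d x.
Proof.
move=> D1 D3 cx nK.
have tri : 0 <= orient a b x -> 0 <= orient b c x -> orient a c x <= 0 ->
  quad_region a b c d x by move=> *; exact: closed_triangle_quad_region.
have tri' : 0 <= orient c d x -> 0 <= orient d a x -> 0 <= orient a c x ->
    quad_region a b c d x.
  move=> h1 h2 h3; apply/quad_region_rot; apply: closed_triangle_quad_region => //.
    by rewrite orientC oppr_le0.
  by move/quad_curve_rot.
pose C1 := [set y | 0 <= orient a b y] `&` [set y | 0 <= orient b c y] `&`
  [set y | 0 <= orient c a y].
pose C2 := [set y | 0 <= orient c d y] `&` [set y | 0 <= orient d a y] `&`
  [set y | 0 <= orient a c y].
pose C3 := [set y | 0 <= orient a b y] `&` [set y | 0 <= orient b c y] `&`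
  ([set y | 0 <= orient c d y] `&` [set y | 0 <= orient d a y]).
have : (C1 `|` C2 `|` C3) x.
  have cl : closed (C1 `|` C2 `|` C3).
    by apply: closedU; first apply: closedU; repeat apply: closedI; exact: closed_orient_ge0.
  rewrite ((closure_id _).1 cl); move: x cx {nK tri tri'}; apply: closure_subset => y.
  move=> [[[h1 h2 h3]|[h1 h2 h3]]|[h1 h2 h3 h4]].
  - by left; left; split => /=; [split => /=; exact: ltW|rewrite orientC oppr_ge0 ltW].
  - by left; right; split => /=; [split => /=; exact: ltW|exact: ltW].
  - by right; split => /=; split => /=; exact: ltW.
move=> [[[[/= h1 h2] h3]|[[/= h1 h2] h3]]|[[/= h1 h2] [h3 h4]]].
- by apply: tri => //; rewrite orientC oppr_le0.
- exact: tri'.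
- by have [h|h] := leP (orient a c x) 0; [exact: tri|apply: tri' => //; exact: ltW].
Qed.

(** Off K the set O is open and closed, and a connected set that meets it cannot
    leave it. *)
Lemma component_subset_clopen K (O : set (R * R)) x : open O ->
  (forall y, closure O y -> ~ K y -> O y) -> O x -> ~ K x ->
  connected_component (~` K) x `<=` O.
Proof.
move=> oO cO Ox nKx; set C := connected_component _ _.
have cC : connected C by exact: component_connected.
have E : C `&` O = C.
  apply: cC.
  - by exists x; split => //; apply: connected_component_refl.
  - by exists O.
  - exists (closure O); first exact: closed_closure.
    apply/seteqP; split => y [Cy Oy]; split => //; first exact: subset_closure.
    by apply: cO => //; exact: (connected_component_sub Cy).
by move=> y; rewrite -E => -[].
Qed.

(** The ray from x orthogonal to the line and away from K avoids K. *)
Lemma halfplane_unbounded_component K (k l m : R) x : (k != 0) || (l != 0) ->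
  (forall y, K y -> 0 <= lin k l m y) -> lin k l m x < 0 ->
  ~ bounded_set (connected_component (~` K) x).
Proof.
move=> kl HK hx [M [_ HM]].
pose v : R * R := (- k, - l).
pose r (t : R) := x + t *: v.
have n0 : 0 < k ^+ 2 + l ^+ 2.
  by case/orP: kl => h; [apply: ltr_wpDr|apply: ltr_wpDl];
    rewrite ?sqr_ge0// lt_neqAle sqr_ge0 eq_sym expf_neq0.
have lr t : lin k l m (r t) = lin k l m x - t * (k ^+ 2 + l ^+ 2).
  by rewrite /r /v /lin /= /GRing.scale /=; ring.
have sub : r @` `[0, +oo[ `<=` connected_component (~` K) x.
  apply: connected_component_max.
  - by exists 0; rewrite ?/r ?scale0r ?addr0//= in_itv /= lexx.
  - move=> _ [t /= + <-]; rewrite in_itv /= andbT => t0 /HK; rewrite lr.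
    by apply/negP; rewrite -ltNge; have := mulr_ge0 t0 (ltW n0); lra.
  - apply: connected_continuous_connected.
      exact/connected_intervalP/interval_is_interval.
    apply: continuous_subspaceT => s; rewrite /r.
    by apply: cvgD; [exact: cvg_cst|apply: cvgZr_tmp; exact: cvg_id].
have v0 : 0 < `|v|.
  rewrite normr_gt0; apply: contraTneq kl => -[/eqP + /eqP].
  by rewrite !oppr_eq0 => -> ->.
pose t := (`|M| + 2 + `|x|) / `|v|.
have t0 : 0 <= t by rewrite divr_ge0// !addr_ge0.
have Ct : connected_component (~` K) x (r t).
  by apply: sub; exists t => //; rewrite /= in_itv /= t0.
have Mlt : M < `|M| + 1 by rewrite (le_lt_trans (ler_norm _))// ltrDl.
have := HM _ Mlt (r t) Ct; apply/negP; rewrite -ltNge.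
have : `|t *: v| <= `|r t| + `|x|.
  by rewrite -[X in `|X|](addrK x) (addrC _ x) (le_trans (ler_normB _ _)).
rewrite normrZ (ger0_norm t0) /t mulfVK ?lt0r_neq0//; lra.
Qed.

Lemma quad_region_box a b c d : 0 < orient a b c -> 0 < orient c d a ->
  bounded_set (quad_region a b c d).
Proof.
move=> D1 D3.
have tri p q r x : 0 < orient p q r -> 0 <= orient p q x -> 0 <= orient q r x ->
    0 <= orient r p x -> `|x| <= `|p| + `|q - p| + `|r - p|.
  move=> D h1 h2 h3; rewrite [X in `|X|](barycentric p q r x (lt0r_neq0 D)).
  have S := orient_sum p q r x.
  apply: (le_trans (ler_normD _ _)); apply: lerD; last first.
    by rewrite normrZ ler_piMl// ger0_norm ?divr_ge0 ?(ltW D)// ler_pdivrMr//; lra.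
  apply: (le_trans (ler_normD _ _)); apply: lerD => //.
  by rewrite normrZ ler_piMl// ger0_norm ?divr_ge0 ?(ltW D)// ler_pdivrMr//; lra.
exists (`|a| + `|b - a| + `|c - a| + (`|c| + `|d - c| + `|a - c|)); split.
  exact: num_real.
move=> M HM x Hx; apply: (le_trans _ (ltW HM)).
suff [h|h] : `|x| <= `|a| + `|b - a| + `|c - a| \/ `|x| <= `|c| + `|d - c| + `|a - c|.
- by apply: (le_trans h); rewrite lerDl !addr_ge0.
- by apply: (le_trans h); rewrite lerDr !addr_ge0.
case: Hx => [[[h1 h2 h3]|[h1 h2 h3]]|[h1 h2 h3 h4]].
- left; apply: tri => //; [exact: ltW|exact: ltW|].
  by rewrite orientC oppr_ge0 ltW.
- by right; apply: tri => //; exact: ltW.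
- have [h|h] := leP (orient a c x) 0.
    left; apply: tri => //; [exact: ltW|exact: ltW|].
    by rewrite orientC oppr_ge0.
  by right; apply: tri => //; exact: ltW.
Qed.

Definition curve_interior K : set (R * R) :=
  [set x | (~` K) x /\ bounded_set (connected_component (~` K) x)].

Lemma quad_region_interior a b c d : 0 < orient a b c -> 0 < orient c d a ->
  quad_region a b c d `<=` curve_interior (quad_curve a b c d).
Proof.
move=> D1 D3 x Hx; have nK := quad_region_curve _ _ _ _ _ D1 D3 Hx; split => //.
have [M [Mr HM]] := quad_region_box a b c d D1 D3.
exists M; split => // N MN y Cy; apply: HM MN _ _.
apply: (component_subset_clopen (quad_curve a b c d) _ x) Cy => //.
  exact: open_quad_region.
by move=> z; exact: closure_quad_region.
Qed.

(** A point beyond a side line is in an unbounded component, and the points of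
    the region on a side line are on the curve. *)
Lemma convex_quad_interior a b c d : 0 < orient a b c -> 0 < orient b c d ->
  0 < orient c d a -> 0 < orient d a b ->
  curve_interior (quad_curve a b c d) =
  [set x | [/\ 0 < orient a b x, 0 < orient b c x, 0 < orient c d x & 0 < orient d a x]].
Proof.
move=> D1 D2 D3 D0; apply/seteqP; split => x; last first.
  by move=> [h1 h2 h3 h4]; apply: quad_region_interior => //; right.
have seg_ge0 p q r s y : 0 <= orient p q r -> 0 <= orient p q s -> segment r s y -> 0 <= orient p q y.
  move=> h1 h2 [t /andP[t0 t1] ->]; rewrite orient_segment.
  by rewrite addr_ge0// mulr_ge0// subr_ge0.
have curve_ge0 p q r s y : 0 <= orient p q r -> 0 <= orient p q s -> quad_curve p q r s y ->
    0 <= orient p q y.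
  move=> h1 h2 [[[|]|]|]; apply: seg_ge0; rewrite ?orient0l ?orient0r//.
move=> [nK bK].
have ge0 p q : p != q -> (forall y, quad_curve a b c d y -> 0 <= orient p q y) -> 0 <= orient p q x.
  move=> pq H; rewrite leNgt; apply/negP => hx; move: bK.
  apply: (@halfplane_unbounded_component _ (p.2 - q.2) (q.1 - p.1) (p.1 * q.2 - p.2 * q.1)).
  - apply: contraNT pq; rewrite negb_or !negbK !subr_eq0 => /andP[/eqP h1 /eqP h2].
    by rewrite (surjective_pairing p) (surjective_pairing q) h1 h2.
  - by move=> y /H; rewrite orientE.
  - by rewrite -orientE.
have neq p q r : 0 < orient p q r -> p != q.
  by apply: contraTneq => ->; rewrite /orient /cross subrr /= !mul0r subrr ltxx.
have K1 y : quad_curve a b c d y -> quad_curve b c d a y.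
  by move=> [[[h|h]|h]|h]; [right|left; left; left|left; left; right|left; right].
have K2 y : quad_curve a b c d y -> quad_curve c d a b y by move/quad_curve_rot.
have K3 y : quad_curve a b c d y -> quad_curve d a b c y.
  by move=> [[[h|h]|h]|h]; [left; left; right|left; right|right|left; left; left].
have g1 : 0 <= orient a b x.
  apply: (ge0 _ _ (neq _ _ _ D1)) => y; apply: curve_ge0; first exact: ltW.
  by rewrite (orient_cyc d a b) ltW.
have g2 : 0 <= orient b c x.
  apply: (ge0 _ _ (neq _ _ _ D2)) => y /K1; apply: curve_ge0; first exact: ltW.
  by rewrite (orient_cyc a b c) ltW.
have g3 : 0 <= orient c d x.
  apply: (ge0 _ _ (neq _ _ _ D3)) => y /K2; apply: curve_ge0; first exact: ltW.
  by rewrite (orient_cyc b c d) ltW.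
have g4 : 0 <= orient d a x.
  apply: (ge0 _ _ (neq _ _ _ D0)) => y /K3; apply: curve_ge0; first exact: ltW.
  by rewrite (orient_cyc c d a) ltW.
have strict p q r s : 0 < orient p q r -> 0 < orient s p q -> 0 <= orient p q x ->
    0 <= orient q r x -> 0 <= orient s p x -> ~ segment p q x -> 0 < orient p q x.
  move=> E1 E0; rewrite le_eqVlt => /orP[/eqP E|//] h1 h2 []; move: h1 h2.
  have := barycentric p q r x (lt0r_neq0 E1).
  rewrite -E mul0r scale0r addr0; move: (_ / _) => t ->; rewrite !orient_segment.
  rewrite (orient_cyc p q r) (orient0l q r) (orient0r s p) !mulr0 addr0 add0r.
  rewrite !(pmulr_lge0 _ E1, pmulr_lge0 _ E0) subr_ge0 => t1 t0.
  by exists t; rewrite ?t0.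
split; [apply: (strict _ _ c d)|apply: (strict _ _ d a)|apply: (strict _ _ a b)|
  apply: (strict _ _ b c)] => // h; apply: nK.
- by left; left; left.
- by left; left; right.
- by left; right.
- by right.
Qed.
End QuadTopology.

(** * Simple quadrilaterals *)

Section SimpleQuad.
Context {R : realType}.
Implicit Types (a b c d x y : R * R) (p : 'I_4 -> R * R).

Definition q0 : 'I_4 := @Ordinal 4 0 isT.
Definition q1 : 'I_4 := @Ordinal 4 1 isT.
Definition q2 : 'I_4 := @Ordinal 4 2 isT.
Definition q3 : 'I_4 := @Ordinal 4 3 isT.

Lemma ordS_q0 : ordS q0 = q1. Proof. exact: val_inj. Qed.
Lemma ordS_q1 : ordS q1 = q2. Proof. exact: val_inj. Qed.
Lemma ordS_q2 : ordS q2 = q3. Proof. exact: val_inj. Qed.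
Lemma ordS_q3 : ordS q3 = q0. Proof. exact: val_inj. Qed.
Definition ordSE := (ordS_q0, ordS_q1, ordS_q2, ordS_q3).

Lemma ord4P (P : 'I_4 -> Prop) : P q0 -> P q1 -> P q2 -> P q3 -> forall i, P i.
Proof.
move=> h0 h1 h2 h3 [[|[|[|[|//]]]] Hi].
- by rewrite (_ : Ordinal Hi = q0)//; exact: val_inj.
- by rewrite (_ : Ordinal Hi = q1)//; exact: val_inj.
- by rewrite (_ : Ordinal Hi = q2)//; exact: val_inj.
- by rewrite (_ : Ordinal Hi = q3)//; exact: val_inj.
Qed.

Lemma sum_ord4 (V : nmodType) (F : 'I_4 -> V) :
  \sum_i F i = F q0 + F q1 + F q2 + F q3.
Proof.
rewrite !big_ord_recr big_ord0 /= add0r.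
by congr (F _ + F _ + F _ + F _); exact: val_inj.
Qed.

Lemma polygon_curveE p :
  polygon_curve p = quad_curve (p q0) (p q1) (p q2) (p q3).
Proof.
apply/seteqP; split => x.
  move=> [i [t t01 ->]]; move: i; apply: ord4P; rewrite /side ordSE.
  - by left; left; left; exists t.
  - by left; left; right; exists t.
  - by left; right; exists t.
  - by right; exists t.
by move=> [[[]|]|] [t t01 ->]; [exists q0|exists q1|exists q2|exists q3];
  exists t => //; rewrite /side ordSE.
Qed.

Lemma polygon_interiorE p :
  polygon_interior p = curve_interior (quad_curve (p q0) (p q1) (p q2) (p q3)).
Proof. by rewrite /polygon_interior polygon_curveE. Qed.

Lemma simple_polygon_shift p : simple_polygon p -> simple_polygon (p \o @ordS 4).
Proof.
move=> sp i j s t hs ht E.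
by have [/ordS_inj -> ->] := sp (ordS i) (ordS j) s t hs ht E.
Qed.

Lemma polygon_curve_shift p : polygon_curve (p \o @ordS 4) = polygon_curve p.
Proof.
rewrite !polygon_curveE /= !ordSE; apply/seteqP; split => x [[[h|h]|h]|h].
all: by [left; left; left|left; left; right|left; right|right].
Qed.

Lemma polygon_interior_shift p : polygon_interior (p \o @ordS 4) = polygon_interior p.
Proof. by rewrite /polygon_interior polygon_curve_shift. Qed.

Lemma side_meet p (i j : 'I_4) (s t : R) : simple_polygon p -> i != j ->
  0 <= s < 1 -> 0 <= t < 1 -> side p i s = side p j t -> False.
Proof. by move=> sp /eqP ij hs ht E; apply: ij; have [] := sp i j s t hs ht E. Qed.

Lemma side_meet_close p (s t : R) : simple_polygon p -> 0 <= s <= 1 -> 0 <= t <= 1 ->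
  side p q1 s = side p q3 t -> False.
Proof.
move=> sp /andP[s0 s1] /andP[t0 t1] E.
have e1 i : side p i 1 = side p (ordS i) 0.
  by rewrite /side scale0r addr0 scale1r addrC subrK.
have l0 : 0 <= (0 : R) < 1 by rewrite lexx ltr01.
move: s1 t1; rewrite !le_eqVlt => /orP[/eqP ss|s1] /orP[/eqP tt|t1].
- move: E; rewrite ss tt !e1 ordSE ordSE; exact: side_meet.
- by move: E; rewrite ss e1 ordSE; apply: side_meet; rewrite // t0.
- by move: E; rewrite tt e1 ordSE; apply: side_meet; rewrite // s0.
- by move: E; apply: side_meet; rewrite // ?s0 ?t0.
Qed.

(** Let D_i be the value at vertex i. If D0 = D3 all four vanish; otherwise sides 1
    and 3 meet, at the parameters - D0 / (D3 - D0) and D2 / (D3 - D0). *)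
Lemma simple_no_cross p : simple_polygon p ->
  orient (p q3) (p q0) (p q1) <= 0 -> orient (p q0) (p q1) (p q2) <= 0 ->
  0 <= orient (p q1) (p q2) (p q3) -> 0 <= orient (p q2) (p q3) (p q0) ->
  [/\ orient (p q3) (p q0) (p q1) = 0, orient (p q0) (p q1) (p q2) = 0,
   orient (p q1) (p q2) (p q3) = 0 & orient (p q2) (p q3) (p q0) = 0].
Proof.
move=> sp; set D0 := orient (p q3) _ _; set D1 := orient (p q0) _ _.
set D2 := orient (p q1) _ _; set D3 := orient (p q2) _ _ => h0 h1 h2 h3.
have S : D0 + D2 = D1 + D3 by rewrite /D0 /D1 /D2 /D3 /orient /cross /=; ring.
have [E|ne] := eqVneq D3 D0; first by split; lra.
exfalso; have pos : 0 < D3 - D0 by rewrite subr_gt0 lt_neqAle eq_sym ne; lra.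
apply: (@side_meet_close p (- D0 / (D3 - D0)) (D2 / (D3 - D0)) sp).
- by rewrite divr_ge0 ?oppr_ge0 ?(ltW pos)//= ler_pdivrMr// mul1r; lra.
- by rewrite divr_ge0 ?(ltW pos)//= ler_pdivrMr// mul1r; lra.
rewrite /side !ordSE.
have ne' : D3 - D0 != 0 by rewrite lt0r_neq0.
move: ne' {S ne pos h0 h1 h2 h3}; rewrite /D0 /D2 /D3 /orient /cross.
case: (p q0) (p q1) (p q2) (p q3) => [a1 a2] [b1 b2] [c1 c2] [d1 d2] /= ne'.
by congr pair; rewrite /= /GRing.scale /=; field.
Qed.

(** All four vertices would be on one line. There, sides 1 and 3 must leave side 0
    at its two ends in opposite directions, and side 2 then runs over vertex 0. *)
Lemma simple_not_collinear p : simple_polygon p ->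
  orient (p q0) (p q1) (p q2) = 0 -> orient (p q3) (p q0) (p q1) = 0 -> False.
Proof.
move=> sp.
have l0 : 0 <= (0 : R) < 1 by rewrite lexx ltr01.
have ab : p q1 - p q0 != 0.
  apply/eqP => E; have E' : side p q0 0 = side p q0 (1 / 2) by rewrite /side ordSE E !scaler0.
  have h : 0 <= (1 / 2 : R) < 1 by lra.
  have [_] := sp q0 q0 0 (1 / 2) l0 h E'; lra.
have [n n1] : exists n : R * R, (p q1 - p q0).1 * n.1 + (p q1 - p q0).2 * n.2 = 1.
  set v := p q1 - p q0 in ab *.
  have v0 : v.1 ^+ 2 + v.2 ^+ 2 != 0.
    apply: contra ab => /eqP h; apply/eqP; rewrite (surjective_pairing v).
    have [-> ->] // : v.1 = 0 /\ v.2 = 0 by split; nra.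
  exists (v.1 / (v.1 ^+ 2 + v.2 ^+ 2), v.2 / (v.1 ^+ 2 + v.2 ^+ 2)) => /=; field; exact: v0.
have col x : orient (p q0) (p q1) x = 0 -> exists t, x = p q0 + t *: (p q1 - p q0).
  move=> h; exists ((x - p q0).1 * n.1 + (x - p q0).2 * n.2).
  move: n1 h; rewrite /orient /cross.
  case: (p q0) (p q1) x n => [a1 a2] [b1 b2] [x1 x2] [m1 m2] /= n1 h.
  congr pair; rewrite /= /GRing.scale /=; apply/eqP; rewrite -subr_eq0.
    rewrite (_ : _ - _ = (x1 - a1) * (1 - ((b1 - a1) * m1 + (b2 - a2) * m2))
      - m2 * ((b1 - a1) * (x2 - a2) - (b2 - a2) * (x1 - a1))); last by ring.
    by rewrite n1 h subrr !mulr0 subrr.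
  rewrite (_ : _ - _ = (x2 - a2) * (1 - ((b1 - a1) * m1 + (b2 - a2) * m2))
    + m1 * ((b1 - a1) * (x2 - a2) - (b2 - a2) * (x1 - a1))); last by ring.
  by rewrite n1 h subrr !mulr0 addr0.
move=> /col [xc cE]; rewrite -orient_cyc => /col [xd dE].
set v := p q1 - p q0 in ab cE dE.
have bE : p q1 = p q0 + 1 *: v by rewrite scale1r /v addrC subrK.
have sl (k m t : R) : (p q0 + k *: v) + t *: (p q0 + m *: v - (p q0 + k *: v)) =
    p q0 + (k + t * (m - k)) *: v.
  by rewrite opprD addrACA subrr add0r -scalerBl scalerA -addrA -scalerDl.
have s0 t : side p q0 t = p q0 + t *: v by rewrite /side ordSE.
have s1 t : side p q1 t = p q0 + (1 + t * (xc - 1)) *: v.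
  by rewrite /side ordSE cE bE sl.
have s2 t : side p q2 t = p q0 + (xc + t * (xd - xc)) *: v.
  by rewrite /side ordSE cE dE sl.
have s3 t : side p q3 t = p q0 + (xd + t * (0 - xd)) *: v.
  by rewrite /side ordSE dE; have := sl xd 0 t; rewrite scale0r addr0.
have h1 : 1 < xc.
  rewrite ltNge; apply/negP; rewrite le_eqVlt => /orP[/eqP E|lt1].
    apply: (@side_meet p q1 q2 0 0 sp) => //.
    by rewrite s1 s2 E !mul0r !addr0.
  (* side 1 turns back: it meets side 0 just before vertex 1 *)
  pose e := Num.min 1 (1 - xc) / 2.
  have e0 : 0 < e by rewrite /e divr_gt0// lt_min ltr01 subr_gt0.
  have m1 : Num.min 1 (1 - xc) <= 1 by rewrite ge_min lexx.
  have m2 : Num.min 1 (1 - xc) <= 1 - xc by rewrite ge_min lexx orbT.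
  have xp : 0 < 1 - xc by rewrite subr_gt0.
  apply: (@side_meet p q0 q1 (1 - e) (e / (1 - xc)) sp) => //.
  - by rewrite /e in e0 *; lra.
  - by rewrite divr_ge0 ?ltW//= ltr_pdivrMr// mul1r /e; lra.
  - rewrite s0 s1; congr (_ + _ *: _); field; lra.
have h2 : xd < 0.
  rewrite ltNge; apply/negP; rewrite le_eqVlt => /orP[/eqP E|lt1].
    apply: (@side_meet p q3 q0 0 0 sp) => //.
    by rewrite s3 s0 -E !mul0r !addr0.
  (* side 3 arrives from the inside: it meets side 0 just after vertex 0 *)
  pose e := Num.min 1 xd / 2.
  have e0 : 0 < e by rewrite /e divr_gt0// lt_min ltr01.
  have m1 : Num.min 1 xd <= 1 by rewrite ge_min lexx.
  have m2 : Num.min 1 xd <= xd by rewrite ge_min lexx orbT.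
  apply: (@side_meet p q0 q3 e (1 - e / xd) sp) => //.
  - by rewrite /e in e0 *; lra.
  - rewrite subr_ge0 ler_pdivrMr// mul1r gtrBl divr_gt0// andbT /e; lra.
  - by rewrite s0 s3; congr (_ + _ *: _); field; exact: lt0r_neq0.
apply: (@side_meet p q0 q2 0 (xc / (xc - xd)) sp) => //.
- have pos : 0 < xc - xd by lra.
  by rewrite divr_ge0 ?ltW//= ?ltr_pdivrMr// ?mul1r; lra.
- rewrite s0 s2; congr (_ + _ *: _); field; lra.
Qed.

Lemma simple_split_aux p : simple_polygon p ->
  orient (p q3) (p q0) (p q1) <= 0 -> orient (p q0) (p q1) (p q2) <= 0 ->
  0 <= orient (p q1) (p q2) (p q3) -> 0 <= orient (p q2) (p q3) (p q0) -> False.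
Proof.
move=> sp h0 h1 h2 h3; have [E0 E1 _ _] := simple_no_cross p sp h0 h1 h2 h3.
exact: (simple_not_collinear p sp E1 E0).
Qed.

(** Otherwise the signs at the vertices would be, up to a cyclic shift, those for
    which two opposite sides cross. *)
Lemma simple_split p : simple_polygon p ->
  0 < orient (p q0) (p q1) (p q2) * orient (p q2) (p q3) (p q0) \/
  0 < orient (p q3) (p q0) (p q1) * orient (p q1) (p q2) (p q3).
Proof.
move=> sp.
have [h|h1] := ltP 0 (orient (p q0) (p q1) (p q2) * orient (p q2) (p q3) (p q0)); first by left.
have [h|h0] := ltP 0 (orient (p q3) (p q0) (p q1) * orient (p q1) (p q2) (p q3)); first by right.
exfalso.
have sp1 := simple_polygon_shift _ sp; have sp2 := simple_polygon_shift _ sp1.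
have sp3 := simple_polygon_shift _ sp2.
have A0 := simple_split_aux _ sp; have A1 := simple_split_aux _ sp1.
have A2 := simple_split_aux _ sp2; have A3 := simple_split_aux _ sp3.
move: A1 A2 A3; rewrite /= !ordSE => A1 A2 A3.
have alt (x y : R) : x * y <= 0 -> (x <= 0 /\ 0 <= y) \/ (0 <= x /\ y <= 0).
  move=> xy; have [x0|x0] := leP x 0; have [y0|y0] := leP 0 y.
  - by left.
  - have [->|xn] := eqVneq x 0; first by right; rewrite lexx ltW.
    have : 0 < x * y by rewrite nmulr_rgt0// lt_neqAle xn x0.
    lra.
  - have [->|yn] := eqVneq y 0; first by right; rewrite lexx ltW.
    have : 0 < x * y by rewrite mulr_gt0// lt_neqAle eq_sym yn y0.
    lra.
  - by right; split; exact: ltW.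
by case: (alt _ _ h0) => -[? ?]; case: (alt _ _ h1) => -[? ?]; [apply: A0|apply: A3|apply: A1|apply: A2].
Qed.

Lemma closure_of_segment (S : set (R * R)) x w :
  (forall t, 0 < t <= 1 -> S (x + t *: (w - x))) -> closure S x.
Proof.
move=> H B nB.
have : \forall t \near (0 : R), B (x + t *: (w - x)).
  have c : {for 0, continuous (fun t : R => x + t *: (w - x))}.
    by apply: cvgD; [exact: cvg_cst|apply: cvgZr_tmp; exact: cvg_id].
  by apply: c; rewrite /= scale0r addr0.
move=> /nbhs_ballP [e /= e0 He].
pose t := Num.min 1 (e / 2).
have t0 : 0 < t by rewrite lt_min ltr01 divr_gt0.
have t1 : t <= 1 by rewrite ge_min lexx.
have te : t <= e / 2 by rewrite ge_min lexx orbT.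
exists (x + t *: (w - x)); split; first by apply: H; rewrite t0.
by apply: He; rewrite /ball /= sub0r normrN gtr0_norm//; lra.
Qed.

(** The segment from a vertex to the centroid runs inside the open triangle. *)
Lemma triangle_vertices a b c (S : set (R * R)) : 0 < orient a b c ->
  (forall x, 0 < orient a b x -> 0 < orient b c x -> orient a c x < 0 -> S x) ->
  [/\ closure S a, closure S b & closure S c].
Proof.
move=> D H; pose w : R * R := ((a.1 + b.1 + c.1) / 3, (a.2 + b.2 + c.2) / 3).
have wab : orient a b w = orient a b c / 3 by rewrite /w /orient /cross /=; field.
have wbc : orient b c w = orient a b c / 3 by rewrite /w /orient /cross /=; field.
have wac : orient a c w = - (orient a b c / 3) by rewrite /w /orient /cross /=; field.
have E1 := orient_cyc a b c; have E2 := orient_swap a b c.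
have E3 := orient0l a b; have E4 := orient0r a b; have E5 := orient0l b c.
have E6 := orient0r b c; have E7 := orient0l a c; have E8 := orient0r a c.
by split; apply: (@closure_of_segment _ _ w) => t /andP[t0 t1]; apply: H;
  rewrite orient_segment ?E3 ?E4 ?E5 ?E6 ?E7 ?E8 ?E1 ?E2 ?wab ?wbc ?wac; nra.
Qed.

Lemma quad_region_vertices a b c d : 0 < orient a b c -> 0 < orient c d a ->
  let I := curve_interior (quad_curve a b c d) in
  [/\ closure I a, closure I b, closure I c & closure I d].
Proof.
move=> D1 D3 I.
have sub := quad_region_interior a b c d D1 D3.
have [ca cb cc] : [/\ closure I a, closure I b & closure I c].
  by apply: triangle_vertices D1 _ => x h1 h2 h3; apply: sub; left; left.
have [_ cd _] : [/\ closure I c, closure I d & closure I a].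
  apply: triangle_vertices D3 _ => x h1 h2 h3; apply: sub; left; right; split => //.
  by rewrite -oppr_lt0 -orientC.
by [].
Qed.

Lemma quad_curve_rev a b c d : quad_curve a b c d = quad_curve a d c b.
Proof.
have seg x y z : segment x y z -> segment y x z.
  move=> [t /andP[t0 t1] ->]; exists (1 - t); first by rewrite subr_ge0 t1 lerBlDl lerDr.
  case: x y => [x1 x2] [y1 y2]; congr pair; rewrite /= /GRing.scale /=; ring.
apply/seteqP; split => x [[[h|h]|h]|h]; move/seg: h => h.
all: by [right|left; right|left; left; right|left; left; left].
Qed.

(** The two triangles on the sides of a separating diagonal are contained in the
    interior region and reach all the vertices. *)
Lemma simple_vertices p (i : 'I_4) : simple_polygon p -> closure (polygon_interior p) (p i).
Proof.
move=> sp.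
have main (q : 'I_4 -> R * R) : 0 < orient (q q0) (q q1) (q q2) * orient (q q2) (q q3) (q q0) ->
    forall j, closure (polygon_interior q) (q j).
  move=> h; rewrite polygon_interiorE.
  have [D1|D1] := ltP 0 (orient (q q0) (q q1) (q q2)).
    have D3 : 0 < orient (q q2) (q q3) (q q0) by rewrite pmulr_rgt0 in h.
    by have [? ? ? ?] := quad_region_vertices _ _ _ _ D1 D3; apply: ord4P.
  have D1' : orient (q q0) (q q1) (q q2) < 0.
    by rewrite lt_neqAle D1 andbT; apply: contraTneq h => ->; rewrite mul0r ltxx.
  have D3 : orient (q q2) (q q3) (q q0) < 0 by rewrite nmulr_rgt0 in h.
  have E1 : 0 < orient (q q0) (q q3) (q q2) by rewrite orient_swap -(orient_cyc (q q0)) oppr_gt0.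
  have E3 : 0 < orient (q q2) (q q1) (q q0) by rewrite orient_swap -(orient_cyc (q q2)) oppr_gt0.
  rewrite quad_curve_rev.
  by have [? ? ? ?] := quad_region_vertices _ _ _ _ E1 E3; apply: ord4P.
have [h|h] := simple_split p sp; first exact: main.
have h' : 0 < orient ((p \o @ordS 4) q0) ((p \o @ordS 4) q1) ((p \o @ordS 4) q2) *
    orient ((p \o @ordS 4) q2) ((p \o @ordS 4) q3) ((p \o @ordS 4) q0).
  by rewrite /= !ordSE mulrC.
have := main _ h' (ord_pred i); rewrite polygon_interior_shift /=.
by rewrite ord_predK.
Qed.
End SimpleQuad.

(** * The divergence theorem on a convex quadrilateral *)

Section DivQuad.
Context {R : realType}.
Local Notation mR := (measurableTypeR R).
Local Notation mu := (@lebesgue_measure R).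
Local Notation mP := (mR * mR)%type.
Implicit Types (a b c d x y : R * R) (p : 'I_4 -> R * R).

Lemma measurable_line a f : measurable ([set x | cross (x - a) f = 0] : set mP).
Proof.
rewrite (_ : [set x | _] = ~` ([set x | cross (x - a) f / 1 < 0] `|` [set x | 0 < cross (x - a) f / 1])).
  apply: measurableC; apply: measurableU; apply: open_measurable_plane.
    by apply: open_sublevel; exact: continuous_crossl.
  by apply: open_superlevel; exact: continuous_crossl.
apply/seteqP; split => x; rewrite /= divr1; first by move=> ->; rewrite ltxx => -[].
by move=> /not_orP [/negP + /negP]; rewrite -!leNgt => h1 h2; apply/eqP; rewrite eq_le h1 h2.
Qed.

(** With a coordinate axis along the line, each section across it is a point. *)
Lemma area_line a f e : cross e f != 0 ->
  area [set x | cross (x - a) f = 0] = 0%E.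
Proof.
move=> J0; set N := [set x | _].
have mN : measurable (N : set mP) by exact: measurable_line.
have := integral_indic area measurableT mN; rewrite setIT => <-.
have mI : measurable_fun [set: mP] (fun x => (\1_N x : R)%:E).
  by apply/measurable_EFinP; exact: measurable_indic.
have I0 z : (0 <= (\1_N z : R)%:E)%E by rewrite lee_fin.
rewrite (ge0_integral_plane_affine _ a e f mI I0 J0).
rewrite integral0_eq ?mule0// => t _.
rewrite (_ : (fun s => _) = (fun s : mR => (\1_[set (0:R)] s)%:E)); last first.
  apply/funext => s; congr (_%:E); rewrite !indicE; congr (nat_of_bool _)%:R.
  have E : cross (a + s *: e + t *: f - a) f = s * cross e f.
    by rewrite /cross /= /GRing.scale /=; ring.
  apply/idP/idP; rewrite !inE /N /= E; last by move=> ->; rewrite mul0r.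
  by move=> /eqP; rewrite mulf_eq0 (negbTE J0) orbF => /eqP.
rewrite integral_indic// setIT; exact: lebesgue_measure_set1.
Qed.

Lemma triangle_orient a b c x : 0 < orient a b c ->
  triangle a (b - a) (c - a) x <-> [/\ 0 < orient a b x, 0 < orient b c x & orient a c x < 0].
Proof.
move=> D; rewrite /triangle /= -/(orient a b c) -/(orient a b x).
have -> : cross (x - a) (c - a) = orient c a x by rewrite /orient /cross /=; ring.
have i0 : 0 < (orient a b c)^-1 by rewrite invr_gt0.
have S := orient_sum a b c x.
rewrite -mulrDl ltr_pdivrMr// mul1r !pmulr_lgt0// -oppr_lt0 -(orientC c a).
by split => -[h1 h2 h3]; split => //; lra.
Qed.

Lemma orient_bary (p q a b c x : R * R) : orient a b c * orient p q x =
  orient b c x * orient p q a + orient c a x * orient p q b + orient a b x * orient p q c.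
Proof. by rewrite /orient /cross /=; ring. Qed.

Definition ccw a b c d :=
  [/\ 0 < orient a b c, 0 < orient b c d, 0 < orient c d a & 0 < orient d a b].

Definition quad_inside a b c d : set (R * R) :=
  [set x | [/\ 0 < orient a b x, 0 < orient b c x, 0 < orient c d x & 0 < orient d a x]].

Lemma quad_inside_split a b c d : ccw a b c d ->
  quad_inside a b c d `\` [set x | cross (x - a) (c - a) = 0] =
  triangle a (b - a) (c - a) `|` triangle a (c - a) (d - a).
Proof.
move=> [D1 D2 D3 D0].
have D3' : 0 < orient a c d by rewrite -(orient_cyc a c d).
have E x : cross (x - a) (c - a) = - orient a c x by rewrite /orient /cross /=; ring.
apply/seteqP; split => x.
  move=> [[h1 h2 h3 h4]] /= /eqP; rewrite E oppr_eq0 neq_lt => /orP[h|h].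
    by left; apply/(triangle_orient _ _ _ _ D1).
  right; apply/(triangle_orient _ _ _ _ D3'); split => //.
  by rewrite orientC oppr_lt0.
move=> [/(triangle_orient _ _ _ _ D1)|/(triangle_orient _ _ _ _ D3')] [h1 h2 h3].
  have h3' : 0 < orient c a x by rewrite orientC oppr_gt0.
  have H := fun r s => orient_bary r s a b c x.
  split; last by rewrite /= E => /eqP; rewrite oppr_eq0 lt_eqF.
  split => //.
    rewrite -(pmulr_rgt0 _ D1) H (orient0l c d) mulr0 addr0 (orient_cyc b c d).
    by rewrite addr_gt0// mulr_gt0.
  rewrite -(pmulr_rgt0 _ D1) H (orient0r d a) mulr0 add0r (orient_cyc c d a).
  by rewrite addr_gt0// mulr_gt0.
have h3' : 0 < orient d a x by rewrite orientC oppr_gt0.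
have H := fun r s => orient_bary r s a c d x.
split; last by rewrite /= E => /eqP; rewrite oppr_eq0 gt_eqF.
split => //.
  rewrite -(pmulr_rgt0 _ D3') H (orient0l a b) mulr0 add0r (orient_cyc d a b).
  by rewrite addr_gt0// mulr_gt0.
rewrite -(pmulr_rgt0 _ D3') H (orient0r b c) mulr0 addr0 (orient_cyc a b c).
by rewrite addr_gt0// mulr_gt0.
Qed.

Lemma measurable_quad_inside a b c d : measurable (quad_inside a b c d : set mP).
Proof.
apply: open_measurable_plane.
rewrite (_ : quad_inside a b c d = [set x | 0 < orient a b x] `&` [set x | 0 < orient b c x] `&`
    [set x | 0 < orient c d x] `&` [set x | 0 < orient d a x]); last first.
  by apply/seteqP; split => x /= [] => [? ? ? ?|[[? ?] ?] ?].
by repeat apply: openI; exact: open_orient_gt0.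
Qed.

Lemma quad_inside_box a b c d : ccw a b c d -> exists m, quad_inside a b c d `<=` box m.
Proof.
move=> [D1 D2 D3 D0]; have [M [_ HM]] := quad_region_box a b c d D1 D3.
exists (`|M| + 1) => x Hx.
have : `|x| <= `|M| + 1 by apply: HM; [rewrite (le_lt_trans (ler_norm _))// ltrDl|right].
by rewrite /Num.norm /= ge_max => /andP[h1 h2]; split; rewrite /= in_itv /= -ler_norml.
Qed.

Lemma integrable_quad_inside a b c d (g : R * R -> R) : ccw a b c d -> continuous g ->
  area.-integrable (quad_inside a b c d) (EFin \o g).
Proof.
move=> cc cg; have [m Hm] := quad_inside_box a b c d cc.
by apply: (integrable_bounded_continuous _ m) => //; exact: measurable_quad_inside.
Qed.

(** A diagonal, which is a null set, cuts the region into two triangles, and the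
    fluxes through it cancel. *)
Lemma divergence_quad a b c d F1 F2 F11 F12 F21 F22 : ccw a b c d ->
  C1 F1 F11 F12 -> C1 F2 F21 F22 ->
  Rintegral area (quad_inside a b c d) (fun x => F11 x + F22 x) =
  flux F1 F2 a b + flux F1 F2 b c + flux F1 F2 c d + flux F1 F2 d a.
Proof.
move=> cc c1 c2; have [D1 D2 D3 D0] := cc.
have D3' : 0 < orient a c d by rewrite -(orient_cyc a c d).
have cF1 : continuous F1 by case: c1.
have cF2 : continuous F2 by case: c2.
have c11 : continuous (fun x => F11 x + F22 x).
  by move=> x; case: c1 => _ k1 _ _ _; case: c2 => _ _ k2 _ _; apply: cvgD; [exact: k1|exact: k2].
have mI := measurable_quad_inside a b c d.
have iI := integrable_quad_inside a b c d _ cc c11.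
pose N := [set x | cross (x - a) (c - a) = 0].
have N0 : area N = 0%E.
  by apply: (area_line a (c - a) (b - a)); rewrite -/(orient a b c) lt0r_neq0.
have mN : measurable (N : set mP) by exact: measurable_line.
rewrite [LHS]/Rintegral (negligible_integral mN)// quad_inside_split//.
rewrite -/(Rintegral _ _ _) Rintegral_setU; last 4 first.
- exact: measurable_triangle.
- exact: measurable_triangle.
- by rewrite -quad_inside_split//; apply: integrableS iI => //; exact: measurableD.
- rewrite disj_set2E; apply/eqP; rewrite -subset0 => x [].
  move=> /(triangle_orient _ _ _ _ D1)[_ _ h] /(triangle_orient _ _ _ _ D3')[h' _ _].
  by move: h; rewrite ltNge (ltW h').
rewrite (divergence_triangle a (b - a) (c - a) _ _ _ _ _ _ _ c1 c2); last by rewrite -/(orient a b c) lt0r_neq0.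
rewrite (divergence_triangle a (c - a) (d - a) _ _ _ _ _ _ _ c1 c2); last by rewrite -/(orient a c d) lt0r_neq0.
rewrite -/(orient a b c) -/(orient a c d) !gtr0_sg// !mul1r.
have sE y : a + (y - a) = y by rewrite addrC subrK.
rewrite !sE (fluxC F1 F2 a c)//; ring.
Qed.
End DivQuad.

(** * Upper bounds for the Robin eigenvalue from trial functions *)

Section Polygon4.
Context {R : realType}.
Local Notation mR := (measurableTypeR R).
Local Notation mu := (@lebesgue_measure R).
Local Notation mP := (mR * mR)%type.
Implicit Types (p : 'I_4 -> R * R) (e : R) (u phi : R * R -> R).

(** The sign e tells in which orientation p lists the vertices. *)
Definition convex_polygon e p : Prop :=
  (e = 1 /\ ccw (p q0) (p q1) (p q2) (p q3)) \/
  (e = -1 /\ ccw (p q0) (p q3) (p q2) (p q1)).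

(** Both orientations reduce to a counterclockwise list, because reversing a side
    changes the sign of the flux through it. *)
Lemma convex_polygon_interior e p : convex_polygon e p ->
  exists a b c d, [/\ ccw a b c d, polygon_interior p = quad_inside a b c d
    & forall F1 F2, continuous F1 -> continuous F2 ->
      e * (flux F1 F2 a b + flux F1 F2 b c + flux F1 F2 c d + flux F1 F2 d a) =
      \sum_i flux F1 F2 (p i) (p (ordS i))].
Proof.
move=> [[-> cc]|[-> cc]].
  exists (p q0), (p q1), (p q2), (p q3); split => //.
    by rewrite polygon_interiorE; case: (cc) => *; apply: convex_quad_interior.
  by move=> F1 F2 _ _; rewrite sum_ord4 !ordSE mul1r.
exists (p q0), (p q3), (p q2), (p q1); split => //.
  by rewrite polygon_interiorE quad_curve_rev; case: (cc) => *; apply: convex_quad_interior.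
move=> F1 F2 c1 c2; rewrite sum_ord4 !ordSE.
rewrite (fluxC F1 F2 (p q1) (p q2))// (fluxC F1 F2 (p q2) (p q3))//.
rewrite (fluxC F1 F2 (p q3) (p q0))// (fluxC F1 F2 (p q0) (p q1))//; ring.
Qed.

Lemma measurable_convex_polygon e p : convex_polygon e p ->
  measurable (polygon_interior p : set mP).
Proof.
move=> /convex_polygon_interior [a [b [c [d [_ -> _]]]]]; exact: measurable_quad_inside.
Qed.

Lemma integrable_convex_polygon e p (g : R * R -> R) : convex_polygon e p ->
  continuous g -> area.-integrable (polygon_interior p) (EFin \o g).
Proof.
move=> /convex_polygon_interior [a [b [c [d [cc -> _]]]]]; exact: integrable_quad_inside.
Qed.

Lemma divergence_polygon e p F1 F2 F11 F12 F21 F22 : convex_polygon e p ->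
  C1 F1 F11 F12 -> C1 F2 F21 F22 ->
  e * Rintegral area (polygon_interior p) (fun x => F11 x + F22 x) =
  \sum_i flux F1 F2 (p i) (p (ordS i)).
Proof.
move=> /convex_polygon_interior [a [b [c [d [cc -> H]]]]] c1 c2.
rewrite -H; [|by case: c1|by case: c2].
by rewrite (divergence_quad a b c d _ _ _ _ _ _ cc c1 c2).
Qed.

Lemma convex_polygon_sqr e p : convex_polygon e p -> e * e = 1.
Proof. by move=> [[-> _]|[-> _]]; rewrite ?mulrNN mulr1. Qed.

Lemma interior_curve_disjoint p x : polygon_interior p x -> ~ polygon_curve p x.
Proof. by case. Qed.

Lemma side_curve p i t : 0 <= t <= 1 -> polygon_curve p (side p i t).
Proof. by move=> ht; exists i, t. Qed.

Definition boundary_mass p (g : R * R -> R) : R :=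
  \sum_(i < 4) side_length p i * I01 (fun t => g (side p i t)).

Lemma boundary_integralE p (g : R * R -> R) : continuous g ->
  boundary_integral p (fun x => (g x)%:E) = (boundary_mass p g)%:E.
Proof.
move=> cg; rewrite /boundary_integral /boundary_mass -sumEFin.
apply: eq_bigr => i _; rewrite I01E ?EFinM//; exact: continuous_segment.
Qed.

(** Divergence theorem for u phi along each coordinate axis: phi vanishes on the
    curve, which does not meet the interior region. *)
Lemma test_function_weak_gradient e p u u1 u2 : convex_polygon e p -> C1 u u1 u2 ->
  weak_gradient (polygon_interior p) u u1 u2.
Proof.
move=> cp cu phi [smooth [K [_ KO phi0]]].
have cphi := Ck1_C1 _ (smooth 1%N).
have cpr := C1M _ _ _ _ _ _ cu cphi.
have c0 := C1_lin 0 0 (0 : R).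
have e0 : e != 0 by apply/eqP => E; have := convex_polygon_sqr _ _ cp; rewrite E mul0r => /eqP; rewrite eq_sym oner_eq0.
have zero i t : 0 <= t <= 1 -> u (p i + t *: (p (ordS i) - p i)) * phi (p i + t *: (p (ordS i) - p i)) = 0.
  move=> ht; rewrite phi0 ?mulr0// => /KO /interior_curve_disjoint; apply.
  exact: side_curve.
have I0 : I01 (fun=> 0 : R) = 0.
  by rewrite /I01 Rintegral_cst ?mul0r//.
have l0 x : lin 0 0 (0 : R) x = 0 by rewrite /lin !mul0r !addr0.
have cf : continuous phi by case: cphi.
have cu0 : continuous u by case: cu.
have [cu1 cu2] : continuous u1 /\ continuous u2 by case: cu.
have [cf1 cf2] : continuous (partial1 phi) /\ continuous (partial2 phi) by case: cphi.
have int (g h : R * R -> R) : continuous g -> continuous h ->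
    area.-integrable (polygon_interior p) (EFin \o (fun x => g x * h x)).
  by move=> cg ch; apply: (integrable_convex_polygon _ _ _ cp) => x; exact: (cvgM (cg x) (ch x)).
have mO := measurable_convex_polygon _ _ cp.
split.
- have := divergence_polygon e p _ _ _ _ _ _ cp cpr c0.
  rewrite big1 => [|i _]; last first.
    by rewrite /flux -[RHS]I0; apply: eq_I01 => t ht; rewrite zero// l0; ring.
  move=> /eqP; rewrite mulf_eq0 (negbTE e0) /= => /eqP E.
  apply/eqP; rewrite -addr_eq0 -RintegralD//; [|exact: int|exact: int].
  by rewrite -E; apply/eqP; congr Rintegral; apply/funext => x /=; ring.
- have := divergence_polygon e p _ _ _ _ _ _ cp c0 cpr.
  rewrite big1 => [|i _]; last first.
    by rewrite /flux -[RHS]I0; apply: eq_I01 => t ht; rewrite zero// l0; ring.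
  move=> /eqP; rewrite mulf_eq0 (negbTE e0) /= => /eqP E.
  apply/eqP; rewrite -addr_eq0 -RintegralD//; [|exact: int|exact: int].
  by rewrite -E; apply/eqP; congr Rintegral; apply/funext => x /=; ring.
Qed.

Lemma continuous_sqr u : continuous u -> continuous (fun x => u x ^+ 2).
Proof.
move=> cu x; apply: (@continuous_comp _ _ _ u (fun y => y ^+ 2)); first exact: cu.
exact: exprn_continuous.
Qed.

Lemma in_L2_continuous e p u : convex_polygon e p -> continuous u ->
  in_L2 (polygon_interior p) u.
Proof.
move=> cp cu; have mO := measurable_convex_polygon _ _ cp; split.
  exact: continuous_measurable_plane.
have := integrable_convex_polygon e p _ cp (continuous_sqr _ cu).
by move=> /integrable_lty; apply.
Qed.

Lemma trace_C1 e p u u1 u2 : convex_polygon e p -> C1 u u1 u2 -> trace p u u1 u2 u.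
Proof.
move=> cp cu; have cu0 : continuous u by case: cu.
have [p1 p2] := C1_partial _ _ _ cu.
have sub0 w : L2_cvg (polygon_interior p) (fun=> w) w.
  rewrite /L2_cvg; under eq_fun do under eq_integral do rewrite subrr expr0n /=.
  by rewrite integral0; exact: cvg_cst.
split; first split.
- move=> i; apply: measurable_funTS; apply: continuous_measurable_fun.
  exact: continuous_segment.
- by rewrite boundary_integralE ?ltry//; exact: continuous_sqr.
exists (fun=> u); split => [m||||].
- exact: C1_Ck1 cu.
- exact: sub0.
- by rewrite -p1; exact: sub0.
- by rewrite -p2; exact: sub0.
- under eq_fun do under eq_fun do rewrite subrr expr0n /=.
  rewrite (boundary_integralE p (fun=> 0)); last exact: cst_continuous.
  rewrite /boundary_mass big1; first exact: cvg_cst.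
  by move=> i _; rewrite /I01 Rintegral_cst ?mul0r ?mulr0.
Qed.

Lemma Rintegral_sqr_gt0 (O : set (R * R)) u : measurable (O : set mP) ->
  in_L2 O u -> ~ {ae area, forall x, O x -> u x = 0} ->
  0 < Rintegral area O (fun x => u x ^+ 2).
Proof.
move=> mO [mu' fin] nae; rewrite lt_neqAle Rintegral_ge0 ?andbT; last by move=> x _; exact: sqr_ge0.
apply/eqP => E; apply: nae.
have E' : (\int[area]_(x in O) `|((u x) ^+ 2)%:E| = 0)%E.
  transitivity (\int[area]_(x in O) ((u x) ^+ 2)%:E)%E.
    by apply: eq_integral => x _; rewrite gee0_abs// lee_fin sqr_ge0.
  rewrite -[LHS]fineK; last first.
    by rewrite ge0_fin_numE// integral_ge0// => x _; rewrite lee_fin sqr_ge0.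
  exact: (congr1 EFin (esym E)).
have := (ae_eq_integral_abs area mO _).1 E'.
move=> H; have {H} : ae_eq area O (fun x => ((u x) ^+ 2)%:E) (cst 0%E).
  by apply: H; apply/measurable_EFinP; exact: measurable_funX.
apply: filterS => x H Ox; move: (H Ox) => /= [] /eqP; rewrite sqrf_eq0 => /eqP //.
Qed.

(** The divergence of u grad u is |grad u|^2 + kap u^2, so the energy of u is the
    flux of u grad u minus kap times the integral of u^2. *)
Lemma robin_eigenvalue_upper e p u u1 u2 u11 u12 u21 u22 (kap b A : R) :
  convex_polygon e p -> 0 < A -> area (polygon_interior p) = A%:E ->
  C1 u u1 u2 -> C1 u1 u11 u12 -> C1 u2 u21 u22 ->
  (forall x, u11 x + u22 x = kap * u x) -> (forall x, 0 < u x) ->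
  e * (\sum_i flux (fun x => u x * u1 x) (fun x => u x * u2 x) (p i) (p (ordS i)))
    <= b * boundary_mass p (fun x => u x ^+ 2) ->
  (robin_eigenvalue p (- b) <= (- kap)%:E)%E.
Proof.
move=> cp A0 areaA cu cu1 cu2 pde u0 bd.
have cu' : continuous u by case: cu.
have [cu1' cu2'] : continuous u1 /\ continuous u2 by case: cu.
have mO := measurable_convex_polygon _ _ cp.
have nae : ~ {ae area, forall x, polygon_interior p x -> u x = 0}.
  move=> [N [mN N0 HN]]; have : (A%:E <= 0)%E.
    rewrite -areaA -N0; apply: le_measure; rewrite ?inE// => x Ox; apply: HN => /= /(_ Ox).
    by move=> E; have := u0 x; rewrite E ltxx.
  by rewrite lee_fin leNgt A0.
apply: (@le_trans _ _ ((rayleigh_quotient p (- b) u u1 u2 u)%:E)).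
  apply: ereal_inf_lbound; exists u, u1, u2, u; split => //.
  - split; [exact: in_L2_continuous cp cu'|exact: in_L2_continuous cp cu1'
      |exact: in_L2_continuous cp cu2'|exact: test_function_weak_gradient cp cu].
  - exact: trace_C1 cp cu.
have csq (w : R * R -> R) : continuous w -> area.-integrable (polygon_interior p) (EFin \o (fun x => w x ^+ 2)).
  by move=> cw; apply: (integrable_convex_polygon _ _ _ cp); exact: continuous_sqr.
have mass0 : 0 < Rintegral area (polygon_interior p) (fun x => u x ^+ 2).
  exact: (Rintegral_sqr_gt0 _ _ mO (in_L2_continuous _ _ _ cp cu') nae).
rewrite lee_fin /rayleigh_quotient ler_pdivrMr//.
rewrite (boundary_integralE p (fun x => u x ^+ 2)) /=; last exact: continuous_sqr.
have cF1 := C1M _ _ _ _ _ _ cu cu1; have cF2 := C1M _ _ _ _ _ _ cu cu2.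
have := divergence_polygon e p _ _ _ _ _ _ cp cF1 cF2.
move=> /(congr1 ( *%R e)); rewrite mulrA (convex_polygon_sqr _ _ cp) mul1r => E.
move: bd; rewrite -E.
have -> : (fun x => u1 x * u1 x + u x * u11 x + (u2 x * u2 x + u x * u22 x)) =
    (fun x => (u1 x ^+ 2 + u2 x ^+ 2) + kap * u x ^+ 2).
  apply/funext => x; transitivity (u1 x ^+ 2 + u2 x ^+ 2 + u x * (u11 x + u22 x)); first ring.
  by rewrite pde; ring.
have csum : continuous (fun x => u1 x ^+ 2 + u2 x ^+ 2).
  by move=> x; apply: (cvgD (continuous_sqr _ cu1' x) (continuous_sqr _ cu2' x)).
rewrite RintegralD//; last 2 first.
- exact: integrable_convex_polygon cp csum.
- by apply: (integrable_convex_polygon _ _ _ cp) => x; apply: cvgM; [exact: cvg_cst|exact: continuous_sqr].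
rewrite RintegralZl//; last exact: csq.
lra.
Qed.
End Polygon4.

(** * Lower bounds for the Robin eigenvalue from positive solutions *)

Section LowerBound.
Context {R : realType}.
Local Notation mR := (measurableTypeR R).
Local Notation mu := (@lebesgue_measure R).
Local Notation mP := (mR * mR)%type.
Implicit Types (p : 'I_4 -> R * R) (e : R) (u v g : R * R -> R).

(** Picone's identity: the difference between |grad v|^2 + kap v^2 and the divergence
    of v^2 grad u / u is the square of grad v - v grad u / u. *)
Lemma boundary_le_energy e p u u1 u2 u11 u12 u21 u22 v v1 v2 (kap b : R) :
  convex_polygon e p ->
  C1 u u1 u2 -> C1 u1 u11 u12 -> C1 u2 u21 u22 ->
  (forall x, u11 x + u22 x = kap * u x) -> (forall x, 0 < u x) ->
  (forall i t, 0 <= t <= 1 -> let x := side p i t in let d := p (ordS i) - p i in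
    e * (u1 x * d.2 - u2 x * d.1) = b * side_length p i * u x) ->
  C1 v v1 v2 ->
  b * boundary_mass p (fun x => v x ^+ 2) <=
  Rintegral area (polygon_interior p) (fun x => v1 x ^+ 2 + v2 x ^+ 2 + kap * v x ^+ 2).
Proof.
move=> cp cu cu1 cu2 pde u0 bc cv.
have u0' x : u x != 0 by rewrite lt0r_neq0.
have cV := C1V _ _ _ cu u0'.
have cvv := C1M _ _ _ _ _ _ cv cv.
have cF1 := C1M _ _ _ _ _ _ cvv (C1M _ _ _ _ _ _ cu1 cV).
have cF2 := C1M _ _ _ _ _ _ cvv (C1M _ _ _ _ _ _ cu2 cV).
have cu' : continuous u by case: cu.
have cv' : continuous v by case: cv.
have [cv1 cv2] : continuous v1 /\ continuous v2 by case: cv.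
have E := divergence_polygon e p _ _ _ _ _ _ cp cF1 cF2.
have -> : b * boundary_mass p (fun x => v x ^+ 2) =
    e * \sum_i flux (fun x => v x * v x * (u1 x / u x)) (fun x => v x * v x * (u2 x / u x))
      (p i) (p (ordS i)).
  rewrite /boundary_mass !mulr_sumr; apply: eq_bigr => i _.
  rewrite /flux mulrA -!I01Z; last 2 first.
  - by have [kF1 _ _ _ _] := cF1; have [kF2 _ _ _ _] := cF2; exact: (continuous_flux _ _ _ _ kF1 kF2).
  - exact: (continuous_segment _ _ _ (continuous_sqr _ cv')).
  apply: eq_I01 => t ht; have := bc i t ht; rewrite /= -/(side p i t).
  set x := side p i t => H.
  transitivity (v x ^+ 2 / u x * (b * side_length p i * u x)).
    by rewrite expr2; field.
  by rewrite -H expr2; field.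
rewrite -E mulrA (convex_polygon_sqr _ _ cp) mul1r.
apply: le_Rintegral.
- exact: measurable_convex_polygon cp.
- apply: (integrable_convex_polygon _ _ _ cp) => x.
  have [_ k1 _ _ _] := cF1; have [_ _ k2 _ _] := cF2.
  exact: (cvgD (k1 x) (k2 x)).
- apply: (integrable_convex_polygon _ _ _ cp) => x.
  apply: cvgD; last by apply: cvgM; [exact: cvg_cst|exact: continuous_sqr].
  by apply: cvgD; exact: continuous_sqr.
move=> x _; have := pde x; have := u0' x.
move: (u x) (u1 x) (u2 x) (u11 x) (u22 x) (v x) (v1 x) (v2 x) => U U1 U2 U11 U22 V V1 V2 U0 pdeU.
rewrite -subr_ge0.
have -> : V1 ^+ 2 + V2 ^+ 2 + kap * V ^+ 2 -
  ((V1 * V + V * V1) * (U1 / U) + V * V * (U11 / U + U1 * (- U ^- 2 * U1)) +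
   ((V2 * V + V * V2) * (U2 / U) + V * V * (U22 / U + U2 * (- U ^- 2 * U2)))) =
  (V1 - V * (U1 / U)) ^+ 2 + (V2 - V * (U2 / U)) ^+ 2 + (kap * U - (U11 + U22)) * (V ^+ 2 / U).
  by field.
by rewrite pdeU subrr mul0r addr0 addr_ge0// sqr_ge0.
Qed.

(** Integrates (h + r)^2 <= (1 + eta) h^2 + (1 + 1 / eta) r^2. In the extended reals
    it holds before any finiteness is known. *)
Lemma ge0_integral_sqrD d (T : measurableType d) (m : {measure set T -> \bar R})
    (D : set T) (f h r : T -> R) (eta : R) : measurable D ->
  measurable_fun D f -> measurable_fun D h -> measurable_fun D r -> 0 < eta ->
  (forall x, D x -> f x = h x + r x) ->
  (\int[m]_(x in D) ((f x) ^+ 2)%:E <= (1 + eta)%:E * \int[m]_(x in D) ((h x) ^+ 2)%:E +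
    (1 + eta^-1)%:E * \int[m]_(x in D) ((r x) ^+ 2)%:E)%E.
Proof.
move=> mD mf mh mr e0 E.
have i0 : 0 < eta^-1 by rewrite invr_gt0.
have c1 : (0 <= (1 + eta)%:E :> \bar R)%E by rewrite lee_fin; lra.
have c2 : (0 <= (1 + eta^-1)%:E :> \bar R)%E by rewrite lee_fin; lra.
have msq (k : T -> R) : measurable_fun D k -> measurable_fun D (fun x => ((k x) ^+ 2)%:E).
  by move=> mk; apply/measurable_EFinP; exact: measurable_funX.
have sq0 (k : T -> R) x : D x -> (0 <= ((k x) ^+ 2)%:E)%E by rewrite lee_fin sqr_ge0.
rewrite -!ge0_integralZl//; try exact: msq; try exact: sq0.
rewrite -ge0_integralD//; last 4 first.
- by move=> x Dx; apply: mule_ge0 => //; exact: sq0.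
- by apply: measurable_funeM; exact: msq.
- by move=> x Dx; apply: mule_ge0 => //; exact: sq0.
- by apply: measurable_funeM; exact: msq.
apply: ge0_le_integral => //.
- exact: sq0.
- exact: msq.
- by apply: emeasurable_funD; apply: measurable_funeM; exact: msq.
move=> x Dx; rewrite -!EFinM -EFinD lee_fin E// -subr_ge0.
have -> : (1 + eta) * h x ^+ 2 + (1 + eta^-1) * r x ^+ 2 - (h x + r x) ^+ 2 =
    eta * (h x - eta^-1 * r x) ^+ 2 by field; exact: lt0r_neq0.
by rewrite mulr_ge0 ?sqr_ge0// ltW.
Qed.

Lemma side_length_ge0 p i : 0 <= side_length p i.
Proof. exact: sqrtr_ge0. Qed.

Lemma boundary_integral_sqrD p (f h r : R * R -> R) (eta : R) :
  (forall i, measurable_fun (`[0, 1] : set R) (fun t => f (side p i t))) ->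
  (forall i, measurable_fun (`[0, 1] : set R) (fun t => h (side p i t))) ->
  (forall i, measurable_fun (`[0, 1] : set R) (fun t => r (side p i t))) ->
  0 < eta -> (forall x, f x = h x + r x) ->
  (boundary_integral p (fun x => ((f x) ^+ 2)%:E) <=
   (1 + eta)%:E * boundary_integral p (fun x => ((h x) ^+ 2)%:E) +
   (1 + eta^-1)%:E * boundary_integral p (fun x => ((r x) ^+ 2)%:E))%E.
Proof.
move=> mf mh mr e0 E.
have i0 : 0 < eta^-1 by rewrite invr_gt0.
have bge0 (k : R * R -> R) i : (0 <= (side_length p i)%:E *
    \int[mu]_(t in `[0%R, 1%R]) ((k (side p i t)) ^+ 2)%:E)%E.
  by apply: mule_ge0; [rewrite lee_fin side_length_ge0|apply: integral_ge0 => t _; rewrite lee_fin sqr_ge0].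
rewrite /boundary_integral !ge0_sume_distrr; last 2 first.
- by move=> i _; exact: bge0.
- by move=> i _; exact: bge0.
rewrite -big_split /=; apply: lee_sum => i _.
rewrite !(muleCA _ (side_length p i)%:E) -ge0_muleDr; last 2 first.
- by apply: mule_ge0; [rewrite lee_fin; lra|apply: integral_ge0 => t _; rewrite lee_fin sqr_ge0].
- by apply: mule_ge0; [rewrite lee_fin; lra|apply: integral_ge0 => t _; rewrite lee_fin sqr_ge0].
apply: lee_wpmul2l; first by rewrite lee_fin side_length_ge0.
apply: (ge0_integral_sqrD _ _ mu _ (fun t => f (side p i t))
  (fun t => h (side p i t)) (fun t => r (side p i t)) eta) => //;
  [exact: mf|exact: mh|exact: mr].
Qed.

Lemma le_of_small_slack (x y C : R) :
  (forall eta, 0 < eta <= 1 -> x <= y + eta * C) -> x <= y.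
Proof.
move=> H; rewrite leNgt; apply/negP => yx.
have C1 : 0 < `|C| + 1 by rewrite ltr_wpDl.
pose eta := Num.min 1 ((x - y) / (2 * (`|C| + 1))).
have e0 : 0 < eta by rewrite lt_min ltr01 divr_gt0 ?subr_gt0// mulr_gt0.
have e1 : eta <= 1 by rewrite ge_min lexx.
have e2 : eta * (2 * (`|C| + 1)) <= x - y.
  by rewrite -ler_pdivlMr ?mulr_gt0// ge_min lexx orbT.
have := H eta; rewrite e0 e1 => /(_ isT).
have : eta * C <= eta * (`|C| + 1) by rewrite ler_pM2l// (le_trans (ler_norm _))// lerDl.
by lra.
Qed.

Lemma boundary_integral_ge0 p (f : R * R -> R) :
  (0 <= boundary_integral p (fun x => ((f x) ^+ 2)%:E))%E.
Proof.
apply: sume_ge0 => i _; apply: mule_ge0; first by rewrite lee_fin side_length_ge0.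
by apply: integral_ge0 => t _; rewrite lee_fin sqr_ge0.
Qed.

Lemma fine_near (f : nat -> \bar R) (eps : R) : f m @[m --> \oo] --> 0%E ->
  (forall m, 0 <= f m)%E -> 0 < eps -> \forall m \near \oo, (f m <= eps%:E)%E.
Proof.
move=> cf f0 e0.
move/fine_cvgP : cf => [ff /cvgr0Pnorm_le cf]; have {}cf := cf _ e0.
near=> m.
have fm : f m \is a fin_num by near: m.
have : `|fine (f m)| <= eps by near: m.
rewrite ger0_norm ?fine_ge0// => h; by rewrite -(fineK fm) lee_fin.
Unshelve. all: by end_near.
Qed.

Lemma integral_sqr_fin e p v : convex_polygon e p -> continuous v ->
  (\int[area]_(x in polygon_interior p) ((v x) ^+ 2)%:E =
   (Rintegral area (polygon_interior p) (fun x => v x ^+ 2))%:E)%E.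
Proof.
move=> cp cv; rewrite /Rintegral fineK//.
have := integrable_convex_polygon e p _ cp (continuous_sqr _ cv).
by apply: integrable_fin_num; exact: measurable_convex_polygon cp.
Qed.

(** The inequality of [boundary_le_energy] is passed to the limit along the C^1
    functions that define the trace. *)
Lemma robin_eigenvalue_lower e p u u1 u2 u11 u12 u21 u22 (kap b : R) :
  convex_polygon e p -> 0 <= kap -> 0 <= b ->
  C1 u u1 u2 -> C1 u1 u11 u12 -> C1 u2 u21 u22 ->
  (forall x, u11 x + u22 x = kap * u x) -> (forall x, 0 < u x) ->
  (forall i t, 0 <= t <= 1 -> let x := side p i t in let d := p (ordS i) - p i in
    e * (u1 x * d.2 - u2 x * d.1) = b * side_length p i * u x) ->
  ((- kap)%:E <= robin_eigenvalue p (- b))%E.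
Proof.
move=> cp kap0 b0 cu cu1 cu2 pde u0 bc.
apply: le_ereal_inf_tmp => _ [w [w1 [w2 [g [[L2w L2w1 L2w2 _] nae [[mg fing] [v [Cv cvw cvw1 cvw2 cvg]]] ->]]]]].
set O := polygon_interior p in L2w L2w1 L2w2 nae cvw cvw1 cvw2.
have mO : measurable (O : set mP) := measurable_convex_polygon _ _ cp.
have mass0 := Rintegral_sqr_gt0 _ _ mO L2w nae.
have finE f : in_L2 O f -> (\int[area]_(x in O) ((f x) ^+ 2)%:E =
    (Rintegral area O (fun x => f x ^+ 2))%:E)%E.
  move=> [_ fin]; rewrite /Rintegral fineK// ge0_fin_numE//.
  by apply: integral_ge0 => x _; rewrite lee_fin sqr_ge0.
set bdg := boundary_integral p (fun x => ((g x) ^+ 2)%:E) in fing.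
have bdgE : bdg = (fine bdg)%:E.
  by rewrite fineK// ge0_fin_numE// boundary_integral_ge0.
rewrite lee_fin /rayleigh_quotient ler_pdivlMr// -/O -/bdg.
have sumE : Rintegral area O (fun x => w1 x ^+ 2 + w2 x ^+ 2) =
    Rintegral area O (fun x => w1 x ^+ 2) + Rintegral area O (fun x => w2 x ^+ 2).
  rewrite /Rintegral -fineD; [|by rewrite finE|by rewrite finE].
  congr fine; rewrite -ge0_integralD//.
  - by move=> x _; rewrite lee_fin sqr_ge0.
  - by apply/measurable_EFinP; apply: measurable_funX; case: L2w1.
  - by move=> x _; rewrite lee_fin sqr_ge0.
  - by apply/measurable_EFinP; apply: measurable_funX; case: L2w2.
rewrite sumE; set I1 := Rintegral area O (fun x => w1 x ^+ 2).
set I2 := Rintegral area O (fun x => w2 x ^+ 2); set I0 := Rintegral area O (fun x => w x ^+ 2).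
have [I1p I2p I0p] : [/\ 0 <= I1, 0 <= I2 & 0 <= I0].
  by split; apply: Rintegral_ge0 => x _; exact: sqr_ge0.
pose W := I1 + I2 + kap * I0.
have W0 : 0 <= W by rewrite /W !addr_ge0// mulr_ge0.
suff : b * fine bdg <= W by rewrite /W; lra.
apply: (@le_of_small_slack _ _ (3 * W + 4 * (2 + kap) + 2 * b)) => eta /andP[e0 e1].
(* the factor 1 + eta^-1 costs one power of eta *)
pose eps := eta ^+ 2.
have eps0 : 0 < eps by rewrite exprn_gt0.
have nn (f : nat -> R * R -> R) h : (forall m, 0 <= \int[area]_(x in O) ((f m x - h x) ^+ 2)%:E)%E.
  by move=> m; apply: integral_ge0 => x _; rewrite lee_fin sqr_ge0.
have [m [a0 a1 a2 ac]] : exists m,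
   [/\ (\int[area]_(x in O) ((v m x - w x) ^+ 2)%:E <= eps%:E)%E,
       (\int[area]_(x in O) ((partial1 (v m) x - w1 x) ^+ 2)%:E <= eps%:E)%E,
       (\int[area]_(x in O) ((partial2 (v m) x - w2 x) ^+ 2)%:E <= eps%:E)%E &
       (boundary_integral p (fun x => ((v m x - g x) ^+ 2)%:E) <= eps%:E)%E].
  have h0 := fine_near _ _ cvw (nn _ _) eps0.
  have h1 := fine_near _ _ cvw1 (nn _ _) eps0.
  have h2 := fine_near _ _ cvw2 (nn _ _) eps0.
  have hc := fine_near _ _ cvg (fun m => boundary_integral_ge0 p (fun x => v m x - g x)) eps0.
  near \oo => m; exists m; split; near: m => //.
have cv := Ck1_C1 _ (Cv m).
have cv0 : continuous (v m) by case: cv.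
have [cv1 cv2] : continuous (partial1 (v m)) /\ continuous (partial2 (v m)) by case: cv.
have key := boundary_le_energy e p _ _ _ _ _ _ _ _ _ _ kap b cp cu cu1 cu2 pde u0 bc cv.
have csq (f : R * R -> R) : continuous f -> area.-integrable O (EFin \o (fun x => f x ^+ 2)).
  by move=> cf; apply: (integrable_convex_polygon _ _ _ cp); exact: continuous_sqr.
rewrite RintegralD// in key; last 2 first.
- by apply: (integrable_convex_polygon _ _ _ cp) => x; apply: cvgD; exact: continuous_sqr.
- by apply: (integrable_convex_polygon _ _ _ cp) => x; apply: cvgM; [exact: cvg_cst|exact: continuous_sqr].
rewrite RintegralD ?RintegralZl// in key; try exact: csq.
have comp (f h : R * R -> R) (H : R) : continuous f -> in_L2 O h -> H = Rintegral area O (fun x => h x ^+ 2) ->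
    (\int[area]_(x in O) ((f x - h x) ^+ 2)%:E <= eps%:E)%E ->
    Rintegral area O (fun x => f x ^+ 2) <= (1 + eta) * H + (1 + eta^-1) * eps.
  move=> cf L2h -> le; rewrite -lee_fin -(integral_sqr_fin e p f cp cf) -/O.
  have mf := continuous_measurable_plane f O mO cf.
  have mh : measurable_fun (O : set mP) h by case: L2h.
  have mr : measurable_fun (O : set mP) (fun x => f x - h x) by exact: measurable_funB.
  apply: (le_trans (ge0_integral_sqrD _ _ area O f h (fun x => f x - h x) eta mO mf mh mr e0 _)).
    by move=> x _; rewrite addrC subrK.
  rewrite finE// [X in (_ <= X)%E]EFinD !EFinM; apply: leeD => //.
  by apply: lee_wpmul2l => //; rewrite lee_fin addr_ge0// invr_ge0 ltW.
have k0 := comp (v m) w I0 cv0 L2w erefl a0.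
have k1 := comp (partial1 (v m)) w1 I1 cv1 L2w1 erefl a1.
have k2 := comp (partial2 (v m)) w2 I2 cv2 L2w2 erefl a2.
have kc : fine bdg <= (1 + eta) * boundary_mass p (fun x => v m x ^+ 2) + (1 + eta^-1) * eps.
  rewrite -lee_fin -bdgE /bdg.
  have ms i : measurable_fun (`[0, 1] : set R) (fun t => v m (side p i t)).
    by apply: measurable_funTS; apply: continuous_measurable_fun; exact: continuous_segment.
  apply: (le_trans (boundary_integral_sqrD p g (v m) (fun x => g x - v m x) eta mg ms _ e0 _)).
  - by move=> i; apply: measurable_funB; [exact: mg|exact: ms].
  - by move=> x; rewrite addrC subrK.
  rewrite (boundary_integralE p (fun x => v m x ^+ 2)); last exact: continuous_sqr.
  rewrite [X in (_ <= X)%E]EFinD !EFinM; apply: leeD => //.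
  apply: lee_wpmul2l; first by rewrite lee_fin addr_ge0// invr_ge0 ltW.
  apply: le_trans ac; rewrite le_eqVlt; apply/orP; left; apply/eqP; congr boundary_integral.
  by apply/funext => x; rewrite -sqrrN opprB.
move: (boundary_mass _ _) key kc => B key kc.
move: (Rintegral area O (fun x => v m x ^+ 2)) (Rintegral area O (fun x => partial1 (v m) x ^+ 2))
  (Rintegral area O (fun x => partial2 (v m) x ^+ 2)) key k0 k1 k2 => V V1 V2 key k0 k1 k2.
have epsE : (1 + eta^-1) * eps = eta ^+ 2 + eta.
  by rewrite /eps; field; exact: lt0r_neq0.
rewrite !epsE in k0 k1 k2 kc.
move: (fine bdg) kc => G kc {a0 a1 a2 ac comp bdgE fing}.
have s1 : b * G <= (1 + eta) * (b * B) + b * (eta ^+ 2 + eta).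
  by have := ler_wpM2l b0 kc; lra.
have s2 : b * B <= (1 + eta) * W + (2 + kap) * (eta ^+ 2 + eta).
  have := ler_wpM2l kap0 k0; rewrite /W; lra.
have s3 : (1 + eta) * (b * B) <= (1 + eta) * ((1 + eta) * W + (2 + kap) * (eta ^+ 2 + eta)).
  by apply: ler_wpM2l => //; lra.
have t1 : eta ^+ 2 <= eta by rewrite expr2 ler_piMl// ltW.
have t2 : (1 + eta) * (1 + eta) <= 1 + 3 * eta by rewrite expr2 in t1; lra.
have t3 : (1 + eta) * ((1 + eta) * W) <= W + 3 * eta * W.
  by rewrite mulrA -[X in X + _ * W]mul1r -mulrDl; apply: ler_wpM2r.
have t4 : eta * (1 + eta) ^+ 2 <= 4 * eta.
  rewrite mulrC; apply: ler_wpM2r; first exact: ltW.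
  by rewrite expr2; lra.
have t5 : (2 + kap) * (eta * (1 + eta) ^+ 2) <= (2 + kap) * (4 * eta).
  by apply: ler_wpM2l => //; lra.
have t6 : b * (eta ^+ 2 + eta) <= b * (2 * eta) by apply: ler_wpM2l => //; lra.
have E7 : (1 + eta) * ((1 + eta) * W + (2 + kap) * (eta ^+ 2 + eta)) =
  (1 + eta) * ((1 + eta) * W) + (2 + kap) * (eta * (1 + eta) ^+ 2) by ring.
rewrite E7 in s3; lra.
Unshelve. all: by end_near.
Qed.
End LowerBound.

(** * Hyperbolic functions *)

Section Hyperbolic.
Context {R : realType}.
Implicit Types (x y t : R) (f g : R -> R).

Definition ch x : R := (expR x + expR (- x)) / 2.
Definition sh x : R := (expR x - expR (- x)) / 2.

Lemma drv_cst (k t : R) : is_derive t (1 : R) (fun=> k) 0.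
Proof. exact: is_derive_cst. Qed.

Lemma drv_id t : is_derive t (1 : R) (fun y : R => y) 1.
Proof. exact: is_derive_id. Qed.

Lemma drv_add f g t (df dg : R) : is_derive t (1 : R) f df -> is_derive t (1 : R) g dg ->
  is_derive t (1 : R) (fun y => f y + g y) (df + dg).
Proof. by move=> h1 h2; exact: is_deriveD. Qed.

Lemma drv_sub f g t (df dg : R) : is_derive t (1 : R) f df -> is_derive t (1 : R) g dg ->
  is_derive t (1 : R) (fun y => f y - g y) (df - dg).
Proof. by move=> h1 h2; exact: is_deriveB. Qed.

Lemma drv_opp f t (df : R) : is_derive t (1 : R) f df ->
  is_derive t (1 : R) (fun y => - f y) (- df).
Proof. by move=> h1; exact: is_deriveN. Qed.

Lemma drv_mul f g t (df dg : R) : is_derive t (1 : R) f df -> is_derive t (1 : R) g dg ->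
  is_derive t (1 : R) (fun y => f y * g y) (df * g t + f t * dg).
Proof.
move=> h1 h2; apply: (is_derive_eq (is_deriveM h1 h2)).
by rewrite /GRing.scale /=; ring.
Qed.

Lemma drv_comp f g t (df dg : R) : is_derive (g t) (1 : R) f df -> is_derive t (1 : R) g dg ->
  is_derive t (1 : R) (fun y => f (g y)) (df * dg).
Proof. by move=> h1 h2; exact: is_derive1_comp. Qed.

Lemma drv_eq f g t (df dg : R) : is_derive t (1 : R) f df -> f =1 g -> df = dg ->
  is_derive t (1 : R) g dg.
Proof. by move=> h /funext <- <-. Qed.

Lemma drv_exp t : is_derive t (1 : R) expR (expR t).
Proof. exact: is_derive_expR. Qed.

Lemma drv_ch t : is_derive t (1 : R) ch (sh t).
Proof.
have := drv_mul _ _ _ _ _ (drv_add _ _ _ _ _ (drv_exp t) (drv_comp _ _ _ _ _ (drv_exp (- t)) (drv_opp _ _ _ (drv_id t)))) (drv_cst (2^-1) t).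
by move=> h; apply: drv_eq h _ _ => //; rewrite /sh; ring.
Qed.

Lemma drv_sh t : is_derive t (1 : R) sh (ch t).
Proof.
have := drv_mul _ _ _ _ _ (drv_sub _ _ _ _ _ (drv_exp t) (drv_comp _ _ _ _ _ (drv_exp (- t)) (drv_opp _ _ _ (drv_id t)))) (drv_cst (2^-1) t).
by move=> h; apply: drv_eq h _ _ => //; rewrite /ch; ring.
Qed.

Lemma is_derive_continuous f (df : R -> R) : (forall s, is_derive s (1 : R) f (df s)) -> continuous f.
Proof.
move=> dF s; apply: differentiable_continuous.
by apply/derivable1_diffP; case: (dF s).
Qed.

Lemma continuous_cstR (a : R) : continuous (fun _ : R => a).
Proof. by move=> t; exact: cvg_cst. Qed.

Lemma continuous_mulR (f g : R -> R) : continuous f -> continuous g ->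
  continuous (fun t => f t * g t).
Proof. by move=> cf cg t; exact: (cvgM (cf t) (cg t)). Qed.

Lemma continuous_addR (f g : R -> R) : continuous f -> continuous g ->
  continuous (fun t => f t + g t).
Proof. by move=> cf cg t; exact: (cvgD (cf t) (cg t)). Qed.

Lemma continuous_subR (f g : R -> R) : continuous f -> continuous g ->
  continuous (fun t => f t - g t).
Proof. by move=> cf cg t; exact: (cvgB (cf t) (cg t)). Qed.

Lemma continuous_ch : continuous ch. Proof. exact: is_derive_continuous drv_ch. Qed.
Lemma continuous_sh : continuous sh. Proof. exact: is_derive_continuous drv_sh. Qed.

Lemma ch0 : ch 0 = 1. Proof. by rewrite /ch oppr0 expR0; field. Qed.
Lemma sh0 : sh 0 = 0. Proof. by rewrite /sh oppr0 subrr mul0r. Qed.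
Lemma chN x : ch (- x) = ch x. Proof. by rewrite /ch opprK addrC. Qed.
Lemma shN x : sh (- x) = - sh x. Proof. by rewrite /sh opprK; ring. Qed.

Lemma chD x y : ch (x + y) = ch x * ch y + sh x * sh y.
Proof. by rewrite /ch /sh opprD !expRD; field. Qed.
Lemma shD x y : sh (x + y) = sh x * ch y + ch x * sh y.
Proof. by rewrite /ch /sh opprD !expRD; field. Qed.

Lemma ch2sh2 x : ch x * ch x = 1 + sh x * sh x.
Proof. by have := chD x (- x); rewrite subrr ch0 chN shN mulrN => ->; rewrite subrK. Qed.

Lemma ch_gt0 x : 0 < ch x.
Proof. by rewrite /ch divr_gt0// addr_gt0// expR_gt0. Qed.

Lemma ch_ge1 x : 1 <= ch x.
Proof.
have := ch2sh2 x; have := ch_gt0 x; have := sqr_ge0 (sh x); rewrite expr2 => h1 h2 h3.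
rewrite leNgt; apply/negP => h; have : ch x * ch x < 1 * 1 by apply: ltr_pM => //; exact: ltW.
by lra.
Qed.

Lemma ge_of_derive (F f : R -> R) x : (forall s, is_derive s (1 : R) F (f s)) ->
  (forall s, 0 <= s <= x -> 0 <= f s) -> 0 <= x -> F 0 <= F x.
Proof.
move=> dF f0; rewrite le_eqVlt => /orP[/eqP <-//|x0].
have cF : {within `[0, x], continuous F}.
  by apply: continuous_subspaceT; exact: is_derive_continuous dF.
have [c] := @MVT R F f 0 x x0 (fun s _ => dF s) cF.
rewrite in_itv /= => /andP[c0 cx]; rewrite -subr_ge0 => ->.
by rewrite subr0 mulr_ge0 ?f0 ?ltW//= ?ltW.
Qed.

Lemma sh_ge_id x : 0 <= x -> x <= sh x.
Proof.
move=> x0; rewrite -subr_ge0.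
have := ge_of_derive (fun y => sh y - y) (fun y => ch y - 1) x.
rewrite sh0 subr0; apply => // [s|s _].
- exact: (drv_sub _ _ _ _ _ (drv_sh s) (drv_id s)).
- by rewrite subr_ge0 ch_ge1.
Qed.

Lemma drv_sqr t : is_derive t (1 : R) (fun y : R => y * y) (t + t).
Proof.
by apply: drv_eq (drv_mul _ _ _ _ _ (drv_id t) (drv_id t)) _ _ => //; ring.
Qed.

Lemma ch_ge_sqr x : 0 <= x -> 1 + x * x / 2 <= ch x.
Proof.
move=> x0; rewrite -subr_ge0.
have := ge_of_derive (fun y => ch y - (1 + y * y / 2)) (fun y => sh y - y) x.
rewrite ch0 mul0r mul0r addr0 subrr; apply => // [s|s /andP[s0 _]].
- apply: drv_eq (drv_sub _ _ _ _ _ (drv_ch s) (drv_add _ _ _ _ _ (drv_cst 1 s)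
    (drv_mul _ _ _ _ _ (drv_sqr s) (drv_cst 2^-1 s)))) _ _ => //.
  by field.
- by rewrite subr_ge0 sh_ge_id.
Qed.

Lemma xch_sub_sh x : 0 <= x -> x * x * x / 3 <= x * ch x - sh x.
Proof.
move=> x0; rewrite -subr_ge0.
have := ge_of_derive (fun y => y * ch y - sh y - y * y * y / 3) (fun y => y * (sh y - y)) x.
rewrite sh0 !mul0r !subr0; apply => // [s|s /andP[s0 _]].
- apply: drv_eq (drv_sub _ _ _ _ _ (drv_sub _ _ _ _ _ (drv_mul _ _ _ _ _ (drv_id s) (drv_ch s)) (drv_sh s))
    (drv_mul _ _ _ _ _ (drv_mul _ _ _ _ _ (drv_sqr s) (drv_id s)) (drv_cst 3^-1 s))) _ _ => //.
  by field.
- by rewrite mulr_ge0// subr_ge0 sh_ge_id.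
Qed.

(** The difference and its first derivative vanish at 0, and its second derivative
    is x cosh x. *)
Lemma two_sh_le x : 0 <= x -> 2 * sh x <= x * (1 + ch x).
Proof.
move=> x0; rewrite -subr_ge0.
have step y : 0 <= y -> 0 <= y * sh y - ch y + 1.
  move=> y0; have := ge_of_derive (fun y => y * sh y - ch y + 1) (fun y => y * ch y) y.
  rewrite sh0 ch0 mul0r sub0r addNr; apply => // [s|s /andP[s0 _]].
    apply: drv_eq (drv_add _ _ _ _ _ (drv_sub _ _ _ _ _ (drv_mul _ _ _ _ _ (drv_id s) (drv_sh s)) (drv_ch s)) (drv_cst 1 s)) _ _ => //.
    by ring.
  by rewrite mulr_ge0// ltW// ch_gt0.
have := ge_of_derive (fun y => y * (1 + ch y) - 2 * sh y) (fun y => y * sh y - ch y + 1) x.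
rewrite sh0 mul0r mulr0 subr0; apply => // [s|s /andP[s0 _]]; last exact: step.
apply: drv_eq (drv_sub _ _ _ _ _ (drv_mul _ _ _ _ _ (drv_id s) (drv_add _ _ _ _ _ (drv_cst 1 s) (drv_ch s)))
  (drv_mul _ _ _ _ _ (drv_cst 2 s) (drv_sh s))) _ _ => //.
by ring.
Qed.

Lemma sh_ge0 x : 0 <= x -> 0 <= sh x.
Proof. by move=> x0; exact: le_trans (sh_ge_id x x0). Qed.

Lemma ch_mono x y : 0 <= x -> x <= y -> ch x <= ch y.
Proof.
move=> x0 xy; have z0 : 0 <= y - x by rewrite subr_ge0.
have -> : y = x + (y - x) by rewrite addrC subrK.
rewrite chD.
have := ch_ge1 (y - x); have := ch_gt0 x => h1 h2.
have h3 : 0 <= sh x * sh (y - x) by rewrite mulr_ge0// sh_ge0.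
have h4 : ch x * 1 <= ch x * ch (y - x) by rewrite ler_pM2l.
lra.
Qed.

Lemma ch_abs x : ch `|x| = ch x.
Proof. by have [x0|x0] := leP 0 x; [rewrite ger0_norm|rewrite ltr0_norm// chN]. Qed.

(** In this and the next three bounds the constant ch 1 is the maximum of cosh on
    the unit interval, and each bound gives the next by the mean value theorem. *)
Lemma sh_bound x : `|x| <= 1 -> `|sh x| <= ch 1 * `|x|.
Proof.
move=> x1; have [c] := MVT_sym sh ch 0 x drv_sh; rewrite !subr0 sh0 subr0 => cx ->.
rewrite normrM ler_wpM2r// gtr0_norm ?ch_gt0// -ch_abs.
by apply: ch_mono => //; exact: le_trans x1.
Qed.

Lemma ch_bound x : `|x| <= 1 -> `|ch x - 1| <= ch 1 * `|x| ^+ 2.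
Proof.
move=> x1; have [c] := MVT_sym ch sh 0 x drv_ch; rewrite !subr0 ch0 => cx ->.
rewrite normrM expr2 mulrA ler_wpM2r//; apply: le_trans (sh_bound c _) _; first exact: le_trans x1.
by rewrite ler_pM2l ?ch_gt0.
Qed.

Lemma sh_bound3 x : `|x| <= 1 -> `|sh x - x| <= ch 1 * `|x| ^+ 3.
Proof.
move=> x1; have [c] := MVT_sym (fun y => sh y - y) (fun y => ch y - 1) 0 x
  (fun s => drv_sub _ _ _ _ _ (drv_sh s) (drv_id s)).
rewrite !subr0 sh0 subr0 => cx ->.
rewrite normrM exprSr mulrA ler_wpM2r//; apply: le_trans (ch_bound c _) _; first exact: le_trans x1.
by rewrite ler_pM2l ?ch_gt0// lerXn2r// nnegrE.
Qed.

Lemma ch_bound3 x : `|x| <= 1 -> `|ch x - 1 - x ^+ 2 / 2| <= ch 1 * `|x| ^+ 3.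
Proof.
move=> x1; have [|c] := MVT_sym (fun y => ch y - 1 - y * y / 2) (fun y => sh y - y) 0 x.
  move=> s; apply: drv_eq (drv_sub _ _ _ _ _ (drv_sub _ _ _ _ _ (drv_ch s) (drv_cst 1 s))
    (drv_mul _ _ _ _ _ (drv_sqr s) (drv_cst 2^-1 s))) _ _ => //.
  by field.
rewrite ch0 => cx E; rewrite !subr0 in cx.
have -> : ch x - 1 - x ^+ 2 / 2 = (sh c - c) * x by rewrite expr2; lra.
rewrite normrM; apply: (@le_trans _ _ (ch 1 * `|x| ^+ 3 * 1)); last by rewrite mulr1.
apply: ler_pM => //; apply: le_trans (sh_bound3 c _) _; first exact: le_trans x1.
by rewrite ler_pM2l ?ch_gt0// lerXn2r// nnegrE.
Qed.
End Hyperbolic.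

(** * Second-order expansion of the flux excess on a side *)

Section BigO.
Context {R : realType} {I : Type} (D : I -> Prop) (N : I -> R).
Hypothesis N01 : forall i, D i -> 0 <= N i <= 1.
Implicit Types (f g : I -> R).

(** Remainders are functions of a parameter i in the domain D, measured by powers
    of the size N i with constants uniform in i. *)
Definition bigO (k : nat) f : Prop :=
  exists2 K : R, 0 <= K & forall i, D i -> `|f i| <= K * N i ^+ k.

Lemma bigO_add k f g : bigO k f -> bigO k g -> bigO k (fun i => f i + g i).
Proof.
move=> [K K0 HK] [L L0 HL]; exists (K + L); first exact: addr_ge0.
by move=> i Di; rewrite (le_trans (ler_normD _ _))// mulrDl lerD ?HK ?HL.
Qed.

Lemma bigO_opp k f : bigO k f -> bigO k (fun i => - f i).
Proof. by move=> [K K0 HK]; exists K => // i Di; rewrite normrN HK. Qed.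

Lemma bigO_mul k l f g : bigO k f -> bigO l g -> bigO (k + l) (fun i => f i * g i).
Proof.
move=> [K K0 HK] [L L0 HL]; exists (K * L); first exact: mulr_ge0.
by move=> i Di; rewrite normrM exprD mulrACA ler_pM ?HK ?HL.
Qed.

Lemma bigO_weaken k l f : (l <= k)%N -> bigO k f -> bigO l f.
Proof.
move=> lk [K K0 HK]; exists K => // i Di; apply: (le_trans (HK i Di)).
by rewrite ler_wpM2l// ler_wiXn2l//; case/andP: (N01 i Di).
Qed.

Lemma bigO_cst (a : R) : bigO 0 (fun=> a).
Proof. by exists `|a| => // i _; rewrite expr0 mulr1. Qed.

Lemma bigO_bounded (a : R) f : (forall i, D i -> `|f i| <= a) -> bigO 0 f.
Proof.
move=> H; exists `|a| => // i Di; rewrite expr0 mulr1; apply: (le_trans (H i Di)).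
exact: ler_norm.
Qed.

Lemma bigO_small k f (F : R -> R) (M : R) : 0 <= M ->
  (forall x, `|x| <= 1 -> `|F x| <= M * `|x| ^+ k) ->
  (forall i, D i -> `|f i| <= 1) -> bigO 1 f -> bigO k (fun i => F (f i)).
Proof.
move=> M0 HF f1 [K K0 HK]; exists (M * K ^+ k); first by rewrite mulr_ge0// exprn_ge0.
move=> i Di; apply: (le_trans (HF _ (f1 i Di))); rewrite -mulrA ler_wpM2l// -exprMn.
by apply: lerXn2r; rewrite ?nnegrE ?mulr_ge0//; [case/andP: (N01 i Di)|have := HK i Di; rewrite expr1].
Qed.
End BigO.

Section SideExpansion.
Context {R : realType}.
Variable H : R.
Hypothesis H0 : 0 < H.
Let C := ch H.
Let s := sh H.
(** This is tanh (h / 2). *)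
Definition robin_T (h : R) : R := sh h / (1 + ch h).
Let T := robin_T H.

Lemma robin_TE : T * (1 + C) = s.
Proof. by rewrite /T /robin_T mulfVK// lt0r_neq0// ltr_wpDl// ch_gt0. Qed.

Lemma robin_Ts : T * s = C - 1.
Proof.
have c0 : 1 + C != 0 by rewrite lt0r_neq0// ltr_wpDl// ch_gt0.
apply: (mulIf c0); rewrite mulrAC robin_TE.
by have := ch2sh2 H; rewrite -/C -/s; lra.
Qed.

(** It vanishes at H, which is the Robin condition on the sides of the square. *)
Definition robin_phi (x : R) : R := sh x - T * (1 + ch x).

Lemma robin_phi_shift x : robin_phi (H + x) = T * (ch x - 1) + sh x.
Proof.
rewrite /robin_phi shD chD -/C -/s.
have E1 := robin_TE; have E2 := robin_Ts.
transitivity ((s - T * C) * ch x + (C - T * s) * sh x - T); first by ring.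
rewrite E2 (_ : s - T * C = T); last by rewrite -E1; ring.
by ring.
Qed.

(** The parameters are those of the side r |-> (H + c + r m, r H + v + r g), for r
    between - 1 and 1; all four are 0 for the side of the square. *)
Definition side_density (c m v g r : R) : R :=
  robin_phi (H + (c + r * m)) * (1 + ch (r * H + (v + r * g))) * (H + g) -
  m * (1 + ch (H + (c + r * m))) * sh (r * H + (v + r * g)).

Definition side_taylor (c m v g r : R) : R :=
  let xi := c + r * m in let w := v + r * g in
  let Q := ch (r * H) in let S := sh (r * H) in
  xi * ((1 + Q) * H) + xi * (S * w * H + (1 + Q) * g) + T / 2 * xi ^+ 2 * ((1 + Q) * H)
  - m * ((1 + C) * S + (1 + C) * Q * w + s * xi * S).

(** The expansions of cosh and sinh around the side of the square are multiplied
    out, and bigO sorts the products by their degree in c, m, v, g. *)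
Lemma side_density_taylor : exists2 K : R, 0 <= K &
  forall N c m v g r : R, `|c| <= N -> `|m| <= N -> `|v| <= N -> `|g| <= N ->
    N <= 1 / 2 -> `|r| <= 1 ->
    side_density c m v g r <= side_taylor c m v g r + K * N ^+ 3.
Proof.
pose I := (R * R * R * R * R * R)%type.
pose N (i : I) := i.1.1.1.1.1; pose c (i : I) := i.1.1.1.1.2; pose m (i : I) := i.1.1.1.2.
pose v (i : I) := i.1.1.2; pose g (i : I) := i.1.2; pose r (i : I) := i.2.
pose D i := [/\ `|c i| <= N i, `|m i| <= N i, `|v i| <= N i & `|g i| <= N i] /\
  (N i <= 1 / 2 /\ `|r i| <= 1).
have N01 i : D i -> 0 <= N i <= 1.
  move=> [[h _ _ _] [h' _]]; apply/andP; split; last by lra.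
  exact: le_trans h.
have M0 : 0 <= ch (1 : R) by rewrite ltW// ch_gt0.
have O1 f : (forall i, D i -> `|f i| <= N i) -> bigO D N 1 f.
  by move=> h; exists 1 => // i Di; rewrite mul1r expr1 h.
have oc : bigO D N 1 c by apply: O1 => i [[]].
have om : bigO D N 1 m by apply: O1 => i [[]].
have ov : bigO D N 1 v by apply: O1 => i [[]].
have og : bigO D N 1 g by apply: O1 => i [[]].
have or_ : bigO D N 0 r by apply: (bigO_bounded _ _ 1) => i [_ []].
have OM := bigO_mul D N; have OA := bigO_add D N; have ON := bigO_opp D N.
have OK := @bigO_cst R I D N; have OW := bigO_weaken D N N01.
pose xi i := c i + r i * m i; pose w i := v i + r i * g i.
have oxi : bigO D N 1 xi by apply: (OA _ _ _); [exact: oc|exact: (OM 0 1)].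
have ow : bigO D N 1 w by apply: (OA _ _ _); [exact: ov|exact: (OM 0 1)].
have small a b i : `|a| <= N i -> `|b| <= N i -> D i -> `|a + r i * b| <= 1.
  move=> ha hb [_ [hN hr]]; apply: (le_trans (ler_normD _ _)); rewrite normrM.
  have : `|r i| * `|b| <= 1 * N i by apply: ler_pM.
  by lra.
have xi1 i : D i -> `|xi i| <= 1 by move=> Di; apply: small => //; case: (Di) => -[].
have w1 i : D i -> `|w i| <= 1 by move=> Di; apply: small => //; case: (Di) => -[].
pose Q i := ch (r i * H); pose S i := sh (r i * H).
have Qb i : D i -> `|Q i| <= C.
  move=> [_ [_ hr]]; rewrite gtr0_norm ?ch_gt0// /Q -ch_abs; apply: ch_mono => //.
  by rewrite normrM (gtr0_norm H0) ler_piMl// ltW.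
have oQ : bigO D N 0 Q by exact: (bigO_bounded _ _ C).
have oS : bigO D N 0 S.
  apply: (bigO_bounded _ _ C) => i Di; apply: le_trans (Qb i Di).
  rewrite -ler_sqr ?nnegrE// !real_normK ?num_real// !expr2.
  by rewrite (ch2sh2 (r i * H)) lerDr.
have shO f : (forall i, D i -> `|f i| <= 1) -> bigO D N 1 f -> bigO D N 3 (fun i => sh (f i) - f i).
  by move=> h1 h2; apply: (bigO_small D N N01 3 f (fun x => sh x - x) (ch 1)) => //; exact: sh_bound3.
have chO f : (forall i, D i -> `|f i| <= 1) -> bigO D N 1 f -> bigO D N 2 (fun i => ch (f i) - 1).
  by move=> h1 h2; apply: (bigO_small D N N01 2 f (fun x => ch x - 1) (ch 1)) => //; exact: ch_bound.
have chO3 f : (forall i, D i -> `|f i| <= 1) -> bigO D N 1 f ->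
    bigO D N 3 (fun i => ch (f i) - 1 - f i ^+ 2 / 2).
  by move=> h1 h2; apply: (bigO_small D N N01 3 f (fun x => ch x - 1 - x ^+ 2 / 2) (ch 1)) => //; exact: ch_bound3.
pose r1 i := T * (ch (xi i) - 1 - xi i ^+ 2 / 2) + (sh (xi i) - xi i).
have o1 : bigO D N 3 r1 by apply: (OA _ _ _); [apply: (OM 0 3)%N; [exact: (OK _)|exact: chO3]|exact: shO].
pose r2 i := Q i * (ch (w i) - 1) + S i * (sh (w i) - w i).
have o2 : bigO D N 2 r2.
  by apply: (OA _ _ _); [apply: (OM 0 2)%N => //; exact: chO|apply: (OM 0 2)%N => //; apply: (OW 3 2)%N => //; exact: shO].
pose r4 i := C * (ch (xi i) - 1) + s * (sh (xi i) - xi i).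
have o4 : bigO D N 2 r4.
  by apply: (OA _ _ _); [apply: (OM 0 2)%N; [exact: (OK _)|exact: chO]|apply: (OM 0 2)%N; [exact: (OK _)|apply: (OW 3 2)%N => //; exact: shO]].
pose r5 i := S i * (ch (w i) - 1) + Q i * (sh (w i) - w i).
have o5 : bigO D N 2 r5.
  by apply: (OA _ _ _); [apply: (OM 0 2)%N => //; exact: chO|apply: (OM 0 2)%N => //; apply: (OW 3 2)%N => //; exact: shO].
pose r3 i := r2 i * (H + g i) + S i * w i * g i.
have oHg : bigO D N 0 (fun i => H + g i) by apply: (OA _ _ _); [exact: (OK _)|exact: (OW 1 0)%N].
have o3 : bigO D N 2 r3.
  by apply: (OA _ _ _); [exact: (OM 2 0)%N|apply: (OM 1 1)%N => //; exact: (OM 0 1)%N].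
pose B0 i := (1 + Q i) * H; pose B1 i := S i * w i * H + (1 + Q i) * g i.
have o1Q : bigO D N 0 (fun i => 1 + Q i) by apply: (OA _ _ _) => //; exact: (OK _).
have oB0 : bigO D N 0 B0 by apply: (OM 0 0)%N => //; exact: (OK _).
have oB1 : bigO D N 1 B1.
  by apply: (OA _ _ _); [apply: (OM 1 0)%N; [exact: (OM 0 1)%N|exact: (OK _)]|exact: (OM 0 1)%N].
pose R1 i := xi i * r3 i + (T / 2 * (xi i * xi i)) * (B1 i + r3 i) + r1 i * (B0 i + B1 i + r3 i).
have oR1 : bigO D N 3 R1.
  apply: (OA _ _ _); first apply: (OA _ _ _).
  - exact: (OM 1 2)%N.
  - apply: (OM 2 1)%N; first by apply: (OM 0 2)%N; [exact: (OK _)|exact: (OM 1 1)%N].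
    by apply: (OA _ _ _) => //; exact: (OW 2 1)%N.
  - apply: (OM 3 0)%N => //; apply: (OA _ _ _); first by apply: (OA _ _ _) => //; exact: (OW 1 0)%N.
    exact: (OW 2 0)%N.
have oQw : bigO D N 1 (fun i => Q i * w i) by exact: (OM 0 1)%N.
pose R2 i := (1 + C) * r5 i + s * xi i * (Q i * w i + r5 i) + r4 i * (S i + Q i * w i + r5 i).
have oR2 : bigO D N 2 R2.
  apply: (OA _ _ _); first apply: (OA _ _ _).
  - by apply: (OM 0 2)%N => //; exact: (OK _).
  - apply: (OM 1 1)%N; first by apply: (OM 0 1)%N => //; exact: (OK _).
    by apply: (OA _ _ _) => //; exact: (OW 2 1)%N.
  - apply: (OM 2 0)%N => //; apply: (OA _ _ _); first by apply: (OA _ _ _) => //; exact: (OW 1 0)%N.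
    exact: (OW 2 0)%N.
have [K K0 HK] : bigO D N 3 (fun i => R1 i + - (m i * R2 i)).
  by apply: (OA _ _ _) => //; apply: (ON _ _); exact: (OM 1 2)%N.
exists K => // N' c' m' v' g' r' hc hm hv hg hN hr.
pose i : I := (N', c', m', v', g', r').
have := HK i; rewrite /D /= => /(_ (conj (And4 hc hm hv hg) (conj hN hr))).
have -> : R1 i + - (m i * R2 i) = side_density c' m' v' g' r' - side_taylor c' m' v' g' r'.
  rewrite /side_density robin_phi_shift (chD H) (chD (r' * H)) (shD (r' * H)) -/C -/s.
  rewrite /R1 /R2 /r3 /B0 /B1 /r1 /r2 /r4 /r5 /side_taylor /xi /w /Q /S /c /m /v /g /r /i /=.
  set a := c' + r' * m'; set b := v' + r' * g'.
  by field.
move=> h; have := le_trans (ler_norm _) h; rewrite /N /=; lra.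
Qed.
End SideExpansion.

(** * Negativity of the total flux excess *)

Section KeyInequality.
Context {R : realType}.
Variable H : R.
Hypothesis H0 : 0 < H.
Let C := ch H.
Let s := sh H.
Let T := robin_T H.

Lemma continuous_affine (a b : R) : continuous (fun t : R => a * t + b).
Proof.
by move=> t; apply: cvgD; [apply: cvgM; [exact: cvg_cst|exact: cvg_id]|exact: cvg_cst].
Qed.

Lemma continuous_ch_affine (a b : R) : continuous (fun t : R => ch (a * t + b)).
Proof. by move=> t; apply: (@continuous_comp _ _ _ (fun t => a * t + b) ch); [exact: continuous_affine|exact: continuous_ch]. Qed.

Lemma continuous_sh_affine (a b : R) : continuous (fun t : R => sh (a * t + b)).
Proof. by move=> t; apply: (@continuous_comp _ _ _ (fun t => a * t + b) sh); [exact: continuous_affine|exact: continuous_sh]. Qed.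

(** The functions of r that occur in [side_taylor]. *)
Definition basis_sum (a1 a2 a3 a4 a5 a6 a7 a8 r : R) : R :=
  a1 + a2 * r + a3 * (r * r) + a4 * ch (r * H) + a5 * sh (r * H) +
  a6 * (r * ch (r * H)) + a7 * (r * sh (r * H)) + a8 * (r * r * sh (r * H)).

Lemma continuous_basis_sum a1 a2 a3 a4 a5 a6 a7 a8 :
  continuous (fun t : R => basis_sum a1 a2 a3 a4 a5 a6 a7 a8 (2 * t - 1)).
Proof.
have cr : continuous (fun t : R => 2 * t - 1) by exact: (continuous_affine 2 (- 1)).
have cc : continuous (fun t : R => ch ((2 * t - 1) * H)).
  have -> : (fun t : R => ch ((2 * t - 1) * H)) = (fun t => ch ((2 * H) * t + (- H))).
    by apply/funext => t; congr ch; ring.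
  exact: continuous_ch_affine.
have cs : continuous (fun t : R => sh ((2 * t - 1) * H)).
  have -> : (fun t : R => sh ((2 * t - 1) * H)) = (fun t => sh ((2 * H) * t + (- H))).
    by apply/funext => t; congr sh; ring.
  exact: continuous_sh_affine.
have k := @continuous_cstR R; have M := @continuous_mulR R; have A := @continuous_addR R.
rewrite /basis_sum.
exact: (A _ _ (A _ _ (A _ _ (A _ _ (A _ _ (A _ _ (A _ _ (k a1) (M _ _ (k a2) cr))
  (M _ _ (k a3) (M _ _ cr cr))) (M _ _ (k a4) cc)) (M _ _ (k a5) cs))
  (M _ _ (k a6) (M _ _ cr cc))) (M _ _ (k a7) (M _ _ cr cs)))
  (M _ _ (k a8) (M _ _ (M _ _ cr cr) cs))).
Qed.

Lemma I01_basis_sum a1 a2 a3 a4 a5 a6 a7 a8 :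
  I01 (fun t => basis_sum a1 a2 a3 a4 a5 a6 a7 a8 (2 * t - 1)) =
  a1 + a3 / 3 + a4 * (s / H) + a7 * (C / H - s / (H * H)).
Proof.
have h0 : H != 0 by rewrite lt0r_neq0.
pose F (r : R) : R := (a1 * r + a2 / 2 * (r * r) + a3 / 3 * (r * r * r) +
  a4 / H * sh (r * H) + a5 / H * ch (r * H) + a6 * (r * sh (r * H) / H - ch (r * H) / (H * H)) +
  a7 * (r * ch (r * H) / H - sh (r * H) / (H * H)) +
  a8 * (r * r * ch (r * H) / H - 2 * r * sh (r * H) / (H * H) + 2 * ch (r * H) / (H * H * H))) / 2.
pose G (t : R) := F (2 * t - 1).
have dr t : is_derive t (1 : R) (fun t => 2 * t - 1) 2.
  by apply: drv_eq (drv_sub _ _ _ _ _ (drv_mul _ _ _ _ _ (drv_cst 2 t) (drv_id t)) (drv_cst 1 t)) _ _ => //; ring.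
have drH (r : R) : is_derive r (1 : R) (fun r => r * H) H.
  by apply: drv_eq (drv_mul _ _ _ _ _ (drv_id r) (drv_cst H r)) _ _ => //; ring.
have dF r : is_derive r (1 : R) F (basis_sum a1 a2 a3 a4 a5 a6 a7 a8 r / 2).
  have dc := drv_comp ch (fun r => r * H) _ _ _ (drv_ch (r * H)) (drH r).
  have ds := drv_comp sh (fun r => r * H) _ _ _ (drv_sh (r * H)) (drH r).
  have k a := drv_cst a r.
  have M f g df dg := drv_mul f g r df dg.
  have A f g df dg := drv_add f g r df dg.
  have B f g df dg := drv_sub f g r df dg.
  have i := drv_id r.
  have q := drv_sqr r.
  have d1 := M _ _ _ _ (k a1) i.
  have d2 := M _ _ _ _ (k (a2 / 2)) q.
  have d3 := M _ _ _ _ (k (a3 / 3)) (M _ _ _ _ q i).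
  have d4 := M _ _ _ _ (k (a4 / H)) ds.
  have d5 := M _ _ _ _ (k (a5 / H)) dc.
  have d6 := M _ _ _ _ (k a6) (B _ _ _ _ (M _ _ _ _ (M _ _ _ _ i ds) (k H^-1)) (M _ _ _ _ dc (k (H * H)^-1))).
  have d7 := M _ _ _ _ (k a7) (B _ _ _ _ (M _ _ _ _ (M _ _ _ _ i dc) (k H^-1)) (M _ _ _ _ ds (k (H * H)^-1))).
  have d8 := M _ _ _ _ (k a8) (A _ _ _ _ (B _ _ _ _ (M _ _ _ _ (M _ _ _ _ q dc) (k H^-1))
    (M _ _ _ _ (M _ _ _ _ (M _ _ _ _ (k 2) i) ds) (k (H * H)^-1)))
    (M _ _ _ _ (M _ _ _ _ (k 2) dc) (k (H * H * H)^-1))).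
  have := M _ _ _ _ (A _ _ _ _ (A _ _ _ _ (A _ _ _ _ (A _ _ _ _ (A _ _ _ _ (A _ _ _ _ (A _ _ _ _ d1 d2) d3) d4) d5) d6) d7) d8) (k 2^-1).
  move=> h; apply: drv_eq h _ _ => //.
  by rewrite /basis_sum; field.
have dG t : is_derive t (1 : R) G (basis_sum a1 a2 a3 a4 a5 a6 a7 a8 (2 * t - 1)).
  by apply: drv_eq (drv_comp F (fun t => 2 * t - 1) _ _ _ (dF (2 * t - 1)) (dr t)) _ _ => //; field.
rewrite (I01_FTC G _ dG); last exact: continuous_basis_sum.
have -> : G 1 = F 1 by rewrite /G; congr F; ring.
have -> : G 0 = F (- 1) by rewrite /G; congr F; ring.
rewrite /F (mul1r H) (mulN1r H) chN shN -/C -/s; field; exact: h0.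
Qed.

Definition side_integral (c m v g : R) : R :=
  2 * I01 (fun t => side_density H c m v g (2 * t - 1)).

(** The integral of [side_taylor] over r, apart from one term in m^2, which is
    replaced by an upper bound. *)
Definition side_form (c m v g : R) : R :=
  2 * (H + s) * c + 2 * (1 + C) * c * g
  + 2 * m * v * (C - s / H - (1 + C) * (s / H))
  + m ^+ 2 * (s * H / 3 - 2 * (s / H) * (C - s / H)) + T * (H + s) * c ^+ 2.

Lemma T_ge0 : 0 <= T.
Proof.
rewrite /T /robin_T divr_ge0 ?sh_ge0 ?ltW//.
by rewrite ltr_wpDl// ch_gt0.
Qed.

Lemma continuous_side_density c m v g :
  continuous (fun t : R => side_density H c m v g (2 * t - 1)).
Proof.
have k := @continuous_cstR R; have M := @continuous_mulR R.
have A := @continuous_addR R; have B := @continuous_subR R.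
pose a1 := 2 * m; pose b1 := H + c - m.
pose a2 := 2 * (H + g); pose b2 := v - H - g.
have -> : (fun t : R => side_density H c m v g (2 * t - 1)) =
  (fun t => (sh (a1 * t + b1) - T * (1 + ch (a1 * t + b1))) * (1 + ch (a2 * t + b2)) * (H + g) -
    m * (1 + ch (a1 * t + b1)) * sh (a2 * t + b2)).
  apply/funext => t; rewrite /side_density /robin_phi -/T.
  have -> : H + (c + (2 * t - 1) * m) = a1 * t + b1 by rewrite /a1 /b1; ring.
  by have -> : (2 * t - 1) * H + (v + (2 * t - 1) * g) = a2 * t + b2 by rewrite /a2 /b2; ring.
have c1 := continuous_ch_affine a1 b1; have c2 := continuous_ch_affine a2 b2.
have s1 := continuous_sh_affine a1 b1; have s2 := continuous_sh_affine a2 b2.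
exact: (B _ _ (M _ _ (M _ _ (B _ _ s1 (M _ _ (k T) (A _ _ (k 1) c1))) (A _ _ (k 1) c2)) (k (H + g)))
  (M _ _ (M _ _ (k m) (A _ _ (k 1) c1)) s2)).
Qed.

Lemma side_integral_le : exists2 K : R, 0 <= K &
  forall N c m v g : R, `|c| <= N -> `|m| <= N -> `|v| <= N -> `|g| <= N ->
    N <= 1 / 2 -> side_integral c m v g <= side_form c m v g + K * N ^+ 3.
Proof.
have [K K0 HK] := side_density_taylor H H0.
exists (2 * K); first by rewrite mulr_ge0.
move=> N c m v g hc hm hv hg hN.
have h0 : H != 0 by rewrite lt0r_neq0.
have TE := robin_TE H; rewrite -/T -/C -/s in TE.
pose B (r : R) := basis_sum
  (c * H + c * g + T / 2 * c ^+ 2 * H + K * N ^+ 3)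
  (m * H + m * g + T * c * m * H)
  (s * H / 2 * m ^+ 2)
  (c * H + c * g + T / 2 * c ^+ 2 * H - m * (1 + C) * v)
  (c * v * H - m * (1 + C) - m * s * c)
  (m * H + m * g + T * c * m * H - m * (1 + C) * g)
  (c * g * H + m * v * H - m * m * s)
  (m * g * H) r.
have pw t : 0 <= t <= 1 -> side_density H c m v g (2 * t - 1) <= B (2 * t - 1).
  move=> /andP[t0 t1]; set r := 2 * t - 1.
  have r1 : `|r| <= 1 by rewrite /r ler_norml; apply/andP; split; lra.
  apply: (le_trans (HK N c m v g r hc hm hv hg hN r1)).
  have Qle : ch (r * H) <= C.
    rewrite -ch_abs; apply: ch_mono => //.
    by rewrite normrM (gtr0_norm H0) ler_piMl// ltW.
  (* the only term not integrated exactly: its factor r^2 cosh (r H) is bounded *)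
  have TQ : T * (1 + ch (r * H)) <= s by rewrite -TE ler_wpM2l ?T_ge0// lerD2l.
  have : 0 <= (r * m) ^+ 2 * (H / 2) * (s - T * (1 + ch (r * H))).
    by rewrite mulr_ge0 ?subr_ge0// mulr_ge0 ?sqr_ge0// divr_ge0// ltW.
  rewrite -subr_ge0 /B /basis_sum /side_taylor -/C -/s -/T => h; rewrite -subr_ge0.
  set Q := ch (r * H) in h *; set S := sh (r * H) in h *.
  by apply: (le_trans h); rewrite le_eqVlt; apply/orP; left; apply/eqP; field.
have := le_I01 _ _ (continuous_side_density c m v g) (continuous_basis_sum _ _ _ _ _ _ _ _) pw.
rewrite I01_basis_sum /side_integral => h.
apply: (le_trans (ler_wpM2l (ler0n R 2) h)).
rewrite le_eqVlt; apply/orP; left; apply/eqP.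
by rewrite /side_form; field.
Qed.

(** These inequalities give the signs of the coefficients of the quadratic form. *)
Lemma hyperbolic_bounds : [/\ 1 <= s / H, s / H <= (1 + C) / 2,
  H * H / 3 <= C - s / H & 1 + H * H / 2 <= C].
Proof.
have h0 := ltW H0.
split.
- by rewrite ler_pdivlMr// mul1r sh_ge_id.
- rewrite ler_pdivrMr//; have := two_sh_le H h0; rewrite -/C -/s; lra.
- rewrite -(ler_pM2l H0) mulrBr (mulrC H (s / H)) mulfVK ?lt0r_neq0//.
  have := xch_sub_sh H h0; rewrite -/C -/s; lra.
- exact: ch_ge_sqr.
Qed.

Definition side_sum (c c' b g1 g2 : R) : R :=
  side_integral c (b + g1) b (c' + g2) + side_integral c (b - g1) b (c' - g2) +
  side_integral c' (b + g2) b (c + g1) + side_integral c' (b - g2) b (c - g1).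

(** The linear terms add up to a multiple of c + c', and the constraint reads
    H (c + c') = b^2 - c c'. After this substitution the quadratic form is
    diagonal with negative coefficients, apart from a multiple of (c + c')^2, which
    is of higher order by the same constraint. *)
Lemma side_sum_nonpos : exists2 delta : R, 0 < delta &
  forall c c' b g1 g2 : R, `|c| <= delta -> `|c'| <= delta -> `|b| <= delta ->
    `|g1| <= delta -> `|g2| <= delta ->
    (H + c) * (H + c') - b ^+ 2 = H ^+ 2 -> side_sum c c' b g1 g2 <= 0.
Proof.
have [K K0 HK] := side_integral_le.
have [sH1 sH2 CH CH2] := hyperbolic_bounds.
have Ts := robin_Ts H; rewrite -/T -/C -/s in Ts.
have Tp := T_ge0.
have T1 : T <= 1.
  have := robin_TE H; rewrite -/T -/C -/s => TE.
  have C1 : 0 < 1 + C by rewrite ltr_wpDl// ch_gt0.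
  have : s <= 1 + C.
    have := ch2sh2 H; rewrite -/C -/s => E; have Cg := ch_gt0 H; rewrite -/C in Cg.
    rewrite leNgt; apply/negP => h; have : C * C < s * s by apply: ltr_pM; lra.
    by lra.
  by rewrite -TE -[X in _ <= X -> _]mul1r ler_pM2r.
set S := s / H in sH1 sH2 CH.
(* the coefficient of m^2 in side_form *)
pose Y := s * H / 3 - 2 * S * (C - S).
have sE : s = S * H by rewrite /S mulfVK// lt0r_neq0.
have Yneg : Y <= - (H * H / 3).
  have S0 : 0 <= S by lra.
  have hh : 0 <= H * H / 3 by rewrite divr_ge0// mulr_ge0 ?ltW.
  have h1 := ler_wpM2l S0 CH.
  have h2 : 1 * (H * H / 3) <= S * (H * H / 3) by rewrite ler_wpM2r.
  rewrite /Y sE; lra.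
(* minus the coefficient of c^2 and c'^2, once c c' is written with (c + c')^2 *)
pose kc := 4 + 2 * C - 2 * S - 2 * T * H.
have kc1 : 2 <= kc.
  have : T * H <= H by rewrite ler_piMl// ltW.
  have : 0 <= (H / 2 - 1) * (H / 2 - 1) by rewrite -expr2 sqr_ge0.
  rewrite /kc; lra.
pose k1 := 8 * (1 + C) - 4 * (1 + S).
have k1p : 0 <= k1 by rewrite /k1; lra.
pose k0 := Num.min 1 (H * H / 3).
have HH : 0 < H * H / 3 by rewrite divr_gt0// mulr_gt0.
have k00 : 0 < k0 by rewrite lt_min ltr01 HH.
have k0a : k0 <= 1 by rewrite ge_min lexx.
have k0b : k0 <= H * H / 3 by rewrite ge_min lexx orbT.
have Y0 : 4 * Y <= 0 by lra.
have Yk : 2 * Y <= - k0 by lra.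
have kk : k0 <= kc by lra.
have k8 : k0 <= 8 by lra.
have bb : 4 - 12 * S + 8 * C * (1 - S) <= - 8.
  have : 0 <= 8 * C * (S - 1) by rewrite mulr_ge0 ?subr_ge0// mulr_ge0// ltW// ch_gt0.
  by lra.
(* the two errors, from (c + c')^2 and from the cubic remainder, weigh at most d L *)
pose L := k1 / H + 32 * K * 6 + 1.
have k1H : 0 <= k1 / H by rewrite divr_ge0// ltW.
have L0 : 0 < L by rewrite /L; lra.
exists (Num.min (1 / 12) (k0 / L)); first by rewrite lt_min !divr_gt0.
set d := Num.min _ _ => c c' b g1 g2 hc hc' hb hg1 hg2 det.
have d1 : d <= 1 / 12 by rewrite ge_min lexx.
have d2 : d * L <= k0 by rewrite -ler_pdivlMr// ge_min lexx orbT.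
pose N := `|c| + `|c'| + 2 * `|b| + `|g1| + `|g2|.
have [pc pc' pb pg1 pg2] : [/\ 0 <= `|c|, 0 <= `|c'|, 0 <= `|b|, 0 <= `|g1| & 0 <= `|g2|] by [].
have Nd : N <= 6 * d by rewrite /N; clear -hc hc' hb hg1 hg2; lra.
have N2 : N <= 1 / 2 by clear -Nd d1; lra.
have N0 : 0 <= N by rewrite /N; clear -pc pc' pb pg1 pg2; lra.
pose E := c ^+ 2 + c' ^+ 2 + b ^+ 2 + g1 ^+ 2 + g2 ^+ 2.
have NE : N ^+ 2 <= 8 * E.
  have sq (x : R) : x ^+ 2 = `|x| * `|x| by rewrite -expr2 real_normK ?num_real.
  rewrite expr2 /E !sq /N.
  clear; move: (`|c|) (`|c'|) (`|b|) (`|g1|) (`|g2|) => x1 x2 x3 x4 x5.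
  have q (y z : R) : 0 <= (y - z) * (y - z) by rewrite -expr2 sqr_ge0.
  have := q x1 x2; have := q (2 * x1) x3; have := q x1 x4; have := q x1 x5.
  have := q (2 * x2) x3; have := q x2 x4; have := q x2 x5; have := q x3 (2 * x4).
  have := q x3 (2 * x5); have := q x4 x5; lra.
have bnd (x y z : R) : `|x| + `|y| <= z -> `|x + y| <= z.
  by apply: le_trans; exact: ler_normD.
have bndB (x y z : R) : `|x| + `|y| <= z -> `|x - y| <= z.
  by apply: le_trans; exact: ler_normB.
have [cN cN' bN] : [/\ `|c| <= N, `|c'| <= N & `|b| <= N].
  by split; rewrite /N; clear -pc pc' pb pg1 pg2; lra.
have [bg1 bg2 cg2 cg1] : [/\ `|b| + `|g1| <= N, `|b| + `|g2| <= N, `|c'| + `|g2| <= N & `|c| + `|g1| <= N].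
  by split; rewrite /N; clear -pc pc' pb pg1 pg2; lra.
have h1 := HK N c (b + g1) b (c' + g2) cN (bnd _ _ _ bg1) bN (bnd _ _ _ cg2) N2.
have h2 := HK N c (b - g1) b (c' - g2) cN (bndB _ _ _ bg1) bN (bndB _ _ _ cg2) N2.
have h3 := HK N c' (b + g2) b (c + g1) cN' (bnd _ _ _ bg2) bN (bnd _ _ _ cg1) N2.
have h4 := HK N c' (b - g2) b (c - g1) cN' (bndB _ _ _ bg2) bN (bndB _ _ _ cg1) N2.
have E0 : 0 <= E by rewrite /E !addr_ge0// sqr_ge0.
have err : 4 * (K * N ^+ 3) <= 32 * K * 6 * d * E.
  have : K * N ^+ 3 <= K * ((6 * d) * (8 * E)).
    apply: ler_wpM2l => //; rewrite exprS; apply: ler_pM => //; exact: exprn_ge0.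
  by clear; move: (N ^+ 3) => n; lra.
pose sg := c + c'.
have sgE : H * sg = b ^+ 2 - c * c' by clear -det; move: det; rewrite /sg !expr2; lra.
have sg2 : k1 / 2 * sg ^+ 2 <= k1 / H * d * E.
  have a1 : `|sg| <= 2 * d by apply: bnd; clear -hc hc'; lra.
  have a2 : H * `|sg| <= E.
    have -> : H * `|sg| = `|b ^+ 2 - c * c'| by rewrite -sgE normrM gtr0_norm.
    have := sqr_ge0 (c - c'); have := sqr_ge0 (c + c'); have := sqr_ge0 b.
    have := sqr_ge0 g1; have := sqr_ge0 g2; have := sqr_ge0 c; have := sqr_ge0 c'.
    clear; rewrite /E !expr2 => *; rewrite ler_norml; apply/andP; split; lra.
  have a3 : H * sg ^+ 2 <= 2 * d * E.
    have -> : sg ^+ 2 = `|sg| * `|sg| by rewrite -expr2 real_normK ?num_real.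
    rewrite mulrCA; apply: ler_pM => //; first by rewrite mulr_ge0// ltW.
  have k1H2 : 0 <= k1 / H / 2 by rewrite divr_ge0.
  have := ler_wpM2l k1H2 a3.
  have -> : k1 / H / 2 * (H * sg ^+ 2) = k1 / 2 * sg ^+ 2 by field; exact: lt0r_neq0.
  by clear; move: (k1 / H) (sg ^+ 2) => y z; lra.
rewrite /side_sum.
have total : side_form c (b + g1) b (c' + g2) + side_form c (b - g1) b (c' - g2) +
    side_form c' (b + g2) b (c + g1) + side_form c' (b - g2) b (c - g1) =
  b ^+ 2 * (4 - 12 * S + 8 * C * (1 - S)) + 4 * Y * b ^+ 2 + 2 * Y * (g1 ^+ 2 + g2 ^+ 2)
   - kc * (c ^+ 2 + c' ^+ 2) + k1 / 2 * sg ^+ 2 + 4 * (1 + S) * (H * sg - (b ^+ 2 - c * c')).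
  rewrite /side_form -/S /Y /kc /k1 /sg.
  have -> : T * (H + s) = T * H + (C - 1) by rewrite mulrDr Ts.
  by rewrite sE; field.
rewrite sgE subrr mulr0 addr0 in total.
have m1 : b ^+ 2 * (4 - 12 * S + 8 * C * (1 - S)) <= b ^+ 2 * (- 8).
  by apply: ler_wpM2l; first exact: sqr_ge0.
have m2 : 4 * Y * b ^+ 2 <= 0 by apply: mulr_le0_ge0; [exact: Y0|exact: sqr_ge0].
have gg : 0 <= g1 ^+ 2 + g2 ^+ 2 by rewrite addr_ge0// sqr_ge0.
have m3 : 2 * Y * (g1 ^+ 2 + g2 ^+ 2) <= - k0 * (g1 ^+ 2 + g2 ^+ 2) by exact: ler_wpM2r.
have cc : 0 <= c ^+ 2 + c' ^+ 2 by rewrite addr_ge0// sqr_ge0.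
have m4 : k0 * (c ^+ 2 + c' ^+ 2) <= kc * (c ^+ 2 + c' ^+ 2) by exact: ler_wpM2r.
have b0 : 0 <= b ^+ 2 by exact: sqr_ge0.
have m5 : k0 * b ^+ 2 <= 8 * b ^+ 2 by exact: ler_wpM2r.
have m6 : (k1 / H + 32 * K * 6) * d * E <= k0 * E.
  apply: ler_wpM2r => //; apply: (le_trans _ d2); rewrite mulrC; apply: ler_wpM2l.
    by rewrite /d le_min !divr_ge0// ltW.
  by rewrite /L lerDl.
have EE : k0 * E = k0 * (c ^+ 2 + c' ^+ 2) + k0 * b ^+ 2 + k0 * (g1 ^+ 2 + g2 ^+ 2).
  by rewrite /E; ring.
move: h1 h2 h3 h4 err total m1 m2 m3 m4 m5 m6 EE sg2.
set X1 := side_integral _ _ _ _; set X2 := side_integral _ _ _ _.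
set X3 := side_integral _ _ _ _; set X4 := side_integral _ _ _ _.
set F1 := side_form _ _ _ _; set F2 := side_form _ _ _ _.
set F3 := side_form _ _ _ _; set F4 := side_form _ _ _ _.
set e1 := K * N ^+ 3; set e2 := 32 * K * 6 * d * E; set e3 := k1 / 2 * sg ^+ 2.
set e4 := b ^+ 2 * _; set e5 := 4 * Y * _; set e6 := 2 * Y * _; set e7 := kc * _.
set e8 := k0 * (c ^+ 2 + _); set e9 := k1 / H * d * E; set e10 := k0 * (g1 ^+ 2 + _).
move=> h1 h2 h3 h4 err total m1 m2 m3 m4 m5 m6 EE sg2.
have {}m6 : e9 + e2 <= e8 + k0 * b ^+ 2 + e10.
  by rewrite -EE (le_trans _ m6)// le_eqVlt; apply/orP; left; apply/eqP; rewrite /e9 /e2; ring.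
have {}m3 : e6 <= - e10 by rewrite /e10 -mulNr.
clear -h1 h2 h3 h4 err total m1 m2 m3 m4 m5 m6 sg2; move: h1 h2 h3 h4 err total m1 m2 m3 m4 m5 m6 sg2.
clearbody X1 X2 X3 X4 F1 F2 F3 F4 e1 e2 e3 e4 e5 e6 e7 e8 e9 e10.
move: (k0 * b ^+ 2) (b ^+ 2) => x y; clear; lra.
Qed.
End KeyInequality.

(** * The trial function in an orthonormal frame *)

Section TestFunction.
Context {R : realType}.
Implicit Types (o e x p q : R * R).

(** Coordinates in the orthonormal frame at o with first axis e and orientation
    eps, which is 1 or - 1. *)
Definition frameX o e x : R := e.1 * (x.1 - o.1) + e.2 * (x.2 - o.2).
Definition frameY o e (eps : R) x : R := eps * (e.1 * (x.2 - o.2) - e.2 * (x.1 - o.1)).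

(** An eigenfunction on the square, and the trial function near it. *)
Definition test_fun o e (eps k : R) x : R :=
  ch (k * frameX o e x) * ch (k * frameY o e eps x).

Definition test_fun1 o e (eps k : R) x : R :=
  k * (sh (k * frameX o e x) * ch (k * frameY o e eps x) * e.1 -
       eps * (ch (k * frameX o e x) * sh (k * frameY o e eps x)) * e.2).

Definition test_fun2 o e (eps k : R) x : R :=
  k * (sh (k * frameX o e x) * ch (k * frameY o e eps x) * e.2 +
       eps * (ch (k * frameX o e x) * sh (k * frameY o e eps x)) * e.1).

(** Differentiating the trial function turns its factors into hyperbolic sines,
    so its second derivatives need other factors than cosh. *)
Lemma C1_frame_product o e (eps k : R) (F dF G dG : R -> R) :
  (forall s, is_derive s (1 : R) F (dF s)) -> continuous dF ->
  (forall s, is_derive s (1 : R) G (dG s)) -> continuous dG ->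
  C1 (fun x => F (k * frameX o e x) * G (k * frameY o e eps x))
     (fun x => k * (dF (k * frameX o e x) * G (k * frameY o e eps x) * e.1 -
        eps * (F (k * frameX o e x) * dG (k * frameY o e eps x)) * e.2))
     (fun x => k * (dF (k * frameX o e x) * G (k * frameY o e eps x) * e.2 +
        eps * (F (k * frameX o e x) * dG (k * frameY o e eps x)) * e.1)).
Proof.
move=> hF cF hG cG.
have EX x : lin (k * e.1) (k * e.2) (- k * (e.1 * o.1 + e.2 * o.2)) x = k * frameX o e x.
  by rewrite /lin /frameX; ring.
have EY x : lin (- k * eps * e.2) (k * eps * e.1) (- k * eps * (e.1 * o.2 - e.2 * o.1)) x = k * frameY o e eps x.
  by rewrite /lin /frameY; ring.
have c1 := C1_comp _ _ _ F dF (C1_lin (k * e.1) (k * e.2) (- k * (e.1 * o.1 + e.2 * o.2))) hF cF.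
have c2 := C1_comp _ _ _ G dG (C1_lin (- k * eps * e.2) (k * eps * e.1) (- k * eps * (e.1 * o.2 - e.2 * o.1))) hG cG.
apply: (eq_C1 _ _ _ _ _ _ (C1M _ _ _ _ _ _ c1 c2)) => x; rewrite ?EX ?EY //=; ring.
Qed.

Lemma C1_test_fun o e eps k : C1 (test_fun o e eps k) (test_fun1 o e eps k) (test_fun2 o e eps k).
Proof.
exact: (C1_frame_product o e eps k ch sh ch sh drv_ch continuous_sh drv_ch continuous_sh).
Qed.

Lemma test_fun_helmholtz o e (eps k : R) : e.1 ^+ 2 + e.2 ^+ 2 = 1 -> eps * eps = 1 ->
  exists u11 u12 u21 u22, [/\ C1 (test_fun1 o e eps k) u11 u12,
    C1 (test_fun2 o e eps k) u21 u22 &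
    forall x, u11 x + u22 x = 2 * k ^+ 2 * test_fun o e eps k x].
Proof.
move=> e1 ee.
have cA := C1_frame_product o e eps k sh ch ch sh drv_sh continuous_ch drv_ch continuous_sh.
have cB := C1_frame_product o e eps k ch sh sh ch drv_ch continuous_sh drv_sh continuous_ch.
have c1 := C1D _ _ _ _ _ _ (C1M _ _ _ _ _ _ (C1_lin 0 0 (k * e.1)) cA)
  (C1M _ _ _ _ _ _ (C1_lin 0 0 (- k * eps * e.2)) cB).
have c2 := C1D _ _ _ _ _ _ (C1M _ _ _ _ _ _ (C1_lin 0 0 (k * e.2)) cA)
  (C1M _ _ _ _ _ _ (C1_lin 0 0 (k * eps * e.1)) cB).
do 4 eexists; split.
- by apply: (eq_C1 _ _ _ _ _ _ c1) => // x; rewrite /test_fun1 /lin; ring.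
- by apply: (eq_C1 _ _ _ _ _ _ c2) => // x; rewrite /test_fun2 /lin; ring.
move=> x; rewrite /test_fun /lin /=.
set A := ch (k * frameX o e x); set A' := sh (k * frameX o e x).
set B := ch (k * frameY o e eps x); set B' := sh (k * frameY o e eps x).
transitivity (k ^+ 2 * (A * B) * (e.1 ^+ 2 + e.2 ^+ 2) * (1 + eps * eps)); first by ring.
by rewrite e1 ee; ring.
Qed.

Lemma test_fun_gt0 o e eps k x : 0 < test_fun o e eps k x.
Proof. by rewrite /test_fun mulr_gt0 ?ch_gt0. Qed.

Lemma sh_double (x : R) : sh (2 * x) = 2 * (sh x * ch x).
Proof. by rewrite mulrDl mul1r shD; ring. Qed.

Lemma ch_double (x : R) : ch (2 * x) = 2 * (ch x * ch x) - 1.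
Proof. by rewrite mulrDl mul1r chD; have := ch2sh2 x; lra. Qed.

Lemma frame_normal_flux o e (eps k : R) x (d : R * R) : eps * eps = 1 ->
  eps * (test_fun1 o e eps k x * d.2 - test_fun2 o e eps k x * d.1) =
  k * (sh (k * frameX o e x) * ch (k * frameY o e eps x) * (eps * (e.1 * d.2 - e.2 * d.1)) -
       ch (k * frameX o e x) * sh (k * frameY o e eps x) * (e.1 * d.1 + e.2 * d.2)).
Proof.
move=> ee; rewrite /test_fun1 /test_fun2.
set A := ch (k * frameX o e x); set A' := sh (k * frameX o e x).
set B := ch (k * frameY o e eps x); set B' := sh (k * frameY o e eps x).
transitivity (k * (A' * B * (eps * (e.1 * d.2 - e.2 * d.1))) - k * (eps * eps) * (A * B') * (e.1 * d.1 + e.2 * d.2)); first by ring.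
by rewrite ee; ring.
Qed.

(** Eight times the density of the flux of u grad u minus the Robin term along a
    side, by the double-angle formulas, in coordinates scaled by 2k: dx and dy are
    the increments along the side and l is its length. *)
Definition robin_density (T x y dx dy l : R) : R :=
  sh x * (1 + ch y) * dy - sh y * (1 + ch x) * dx - T * (1 + ch x) * (1 + ch y) * l.

Lemma continuous_robin_density (T x0 y0 x1 y1 dx dy l : R) : continuous (fun t : R =>
  robin_density T (x0 + t * (x1 - x0)) (y0 + t * (y1 - y0)) dx dy l).
Proof.
have ca (a b : R) : continuous (fun t : R => a + t * (b - a)).
  move=> t; have := continuous_affine (b - a) a t.
  by rewrite (_ : (fun t => (b - a) * t + a) = (fun t => a + t * (b - a)))//; apply/funext => r; ring.
have cc (a b : R) (F : R -> R) : continuous F -> continuous (fun t : R => F (a + t * (b - a))).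
  by move=> cF t; exact: (@continuous_comp R R R (fun t : R => a + t * (b - a)) F t (ca a b t) (cF _)).
have k := @continuous_cstR R; have M := @continuous_mulR R.
have A := @continuous_addR R; have B := @continuous_subR R.
rewrite /robin_density.
apply: (B _ _ (B _ _ _ _)).
- by apply: (M _ _) => //; apply: (M _ _); [exact: (cc _ _ _ continuous_sh)|apply: (A _ _) => //; exact: (cc _ _ _ continuous_ch)].
- by apply: (M _ _) => //; apply: (M _ _); [exact: (cc _ _ _ continuous_sh)|apply: (A _ _) => //; exact: (cc _ _ _ continuous_ch)].
- apply: (M _ _) => //; apply: (M _ _); [apply: (M _ _) => //|]; apply: (A _ _) => //; exact: (cc _ _ _ continuous_ch).
Qed.

Definition side_excess (T x0 y0 x1 y1 l : R) : R :=
  I01 (fun t => robin_density T (x0 + t * (x1 - x0)) (y0 + t * (y1 - y0)) (x1 - x0) (y1 - y0) l).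

Lemma side_flux_excess o e (eps k T : R) (p : 'I_4 -> R * R) (i : 'I_4) : 0 < k ->
  e.1 ^+ 2 + e.2 ^+ 2 = 1 -> eps * eps = 1 ->
  let u := test_fun o e eps k in
  let X j := 2 * k * frameX o e (p j) in let Y j := 2 * k * frameY o e eps (p j) in
  eps * flux (fun x => u x * test_fun1 o e eps k x) (fun x => u x * test_fun2 o e eps k x) (p i) (p (ordS i))
   - k * T * (side_length p i * I01 (fun t => u (side p i t) ^+ 2)) =
  8^-1 * side_excess T (X i) (Y i) (X (ordS i)) (Y (ordS i)) (2 * k * side_length p i).
Proof.
move=> k0 e1 ee u X Y.
have cu : continuous u by case: (C1_test_fun o e eps k).
have [_ cu1 cu2 _ _] := C1_test_fun o e eps k.
have cF1 : continuous (fun x => u x * test_fun1 o e eps k x) by move=> x; exact: (cvgM (cu x) (cu1 x)).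
have cF2 : continuous (fun x => u x * test_fun2 o e eps k x) by move=> x; exact: (cvgM (cu x) (cu2 x)).
have cs : continuous (fun t => u (side p i t) ^+ 2).
  exact: (continuous_segment _ _ _ (continuous_sqr _ cu)).
have cl : continuous (fun t => side_length p i * u (side p i t) ^+ 2).
  by move=> t; apply: cvgM; [exact: cvg_cst|exact: cs].
rewrite /flux -I01Z; last exact: (continuous_flux _ _ _ _ cF1 cF2).
rewrite -(I01Z (side_length p i))// -(I01Z (k * T))// -I01B; last 2 first.
- by move=> t; apply: cvgM; [exact: cvg_cst|exact: (continuous_flux _ _ _ _ cF1 cF2)].
- by move=> t; apply: cvgM; [exact: cvg_cst|exact: cl].
have crd (x0 y0 x1 y1 l : R) : continuous (fun t : R =>
    robin_density T (x0 + t * (x1 - x0)) (y0 + t * (y1 - y0)) (x1 - x0) (y1 - y0) l).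
  exact: continuous_robin_density.
rewrite /side_excess -I01Z; last exact: crd.
apply: eq_I01 => t _.
have Es : p i + t *: (p (ordS i) - p i) = side p i t by [].
rewrite !Es /X /Y.
have EX : 2 * k * frameX o e (p i) + t * (2 * k * frameX o e (p (ordS i)) - 2 * k * frameX o e (p i)) =
   2 * (k * frameX o e (side p i t)) by rewrite -Es /frameX /= /GRing.scale /=; ring.
have EY : 2 * k * frameY o e eps (p i) + t * (2 * k * frameY o e eps (p (ordS i)) - 2 * k * frameY o e eps (p i)) =
   2 * (k * frameY o e eps (side p i t)) by rewrite -Es /frameY /= /GRing.scale /=; ring.
have DX : 2 * k * frameX o e (p (ordS i)) - 2 * k * frameX o e (p i) =
   2 * k * (e.1 * (p (ordS i) - p i).1 + e.2 * (p (ordS i) - p i).2) by rewrite /frameX /=; ring.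
have DY : 2 * k * frameY o e eps (p (ordS i)) - 2 * k * frameY o e eps (p i) =
   2 * k * (eps * (e.1 * (p (ordS i) - p i).2 - e.2 * (p (ordS i) - p i).1)) by rewrite /frameY /=; ring.
rewrite EX EY DX DY /robin_density !sh_double !ch_double.
set d := p (ordS i) - p i; set x := side p i t.
have := frame_normal_flux o e eps k x d ee; rewrite /u /test_fun.
set A := ch (k * frameX o e x); set A' := sh (k * frameX o e x).
set B := ch (k * frameY o e eps x); set B' := sh (k * frameY o e eps x).
set V1 := test_fun1 _ _ _ _ _; set V2 := test_fun2 _ _ _ _ _ => NF.
transitivity (A * B * (eps * (V1 * d.2 - V2 * d.1)) - k * T * (side_length p i * (A * B) ^+ 2)).
  by rewrite /d /=; ring.
by rewrite NF; clear; field; rewrite ?pnatr_eq0.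
Qed.
End TestFunction.

(** * The upper bound near a square, in adapted coordinates *)

Section LocalUpper.
Context {R : realType}.
Implicit Types (o e x : R * R) (p : 'I_4 -> R * R).

Lemma side_excess_neg (T x0 y0 x1 y1 l : R) :
  side_excess T (- x0) (- y0) (- x1) (- y1) l = side_excess T x0 y0 x1 y1 l.
Proof.
apply: eq_I01 => t _; rewrite /robin_density.
rewrite (_ : - x0 + t * (- x1 - - x0) = - (x0 + t * (x1 - x0))); last by ring.
rewrite (_ : - y0 + t * (- y1 - - y0) = - (y0 + t * (y1 - y0))); last by ring.
rewrite !shN !chN; ring.
Qed.

Lemma side_excess_swap (T x0 y0 x1 y1 l : R) :
  side_excess T y1 x1 y0 x0 l = side_excess T x0 y0 x1 y1 l.
Proof.
rewrite /side_excess -I01_rev; last exact: continuous_robin_density.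
apply: eq_I01 => t _; rewrite /robin_density.
rewrite (_ : y1 + (1 - t) * (y0 - y1) = y0 + t * (y1 - y0)); last by ring.
rewrite (_ : x1 + (1 - t) * (x0 - x1) = x0 + t * (x1 - x0)); last by ring.
ring.
Qed.

(** The length l enters with a negative sign, and it is at least the extent
    2 (H + g) of the side in the second coordinate. *)
Lemma side_excess_le (H c m v g l : R) : 0 < H -> 2 * (H + g) <= l ->
  side_excess (robin_T H) (H + c - m) (v - (H + g)) (H + c + m) (v + (H + g)) l <=
  side_integral H c m v g.
Proof.
move=> H0 hl; have cd := continuous_side_density H c m v g.
rewrite /side_integral -I01Z//; apply: le_I01; first exact: continuous_robin_density.
  by move=> t; apply: cvgM; [exact: cvg_cst|exact: cd].
move=> t _; rewrite /robin_density /side_density /robin_phi.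
have T0 := T_ge0 H H0.
rewrite (_ : H + c - m + t * (H + c + m - (H + c - m)) = H + (c + (2 * t - 1) * m)); last by ring.
rewrite (_ : v - (H + g) + t * (v + (H + g) - (v - (H + g))) = (2 * t - 1) * H + (v + (2 * t - 1) * g)); last by ring.
set x := H + (c + (2 * t - 1) * m); set y := (2 * t - 1) * H + (v + (2 * t - 1) * g).
have x0 : 0 <= 1 + ch x by rewrite addr_ge0// ltW// ch_gt0.
have y0 : 0 <= 1 + ch y by rewrite addr_ge0// ltW// ch_gt0.
set T := robin_T H in T0 *.
have := mulr_ge0 (mulr_ge0 (mulr_ge0 T0 x0) y0) (_ : 0 <= l - 2 * (H + g)).
rewrite subr_ge0 => /(_ hl); rewrite -subr_ge0 => h.
rewrite -subr_ge0; apply: (le_trans h).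
rewrite le_eqVlt; apply/orP; left; apply/eqP; ring.
Qed.

Lemma frame_orient o e (eps k : R) a b c : e.1 ^+ 2 + e.2 ^+ 2 = 1 ->
  let X x := 2 * k * frameX o e x in let Y x := 2 * k * frameY o e eps x in
  (2 * k) ^+ 2 * (eps * orient a b c) =
  (X b - X a) * (Y c - Y a) - (Y b - Y a) * (X c - X a).
Proof.
move=> e1 X Y; transitivity ((2 * k) ^+ 2 * (eps * orient a b c) * (e.1 ^+ 2 + e.2 ^+ 2)).
  by rewrite e1 mulr1.
rewrite /X /Y /frameX /frameY /orient /cross /=; ring.
Qed.

Lemma frame_orient1 o e (eps : R) a b c : e.1 ^+ 2 + e.2 ^+ 2 = 1 ->
  eps * orient a b c =
  (frameX o e b - frameX o e a) * (frameY o e eps c - frameY o e eps a) -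
  (frameY o e eps b - frameY o e eps a) * (frameX o e c - frameX o e a).
Proof.
move=> e1; have := frame_orient o e eps 2^-1 a b c e1.
rewrite (_ : 2 * 2^-1 = 1) ?mulfV ?pnatr_eq0//=.
by rewrite expr1n !mul1r.
Qed.

Lemma frame_length o e (eps k : R) p i : 0 < k -> e.1 ^+ 2 + e.2 ^+ 2 = 1 -> eps * eps = 1 ->
  let X j := 2 * k * frameX o e (p j) in let Y j := 2 * k * frameY o e eps (p j) in
  `|X (ordS i) - X i| <= 2 * k * side_length p i /\ `|Y (ordS i) - Y i| <= 2 * k * side_length p i.
Proof.
move=> k0 e1 ee X Y.
have L0 : 0 <= side_length p i by exact: sqrtr_ge0.
have E : (X (ordS i) - X i) ^+ 2 + (Y (ordS i) - Y i) ^+ 2 = (2 * k * side_length p i) ^+ 2.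
  rewrite [RHS]exprMn /side_length sqr_sqrtr; last by rewrite addr_ge0 ?sqr_ge0.
  transitivity ((2 * k) ^+ 2 * ((e.1 * ((p (ordS i)).1 - (p i).1) + e.2 * ((p (ordS i)).2 - (p i).2)) ^+ 2
     + (eps * eps) * (e.1 * ((p (ordS i)).2 - (p i).2) - e.2 * ((p (ordS i)).1 - (p i).1)) ^+ 2)).
    by rewrite /X /Y /frameX /frameY; ring.
  rewrite ee mul1r; congr (_ * _).
  transitivity ((e.1 ^+ 2 + e.2 ^+ 2) * (((p i).1 - (p (ordS i)).1) ^+ 2 + ((p i).2 - (p (ordS i)).2) ^+ 2)); first by ring.
  by rewrite e1 mul1r.
have l0 : 0 <= 2 * k * side_length p i by rewrite !mulr_ge0// ltW.
by split; rewrite -(@ler_pXn2r _ 2)// ?nnegrE// real_normK ?num_real// -E ?lerDl ?lerDr sqr_ge0.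
Qed.

Lemma sqr1_sign (s : R) : s ^+ 2 = 1 -> s = 1 \/ s = -1.
Proof.
move=> s1; have : (s - 1) * (s + 1) = 0 by rewrite -subr_sqr_1 s1 subrr.
by move/eqP; rewrite mulf_eq0 subr_eq0 addr_eq0 => /orP[/eqP ->|/eqP ->]; [left|right].
Qed.

Lemma frame_convex o e (eps k : R) p : 0 < k -> e.1 ^+ 2 + e.2 ^+ 2 = 1 -> eps * eps = 1 ->
  0 < eps * orient (p q0) (p q1) (p q2) -> 0 < eps * orient (p q1) (p q2) (p q3) ->
  0 < eps * orient (p q2) (p q3) (p q0) -> 0 < eps * orient (p q3) (p q0) (p q1) ->
  convex_polygon eps p.
Proof.
move=> k0 e1 ee h1 h2 h3 h0.
have [E|E] := sqr1_sign eps ee; [left|right]; split => //.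
  by move: h0 h1 h2 h3; rewrite E !mul1r.
have R3 (a b c : R * R) : orient c b a = -1 * orient a b c by rewrite /orient /cross /=; ring.
by move: h0 h1 h2 h3; rewrite E -!R3.
Qed.

(** Divergence theorem for the field x / 2. *)
Lemma polygon_area (eps A : R) p : convex_polygon eps p ->
  area (polygon_interior p) = A%:E ->
  2 * A = eps * orient (p q0) (p q1) (p q2) + eps * orient (p q2) (p q3) (p q0).
Proof.
move=> cp areaA; have ee := convex_polygon_sqr _ _ cp.
have mO := measurable_convex_polygon _ _ cp.
have := divergence_polygon _ _ _ _ _ _ _ _ cp (C1_lin (2^-1) 0 0) (C1_lin 0 (2^-1) 0).
have F (a b : R * R) : flux (lin (2^-1) 0 0) (lin 0 (2^-1) 0) a b = (a.1 * b.2 - a.2 * b.1) / 2.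
  rewrite /flux (_ : I01 _ = I01 (fun=> (a.1 * b.2 - a.2 * b.1) / 2)); last first.
    by apply: eq_I01 => t _; rewrite /lin /= /GRing.scale /=; field.
  by rewrite /I01 Rintegral_cst//= lebesgue_measure_itv/= lte_fin ltr01 oppr0 adde0 mulr1.
rewrite sum_ord4 !ordSE !F.
rewrite (_ : Rintegral _ _ _ = A); last first.
  rewrite /Rintegral (_ : (fun x => _) = cst 1%:E); last by apply/funext => x /=; congr EFin; rewrite /cst /=; field.
  by rewrite integral_cst// mul1e areaA.
move=> E; transitivity (2 * (eps * eps) * A); first by rewrite ee mulr1.
by rewrite -mulrA -mulrA E /orient /cross /=; field.
Qed.

(** The left and bottom sides reduce to the right and top ones by a central
    symmetry, and the top to the right by exchanging the coordinates. The area
    condition becomes the constraint of [side_sum_nonpos]. *)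
Lemma robin_upper_near_square (H : R) : 0 < H -> exists2 delta : R, 0 < delta &
  forall o e (eps k A c c' b g1 g2 : R) p,
  let X j := 2 * k * frameX o e (p j) in let Y j := 2 * k * frameY o e eps (p j) in
  0 < k -> e.1 ^+ 2 + e.2 ^+ 2 = 1 -> eps * eps = 1 -> 0 < A -> k ^+ 2 * A = H ^+ 2 ->
  area (polygon_interior p) = A%:E ->
  X q0 = H + c + (b + g1) -> Y q0 = H + c' + (b + g2) ->
  X q1 = b - (H + (c + g1)) -> Y q1 = H + c' - (b + g2) ->
  X q2 = - (H + c + (b - g1)) -> Y q2 = - (H + c' + (b - g2)) ->
  X q3 = - (b - (H + (c - g1))) -> Y q3 = - (H + c' - (b - g2)) ->
  `|c| <= delta -> `|c'| <= delta -> `|b| <= delta -> `|g1| <= delta -> `|g2| <= delta ->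
  (robin_eigenvalue p (- (k * robin_T H)) <= (- (2 * k ^+ 2))%:E)%E.
Proof.
move=> H0; have [d1 d10 key] := side_sum_nonpos H H0.
exists (Num.min d1 (H / 10)); first by rewrite lt_min d10 divr_gt0.
move=> o e eps k A c c' b g1 g2 p X Y k0 e1 ee A0 kA areaA X0 Y0 X1 Y1 X2 Y2 X3 Y3.
rewrite !le_min => /andP[hc /ler_normlP[hcn hcp]] /andP[hc' /ler_normlP[hcn' hcp']].
move=> /andP[hb /ler_normlP[hbn hbp]] /andP[hg1 /ler_normlP[hg1n hg1p]] /andP[hg2 /ler_normlP[hg2n hg2p]].
have kk0 : 0 < (2 * k) ^+ 2 by rewrite exprn_gt0// mulr_gt0.
have O a b' c0 := frame_orient o e eps k a b' c0 e1.
have prod (a a' u v : R) : 8 / 10 * H <= a -> 8 / 10 * H <= a' -> u <= 2 / 10 * H -> v <= 12 / 10 * H ->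
    - (2 / 10 * H) <= u -> - (12 / 10 * H) <= v -> 0 < a * a' - u * v.
  clear -H0 => ha ha' hu hv hu' hv'.
  have h1 : (8 / 10 * H) * (8 / 10 * H) <= a * a' by apply: ler_pM => //; lra.
  have h2 : u * v <= (2 / 10 * H) * (12 / 10 * H).
    apply: (le_trans (ler_norm _)); rewrite normrM; apply: ler_pM => //; rewrite ler_norml; lra.
  have h3 : 0 < H * H by rewrite mulr_gt0.
  lra.
have cp : convex_polygon eps p.
  have pos a b' c0 : 0 < (2 * k) ^+ 2 * (eps * orient a b' c0) -> 0 < eps * orient a b' c0.
    by rewrite pmulr_rgt0.
  apply: (frame_convex o e eps k p k0 e1 ee); apply: pos; rewrite O -/(X _) -/(X _) -/(X _) -/(Y _) -/(Y _) -/(Y _).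
  - rewrite X0 X1 X2 Y0 Y1 Y2.
    rewrite (_ : _ - _ = 4 * ((H + c + g1) * (H + c' + b) - (b + g2) * (H + c + b))); last by ring.
    by rewrite pmulr_rgt0//; apply: prod; clear -hcn hcp hcn' hcp' hbn hbp hg1n hg1p hg2n hg2p H0; lra.
  - rewrite X1 X2 X3 Y1 Y2 Y3.
    rewrite (_ : _ - _ = 4 * ((H + c' - g2) * (H + c - b) - (g1 - b) * (H + c' - b))); last by ring.
    by rewrite pmulr_rgt0//; apply: prod; clear -hcn hcp hcn' hcp' hbn hbp hg1n hg1p hg2n hg2p H0; lra.
  - rewrite X2 X3 X0 Y2 Y3 Y0.
    rewrite (_ : _ - _ = 4 * ((H + c - g1) * (H + c' + b) - (b - g2) * (H + c + b))); last by ring.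
    by rewrite pmulr_rgt0//; apply: prod; clear -hcn hcp hcn' hcp' hbn hbp hg1n hg1p hg2n hg2p H0; lra.
  - rewrite X3 X0 X1 Y3 Y0 Y1.
    rewrite (_ : _ - _ = 4 * ((H + c' + g2) * (H + c - b) - - (b + g1) * (H + c' - b))); last by ring.
    by rewrite pmulr_rgt0//; apply: prod; clear -hcn hcp hcn' hcp' hbn hbp hg1n hg1p hg2n hg2p H0; lra.
have SA := polygon_area _ _ _ cp areaA.
(* the shoelace formula in scaled coordinates *)
have key1 : (H + c) * (H + c') - b ^+ 2 = H ^+ 2.
  have : (2 * k) ^+ 2 * (2 * A) = 8 * H ^+ 2 by rewrite -kA; ring.
  rewrite SA mulrDr !O -/(X _) -/(X _) -/(X _) -/(X _) -/(Y _) -/(Y _) -/(Y _) -/(Y _) X0 X1 X2 X3 Y0 Y1 Y2 Y3.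
  clear; move=> h; apply: (mulfI (_ : 8 != 0)); first by rewrite pnatr_eq0.
  by rewrite -h; ring.
have {}key := key _ _ _ _ _ hc hc' hb hg1 hg2 key1.
have [u11 [u12 [u21 [u22 [cu1 cu2 pde]]]]] := test_fun_helmholtz o e eps k e1 ee.
apply: (robin_eigenvalue_upper eps p _ _ _ _ _ _ _ _ _ _ cp A0 areaA (C1_test_fun o e eps k) cu1 cu2 pde).
  by move=> x; exact: test_fun_gt0.
rewrite -subr_le0 /boundary_mass mulr_sumr mulr_sumr -sumrB.
under eq_bigr do rewrite (side_flux_excess o e eps k (robin_T H) p _ k0 e1 ee).
rewrite -mulr_sumr pmulr_rle0 ?invr_gt0// sum_ord4 !ordSE.
rewrite -/(X _) -/(X _) -/(X _) -/(X _) -/(Y _) -/(Y _) -/(Y _) -/(Y _).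
apply: le_trans key.
rewrite /side_sum.
have len i := frame_length o e eps k p i k0 e1 ee.
have dist (a a' l : R) : `|a - a'| <= l -> a - a' <= l by apply: le_trans; exact: ler_norm.
have dist' (a a' l : R) : `|a - a'| <= l -> a' - a <= l by rewrite distrC; exact: dist.
have S3 : side_excess (robin_T H) (X q3) (Y q3) (X q0) (Y q0) (2 * k * side_length p q3) <=
    side_integral H c (b + g1) b (c' + g2).
  have [_] := len q3; rewrite ordSE => /dist; rewrite -/(Y _) -/(Y _) Y0 Y3 X0 X3 => hl.
  have := side_excess_le H c (b + g1) b (c' + g2) _ H0 (_ : _ <= 2 * k * side_length p q3).
  have -> : H + c - (b + g1) = - (b - (H + (c - g1))) by ring.
  have -> : b - (H + (c' + g2)) = - (H + c' - (b - g2)) by ring.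
  have -> : b + (H + (c' + g2)) = H + c' + (b + g2) by ring.
  by apply; apply: le_trans hl; clear; lra.
have S1 : side_excess (robin_T H) (X q1) (Y q1) (X q2) (Y q2) (2 * k * side_length p q1) <=
    side_integral H c (b - g1) b (c' - g2).
  have [_] := len q1; rewrite ordSE => /dist'; rewrite -/(Y _) -/(Y _) Y1 Y2 X1 X2 => hl.
  have := side_excess_le H c (b - g1) b (c' - g2) _ H0 (_ : _ <= 2 * k * side_length p q1).
  rewrite -side_excess_neg.
  have -> : - (H + c - (b - g1)) = b - (H + (c + g1)) by ring.
  have -> : - (b - (H + (c' - g2))) = H + c' - (b + g2) by ring.
  have -> : - (b + (H + (c' - g2))) = - (H + c' + (b - g2)) by ring.
  by apply; apply: le_trans hl; clear; lra.
have S0 : side_excess (robin_T H) (X q0) (Y q0) (X q1) (Y q1) (2 * k * side_length p q0) <=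
    side_integral H c' (b + g2) b (c + g1).
  have [+ _] := len q0; rewrite ordSE => /dist'; rewrite -/(X _) -/(X _) Y0 Y1 X0 X1 => hl.
  have := side_excess_le H c' (b + g2) b (c + g1) _ H0 (_ : _ <= 2 * k * side_length p q0).
  rewrite side_excess_swap.
  have -> : b + (H + (c + g1)) = H + c + (b + g1) by ring.
  by apply; apply: le_trans hl; clear; lra.
have S2 : side_excess (robin_T H) (X q2) (Y q2) (X q3) (Y q3) (2 * k * side_length p q2) <=
    side_integral H c' (b - g2) b (c - g1).
  have [+ _] := len q2; rewrite ordSE => /dist; rewrite -/(X _) -/(X _) Y2 Y3 X2 X3 => hl.
  have := side_excess_le H c' (b - g2) b (c - g1) _ H0 (_ : _ <= 2 * k * side_length p q2).
  rewrite side_excess_swap -side_excess_neg.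
  have -> : - (b + (H + (c - g1))) = - (H + c + (b - g1)) by ring.
  by apply; apply: le_trans hl; clear; lra.
have sum4 (a0 a1 a2 a3 b0 b1 b2 b3 : R) : a0 <= b0 -> a1 <= b1 -> a2 <= b2 -> a3 <= b3 ->
    a0 + a1 + a2 + a3 <= b3 + b1 + b0 + b2 by clear; lra.
exact: sum4 S0 S1 S2 S3.
Qed.
End LocalUpper.

(** * The Robin eigenvalue of a square *)

Section SquareEigenvalue.
Context {R : realType}.
Implicit Types (o e x : R * R) (p q : 'I_4 -> R * R).

(** Intermediate value theorem between 0 and max 1 (3 c), where robin_T is at least
    1 / 3 because exp 1 >= 2. *)
Lemma robin_T_root (c : R) : 0 < c -> exists2 H : R, 0 < H & H * robin_T H = c.
Proof.
move=> c0; pose M : R := Num.max 1 (3 * c).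
have M1 : 1 <= M by rewrite le_max lexx.
have Mc : 3 * c <= M by rewrite le_max lexx orbT.
have M0 : 0 <= M by apply: le_trans M1.
have cf : continuous (fun H : R => H * robin_T H).
  move=> x; apply: (@cvgM _ _ _ _ id robin_T); first exact: cvg_id.
  apply: (@cvgM _ _ _ _ sh (fun h => (1 + ch h)^-1)); first exact: continuous_sh.
  apply: cvgV; first by rewrite lt0r_neq0// ltr_wpDl// ch_gt0.
  by apply: cvgD; [exact: cvg_cst|exact: continuous_ch].
have TM : 1 / 3 <= robin_T M.
  rewrite /robin_T ler_pdivlMr; last by rewrite ltr_wpDl// ch_gt0.
  rewrite /sh /ch expRN.
  have E2 : 2 <= expR M by apply: le_trans (expR_ge1Dx M); lra.
  have E0 : 0 < expR M by apply: lt_le_trans E2.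
  have : (expR M)^-1 <= 2^-1 by rewrite lef_pV2 ?posrE.
  by move: E2; clear; lra.
have range : Num.min (0 * robin_T 0) (M * robin_T M) <= c <= Num.max (0 * robin_T 0) (M * robin_T M).
  rewrite mul0r ge_min ltW//= le_max; apply/orP; right.
  apply: (@le_trans _ _ (M * (1 / 3))); first by move: Mc; clear; lra.
  by rewrite ler_wpM2l.
have [H] := @IVT R (fun H => H * robin_T H) 0 M c M0 (continuous_subspaceT cf) range.
rewrite in_itv /= => /andP[H0 _] E; exists H => //.
rewrite lt_neqAle H0 andbT eq_sym; apply/eqP => h; move: E c0; rewrite h mul0r => <-.
by rewrite ltxx.
Qed.

Definition square_in_frame o e (eps h : R) q : Prop :=
  [/\ frameX o e (q q0) = h /\ frameY o e eps (q q0) = h,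
      frameX o e (q q1) = - h /\ frameY o e eps (q q1) = h,
      frameX o e (q q2) = - h /\ frameY o e eps (q q2) = - h &
      frameX o e (q q3) = h /\ frameY o e eps (q q3) = - h].

(** On each side the normal derivative of the trial function is k tanh (k h) times
    its value. *)
Lemma robin_lower_square o e (eps h k A : R) q : 0 < h -> 0 < k ->
  e.1 ^+ 2 + e.2 ^+ 2 = 1 -> eps * eps = 1 ->
  square_in_frame o e eps h q -> (forall i, side_length q i = 2 * h) ->
  area (polygon_interior q) = A%:E ->
  A = 4 * h ^+ 2 /\
  ((- (2 * k ^+ 2))%:E <= robin_eigenvalue q (- (k * robin_T (2 * (k * h)))))%E.
Proof.
move=> h0 k0 e1 ee [[X0 Y0] [X1 Y1] [X2 Y2] [X3 Y3]] len areaA.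
have O a b c := frame_orient1 o e eps a b c e1.
have hh : 0 < h * h by rewrite mulr_gt0.
have cp : convex_polygon eps q.
  apply: (frame_convex o e eps k q k0 e1 ee); rewrite O ?X0 ?X1 ?X2 ?X3 ?Y0 ?Y1 ?Y2 ?Y3;
    move: hh; clear; lra.
split.
  have := polygon_area _ _ _ cp areaA; rewrite !O X0 X1 X2 X3 Y0 Y1 Y2 Y3; clear; lra.
have [u11 [u12 [u21 [u22 [cu1 cu2 pde]]]]] := test_fun_helmholtz o e eps k e1 ee.
have T0 := T_ge0 (2 * (k * h)) _.
have hT : robin_T (2 * (k * h)) * ch (k * h) = sh (k * h).
  rewrite /robin_T sh_double ch_double; have := ch_gt0 (k * h); set C := ch _ => C0.
  rewrite (_ : 1 + (2 * (C * C) - 1) = 2 * (C * C)); last by ring.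
  by field; exact: lt0r_neq0.
set T := robin_T _ in T0 hT *.
apply: (robin_eigenvalue_lower eps q _ _ _ _ _ _ _ _ _ cp _ _ (C1_test_fun o e eps k) cu1 cu2 pde).
- by rewrite mulr_ge0// exprn_ge0// ltW.
- by rewrite mulr_ge0 ?(ltW k0)// T0// !mulr_gt0.
- by move=> x; exact: test_fun_gt0.
have sX i t : frameX o e (side q i t) = frameX o e (q i) + t * (frameX o e (q (ordS i)) - frameX o e (q i)).
  by rewrite /frameX /side /= /GRing.scale /=; ring.
have sY i t : frameY o e eps (side q i t) = frameY o e eps (q i) + t * (frameY o e eps (q (ordS i)) - frameY o e eps (q i)).
  by rewrite /frameY /side /= /GRing.scale /=; ring.
have dX i : e.1 * (q (ordS i) - q i).1 + e.2 * (q (ordS i) - q i).2 = frameX o e (q (ordS i)) - frameX o e (q i).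
  by rewrite /frameX /=; ring.
have dY i : eps * (e.1 * (q (ordS i) - q i).2 - e.2 * (q (ordS i) - q i).1) = frameY o e eps (q (ordS i)) - frameY o e eps (q i).
  by rewrite /frameY /=; ring.
move=> i t _ /=; rewrite (frame_normal_flux o e eps k _ (q (ordS i) - q i) ee) dX dY /test_fun sX sY len.
have hN : sh (k * - h) = - (T * ch (k * h)) by rewrite mulrN shN hT.
have cN : ch (k * - h) = ch (k * h) by rewrite mulrN chN.
move: i; apply: ord4P; rewrite !ordSE ?X0 ?X1 ?X2 ?X3 ?Y0 ?Y1 ?Y2 ?Y3 ?subrr ?mulr0 ?addr0 ?sub0r ?subr0 ?hN ?cN -?hT.
all: ring.
Qed.
End SquareEigenvalue.

(** * Frames attached to a square *)

Section SquareFrame.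
Context {R : realType}.
Implicit Types (o e x y : R * R) (p q : 'I_4 -> R * R).

Lemma pdist_sqr x y : Defs.edist x y ^+ 2 = (x.1 - y.1) ^+ 2 + (x.2 - y.2) ^+ 2.
Proof. by rewrite /Defs.edist sqr_sqrtr// addr_ge0 ?sqr_ge0. Qed.

Lemma pdist_ge0 x y : 0 <= Defs.edist x y.
Proof. exact: sqrtr_ge0. Qed.

(** Expressed by distances only, so as to be preserved by isometries. *)
Definition square_distances (L : R) q : Prop :=
  (forall i, Defs.edist (q i) (q (ordS i)) = L) /\
  (forall i, Defs.edist (q i) (q (ordS (ordS i))) ^+ 2 = 2 * L ^+ 2).

Lemma square_distancesP p : square p -> exists2 L, 0 < L & square_distances L p.
Proof.
move=> [sp eqs perp]; have L i : side_length p i = side_length p q0.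
  have E j := eqs j; have h0 := E q0; have h1 := E q1; have h2 := E q2; rewrite !ordSE in h0 h1 h2.
  by move: i; apply: ord4P => //; rewrite ?h2 ?h1 ?h0.
exists (side_length p q0); last split => //.
  rewrite lt_neqAle pdist_ge0 andbT; apply/eqP => /esym E.
  have := pdist_sqr (p q0) (p (ordS q0)); rewrite -/(side_length p q0) E expr0n /= => /esym /eqP.
  rewrite paddr_eq0 ?sqr_ge0// !sqrf_eq0 !subr_eq0 => /andP[/eqP h1 /eqP h2].
  have z : p (ordS q0) - p q0 = 0.
    by rewrite (surjective_pairing (p (ordS q0))) (surjective_pairing (p q0)) h1 h2 subrr.
  have half : 0 <= (2^-1 : R) < 1 by rewrite invr_ge0 ler0n invf_lt1 ?ltr1n.
  have zer : 0 <= (0 : R) < 1 by rewrite lexx ltr01.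
  have same : side p q0 0 = side p q0 2^-1 by rewrite /side z !scaler0.
  have [_ /esym/eqP] := sp q0 q0 0 2^-1 zer half same.
  by rewrite invr_eq0 pnatr_eq0.
move=> i; have := perp i => /=; rewrite pdist_sqr => h.
have h1 := pdist_sqr (p i) (p (ordS i)); have h2 := pdist_sqr (p (ordS i)) (p (ordS (ordS i))).
rewrite -/(side_length p _) L in h1; rewrite -/(side_length p _) L in h2.
by move: h h1 h2; clear; lra.
Qed.

Lemma isometry_square_distances (T : R * R -> R * R) L q : Defs.isometry T ->
  square_distances L q -> square_distances L (T \o q).
Proof. by move=> iT [h1 h2]; split => i /=; rewrite iT. Qed.

(** The first axis points from vertex 1 to vertex 0; the distances then determine
    the vertices up to the orientation. *)
Lemma square_frame (L : R) q : 0 < L -> square_distances L q -> exists o e (eps : R),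
  [/\ e.1 ^+ 2 + e.2 ^+ 2 = 1, eps * eps = 1 & square_in_frame o e eps (L / 2) q].
Proof.
move=> L0 [hs hd]; have l0 : L != 0 by rewrite lt0r_neq0.
have h01 := pdist_sqr (q q0) (q q1); have h12 := pdist_sqr (q q1) (q q2).
have h23 := pdist_sqr (q q2) (q q3); have h30 := pdist_sqr (q q3) (q q0).
have h02 := pdist_sqr (q q0) (q q2); have h13 := pdist_sqr (q q1) (q q3).
have s0 := hs q0; have s1 := hs q1; have s2 := hs q2; have s3 := hs q3.
have d0 := hd q0; have d1 := hd q1; rewrite !ordSE in s0 s1 s2 s3 d0 d1.
rewrite s0 in h01; rewrite s1 in h12; rewrite s2 in h23; rewrite s3 in h30.
rewrite d0 in h02; rewrite d1 in h13; clear hs hd s0 s1 s2 s3 d0 d1.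
rewrite /square_in_frame /frameX /frameY.
move: h01 h12 h23 h30 h02 h13; case: (q q0) => x y; case: (q q1) => x1 y1.
case: (q q2) => x2 y2; case: (q q3) => x3 y3 /=.
have [a1 ->] : exists a, x1 = x + a by exists (x1 - x); rewrite addrC subrK.
have [a2 ->] : exists a, y1 = y + a by exists (y1 - y); rewrite addrC subrK.
have [b1 ->] : exists a, x3 = x + a by exists (x3 - x); rewrite addrC subrK.
have [b2 ->] : exists a, y3 = y + a by exists (y3 - y); rewrite addrC subrK.
have [c1 ->] : exists a, x2 = x + a by exists (x2 - x); rewrite addrC subrK.
have [c2 ->] : exists a, y2 = y + a by exists (y2 - y); rewrite addrC subrK.
move=> h01 h12 h23 h30 h02 h13.
have aa : a1 ^+ 2 + a2 ^+ 2 = L ^+ 2 by move: h01; clear; lra.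
have bb : b1 ^+ 2 + b2 ^+ 2 = L ^+ 2 by move: h30; clear; lra.
have ab : a1 * b1 + a2 * b2 = 0 by move: h13 aa bb; clear; lra.
have ac : a1 * c1 + a2 * c2 = L ^+ 2 by move: h12 h02 aa; clear; lra.
have bc : b1 * c1 + b2 * c2 = L ^+ 2 by move: h23 h02 bb; clear; lra.
clear h01 h12 h23 h30 h02 h13.
have L2 : L ^+ 2 != 0 by rewrite sqrf_eq0.
pose eps := (a1 * b2 - a2 * b1) / L ^+ 2.
have ED : eps * L ^+ 2 = a1 * b2 - a2 * b1 by rewrite /eps mulfVK.
have Eb1 : b1 = - (eps * a2).
  apply: (mulfI L2); rewrite mulrN mulrA (mulrC _ eps) ED -{1}aa.
  transitivity (a1 * (a1 * b1 + a2 * b2) - (a1 * b2 - a2 * b1) * a2); first by ring.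
  by rewrite ab mulr0 sub0r; ring.
have Eb2 : b2 = eps * a1.
  apply: (mulfI L2); rewrite mulrA (mulrC _ eps) ED -{1}aa.
  transitivity (a2 * (a1 * b1 + a2 * b2) + (a1 * b2 - a2 * b1) * a1); first by ring.
  by rewrite ab mulr0 add0r.
have ee : eps * eps = 1.
  apply: (mulfI L2); rewrite mulr1 -{2}bb Eb1 Eb2 -aa; ring.
have Ec1 : c1 = a1 + b1.
  apply: (mulfI L2); transitivity ((a1 ^+ 2 + a2 ^+ 2) * c1); first by rewrite aa.
  transitivity (a1 * (a1 * c1 + a2 * c2) + a2 * (a2 * c1 - a1 * c2)); first by ring.
  have bc' : a2 * c1 - a1 * c2 = - eps * L ^+ 2.
    rewrite -bc Eb1 Eb2; transitivity (eps * eps * (a2 * c1 - a1 * c2)); last by ring.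
    by rewrite ee mul1r.
  by rewrite ac bc' Eb1; ring.
have Ec2 : c2 = a2 + b2.
  apply: (mulfI L2); transitivity ((a1 ^+ 2 + a2 ^+ 2) * c2); first by rewrite aa.
  transitivity (a2 * (a1 * c1 + a2 * c2) - a1 * (a2 * c1 - a1 * c2)); first by ring.
  have bc' : a2 * c1 - a1 * c2 = - eps * L ^+ 2.
    rewrite -bc Eb1 Eb2; transitivity (eps * eps * (a2 * c1 - a1 * c2)); last by ring.
    by rewrite ee mul1r.
  by rewrite ac bc' Eb2; ring.
exists (x + c1 / 2, y + c2 / 2), (- a1 / L, - a2 / L), eps => /=.
have nrm (r : R) : r * ((a1 ^+ 2 + a2 ^+ 2) / L ^+ 2) = r by rewrite aa mulfV// mulr1.
split => //.
  by rewrite -[RHS](nrm 1); field.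
have A1 : L / 2 = (a1 ^+ 2 + a2 ^+ 2) / L / 2 by rewrite aa; field.
have A2 : L / 2 = eps * eps * (a1 ^+ 2 + a2 ^+ 2) / L / 2 by rewrite ee aa; field.
rewrite Ec1 Ec2 Eb1 Eb2; split; split; rewrite ?[in RHS]A1.
all: try by field.
all: by rewrite -A1 A2; field.
Qed.
End SquareFrame.

(** * Vertices of a polygon close to a square *)

Section Closeness.
Context {R : realType}.
Implicit Types (o e x y : R * R) (p q : 'I_4 -> R * R) (S : set (R * R)).

Lemma frame_dist o e (eps : R) x y : e.1 ^+ 2 + e.2 ^+ 2 = 1 -> eps * eps = 1 ->
  Defs.edist x y ^+ 2 = (frameX o e x - frameX o e y) ^+ 2 + (frameY o e eps x - frameY o e eps y) ^+ 2.
Proof.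
move=> e1 ee; rewrite pdist_sqr.
transitivity ((e.1 ^+ 2 + e.2 ^+ 2) * ((x.1 - y.1) ^+ 2 + (x.2 - y.2) ^+ 2)); first by rewrite e1 mul1r.
transitivity ((e.1 * (x.1 - y.1) + e.2 * (x.2 - y.2)) ^+ 2 + (eps * eps) * (e.1 * (x.2 - y.2) - e.2 * (x.1 - y.1)) ^+ 2).
  by rewrite ee; ring.
by rewrite /frameX /frameY; ring.
Qed.

Lemma frame_le_dist o e (eps : R) x y : e.1 ^+ 2 + e.2 ^+ 2 = 1 -> eps * eps = 1 ->
  `|frameX o e x - frameX o e y| <= Defs.edist x y /\
  `|frameY o e eps x - frameY o e eps y| <= Defs.edist x y.
Proof.
move=> e1 ee; have E := frame_dist o e eps x y e1 ee; have d0 := pdist_ge0 x y.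
by split; rewrite -(@ler_pXn2r _ 2)// ?nnegrE// real_normK ?num_real// E ?lerDl ?lerDr sqr_ge0.
Qed.

(** Coordinates relative to a square depend only on the distances to its vertices. *)
Lemma frame_isometry (T : R * R -> R * R) o e (eps : R) o' e' (eps' h : R) p x : 0 < h ->
  e.1 ^+ 2 + e.2 ^+ 2 = 1 -> eps * eps = 1 ->
  e'.1 ^+ 2 + e'.2 ^+ 2 = 1 -> eps' * eps' = 1 ->
  Defs.isometry T -> square_in_frame o' e' eps' h p -> square_in_frame o e eps h (T \o p) ->
  frameX o e (T x) = frameX o' e' x /\ frameY o e eps (T x) = frameY o' e' eps' x.
Proof.
move=> h0 e1 ee e1' ee' iT [[X0 Y0] [X1 Y1] _ [X3 Y3]] [[X0' Y0'] [X1' Y1'] _ [X3' Y3']].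
have D i := etrans (esym (frame_dist o e eps (T x) (T (p i)) e1 ee))
  (etrans (congr1 (fun r => r ^+ 2) (iT x (p i))) (frame_dist o' e' eps' x (p i) e1' ee')).
have := D q0; have := D q1; have := D q3.
rewrite /= in X0' Y0' X1' Y1' X3' Y3'; rewrite X0 Y0 X1 Y1 X3 Y3 X0' Y0' X1' Y1' X3' Y3'.
set a := frameX o e (T x); set b := frameY o e eps (T x).
set c := frameX o' e' x; set d := frameY o' e' eps' x.
move=> h3 h1 h2; have nz : 4 * h != 0 by rewrite mulf_neq0 ?pnatr_eq0 ?lt0r_neq0.
by split; apply: (mulfI nz); move: h1 h2 h3; clear; lra.
Qed.

Lemma frame_lin o e (eps al be ga : R) x :
  ga - (al * frameX o e x + be * frameY o e eps x) =
  lin (- (al * e.1 - be * eps * e.2)) (- (al * e.2 + be * eps * e.1))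
    (ga + al * (e.1 * o.1 + e.2 * o.2) + be * eps * (e.1 * o.2 - e.2 * o.1)) x.
Proof. by rewrite /lin /frameX /frameY; ring. Qed.

Lemma closure_halfplane (k l m : R) S : (forall x, S x -> 0 <= lin k l m x) ->
  forall x, closure S x -> 0 <= lin k l m x.
Proof.
move=> HS x cS; rewrite leNgt; apply/negP => hx.
have [y [/HS + hy]] := cS _ (open_nbhs_nbhs (conj (open_sublevel _ 0 (continuous_lin k l m)) hx)).
by rewrite leNgt hy.
Qed.

(** The half-plane contains the whole curve, and a point beyond it is in an
    unbounded component of the complement. *)
Lemma interior_halfplane (k l m : R) p : (k != 0) || (l != 0) ->
  (forall i, 0 <= lin k l m (p i)) -> forall x, polygon_interior p x -> 0 <= lin k l m x.
Proof.
move=> kl Hp x [_ bx]; rewrite leNgt; apply/negP => hx.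
apply: (halfplane_unbounded_component (polygon_curve p) k l m x kl _ hx bx) => y [i [t /andP[t0 t1] ->]].
by rewrite /side lin_segment addr_ge0// mulr_ge0// subr_ge0.
Qed.

Lemma frame_closure o e (eps al be ga : R) S :
  (forall x, S x -> al * frameX o e x + be * frameY o e eps x <= ga) ->
  forall x, closure S x -> al * frameX o e x + be * frameY o e eps x <= ga.
Proof.
move=> HS x cx; rewrite -subr_ge0 frame_lin; apply: closure_halfplane cx => y Sy.
by rewrite -frame_lin subr_ge0 HS.
Qed.

Lemma frame_interior o e (eps al be ga : R) p : e.1 ^+ 2 + e.2 ^+ 2 = 1 -> eps * eps = 1 ->
  al ^+ 2 + be ^+ 2 != 0 ->
  (forall i, al * frameX o e (p i) + be * frameY o e eps (p i) <= ga) ->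
  forall x, polygon_interior p x -> al * frameX o e x + be * frameY o e eps x <= ga.
Proof.
move=> e1 ee ab Hp x ix; rewrite -subr_ge0 frame_lin; apply: interior_halfplane ix.
  apply: contraNT ab; rewrite negb_or !negbK !oppr_eq0 => /andP[/eqP h1 /eqP h2]; apply/eqP.
  transitivity ((al ^+ 2 + (eps * eps) * be ^+ 2) * (e.1 ^+ 2 + e.2 ^+ 2)); first by rewrite e1 ee; ring.
  transitivity ((al * e.1 - be * eps * e.2) ^+ 2 + (al * e.2 + be * eps * e.1) ^+ 2); first by ring.
  by rewrite h1 h2 expr0n addr0.
by move=> i; rewrite -frame_lin subr_ge0.
Qed.

Lemma isometry_closure (T : R * R -> R * R) S x : Defs.isometry T -> closure S x ->
  closure (T @` S) (T x).
Proof.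
move=> iT cS B /nbhs_ballP [r /= r0 HB].
have r4 : 0 < r / 4 by rewrite divr_gt0.
have [y [Sy [y1 y2]]] := cS _ (nbhsx_ballx x (r / 4) r4).
exists (T y); split; first by exists y.
apply: HB; rewrite /ball /= /ball /=.
have lt : Defs.edist (T x) (T y) < r.
  rewrite iT -(@ltr_pXn2r _ 2)// ?nnegrE ?pdist_ge0 ?(ltW r0)// pdist_sqr.
  move: y1 y2; rewrite /ball /= => y1 y2.
  have sq (a : R) : `|a| < r / 4 -> a ^+ 2 <= (r / 4) ^+ 2.
    move=> /ltr_normlP[h1 h2]; rewrite -subr_ge0 subr_sqr mulr_ge0//; move: h1 h2; clear; lra.
  have := lerD (sq _ y1) (sq _ y2); have : 0 < r ^+ 2 by rewrite exprn_gt0.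
  clear; lra.
have e1 : (1 : R) ^+ 2 + 0 ^+ 2 = 1 by rewrite expr1n expr0n addr0.
have [] := frame_le_dist (0, 0) (1, 0) 1 (T x) (T y) e1 (mulr1 1).
rewrite /frameX /frameY /= !mul0r !mul1r !addr0 !subr0 => h1 h2.
by split; rewrite /ball /=; [apply: le_lt_trans h1 lt|apply: le_lt_trans h2 lt].
Qed.

Lemma hausdorff_near (S S' : set (R * R)) (d : R) : (hausdorff_dist S S' < d%:E)%E ->
  (forall x, S x -> exists2 y, S' y & Defs.edist x y < d) /\
  (forall y, S' y -> exists2 x, S x & Defs.edist y x < d).
Proof.
rewrite /hausdorff_dist gt_max => /andP[h1 h2].
have aux (A B : set (R * R)) : (ereal_sup [set edist_set x B | x in A] < d%:E)%E ->
    forall x, A x -> exists2 y, B y & Defs.edist x y < d.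
  move=> h x Ax; have : (edist_set x B < d%:E)%E.
    by apply: le_lt_trans h; apply: ereal_sup_ubound; exists x.
  by move=> /ereal_inf_lt [_ [y By <-]]; rewrite lte_fin => ?; exists y.
by split; exact: aux.
Qed.

(** At the corner with signs s, r the function s X + r Y is 2 h, so it exceeds
    2 h - 2 d somewhere in the closed region and hence at a vertex. As s X and r Y
    are at most h + d there, both are at least h - 3 d. *)
Lemma vertex_near_corner (T : R * R -> R * R) o e (eps : R) o' e' (eps' h d : R) p p0 :
  0 < h -> e.1 ^+ 2 + e.2 ^+ 2 = 1 -> eps * eps = 1 ->
  e'.1 ^+ 2 + e'.2 ^+ 2 = 1 -> eps' * eps' = 1 ->
  Defs.isometry T -> square_in_frame o' e' eps' h p0 -> square_in_frame o e eps h (T \o p0) ->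
  simple_polygon p0 -> simple_polygon p ->
  (hausdorff_dist (closure (polygon_interior p)) (closure (T @` polygon_interior p0)) < d%:E)%E ->
  forall j : 'I_4, exists i : 'I_4,
    `|frameX o e (p i) - frameX o e (T (p0 j))| <= 3 * d /\
    `|frameY o e eps (p i) - frameY o e eps (T (p0 j))| <= 3 * d.
Proof.
move=> h0 e1 ee e1' ee' iT sq0 sqT sp0 sp /hausdorff_near [near1 near2].
have iso x := frame_isometry T o e eps o' e' eps' h p0 x h0 e1 ee e1' ee' iT sq0 sqT.
have sign_le (s r : R) : s ^+ 2 = 1 -> `|r| <= h -> s * r <= h.
  by move=> /sqr1_sign [->|->]; rewrite ?mul1r ?mulN1r => /ler_normlP[].
have corners i : `|frameX o' e' (p0 i)| = h /\ `|frameY o' e' eps' (p0 i)| = h.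
  move: sq0 => [[X0 Y0] [X1 Y1] [X2 Y2] [X3 Y3]]; move: i; apply: ord4P;
  by rewrite ?X0 ?Y0 ?X1 ?Y1 ?X2 ?Y2 ?X3 ?Y3 ?normrN gtr0_norm.
have boundX (s : R) i : s ^+ 2 = 1 -> s * frameX o e (p i) <= h + d.
  move=> s1; have [y cy yd] := near1 _ (simple_vertices p i sp).
  have hy : s * frameX o e y + 0 * frameY o e eps y <= h.
    apply: frame_closure cy => _ [x ix <-]; have [-> ->] := iso x.
    apply: (frame_interior o' e' eps' s 0 h p0 e1' ee' _ _ x ix).
      by rewrite s1 expr0n addr0 oner_eq0.
    by move=> j; rewrite mul0r addr0; apply: sign_le => //; case: (corners j) => ->.
  rewrite mul0r addr0 in hy.
  have [/ler_normlP[h1 h2] _] := frame_le_dist o e eps (p i) y e1 ee.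
  by have [E|E] := sqr1_sign s s1; move: hy h1 h2 yd; rewrite E; clear; lra.
have boundY (s : R) i : s ^+ 2 = 1 -> s * frameY o e eps (p i) <= h + d.
  move=> s1; have [y cy yd] := near1 _ (simple_vertices p i sp).
  have hy : 0 * frameX o e y + s * frameY o e eps y <= h.
    apply: frame_closure cy => _ [x ix <-]; have [-> ->] := iso x.
    apply: (frame_interior o' e' eps' 0 s h p0 e1' ee' _ _ x ix).
      by rewrite s1 expr0n add0r oner_eq0.
    by move=> j; rewrite mul0r add0r; apply: sign_le => //; case: (corners j) => _ ->.
  rewrite mul0r add0r in hy.
  have [_ /ler_normlP[h1 h2]] := frame_le_dist o e eps (p i) y e1 ee.
  by have [E|E] := sqr1_sign s s1; move: hy h1 h2 yd; rewrite E; clear; lra.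
have corner (s r : R) j : s ^+ 2 = 1 -> r ^+ 2 = 1 ->
    frameX o e (T (p0 j)) = s * h -> frameY o e eps (T (p0 j)) = r * h ->
  exists i : 'I_4,
    `|frameX o e (p i) - frameX o e (T (p0 j))| <= 3 * d /\
    `|frameY o e eps (p i) - frameY o e eps (T (p0 j))| <= 3 * d.
  move=> s1 r1 Xj Yj; have [y cy yd] := near2 _ (isometry_closure _ _ _ iT (simple_vertices p0 j sp0)).
  have [i Hi] : exists i, 2 * h - 2 * d < s * frameX o e (p i) + r * frameY o e eps (p i).
    apply/not_existsP => Hn.
    have hy : s * frameX o e y + r * frameY o e eps y <= 2 * h - 2 * d.
      apply: frame_closure cy => x ix.
      apply: (frame_interior o e eps s r _ p e1 ee _ _ x ix).
        by rewrite s1 r1 -[1]/(1%:R) -natrD pnatr_eq0.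
      by move=> i; rewrite leNgt; apply/negP; exact: Hn.
    have [/ler_normlP[h1 h2] /ler_normlP[h3 h4]] := frame_le_dist o e eps (T (p0 j)) y e1 ee.
    rewrite Xj in h1 h2; rewrite Yj in h3 h4.
    by case: (sqr1_sign _ s1) (sqr1_sign _ r1) => E [] E'; move: hy h1 h2 h3 h4 yd; rewrite E E'; clear; lra.
  exists i; rewrite Xj Yj !ler_norml.
  have := boundX _ i s1; have := boundY _ i r1; have := boundX _ i (etrans (sqrrN s) s1).
  have := boundY _ i (etrans (sqrrN r) r1).
  by case: (sqr1_sign _ s1) (sqr1_sign _ r1) => E [] E'; move: Hi h0; rewrite E E'; clear; lra.
move=> j; move: sqT => [[X0 Y0] [X1 Y1] [X2 Y2] [X3 Y3]].
have p1 : (1 : R) ^+ 2 = 1 by rewrite expr1n.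
have m1 : (-1 : R) ^+ 2 = 1 by rewrite sqrrN expr1n.
move: j; apply: ord4P.
- by apply: (corner 1 1 q0 p1 p1); rewrite mul1r.
- by apply: (corner (-1) 1 q1 m1 p1); rewrite ?mulN1r ?mul1r.
- by apply: (corner (-1) (-1) q2 m1 m1); rewrite mulN1r.
- by apply: (corner 1 (-1) q3 p1 m1); rewrite ?mulN1r ?mul1r.
Qed.
End Closeness.

(** * Cyclic order of the vertices *)

Section Labelling.
Context {R : realType}.
Implicit Types (o e x y : R * R) (p q : 'I_4 -> R * R) (c : 'I_4 -> bool * bool).

Definition sgb (b : bool) : R := if b then 1 else -1.

(** The pair c i is the signs of the corner assigned to vertex i. *)
Definition near_corners o e (eps h eta : R) p c : Prop := forall i : 'I_4,
  `|frameX o e (p i) - sgb (c i).1 * h| <= eta /\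
  `|frameY o e eps (p i) - sgb (c i).2 * h| <= eta.

Lemma near_corners_flip o e (eps h eta : R) p c (f g : bool) :
  e.1 ^+ 2 + e.2 ^+ 2 = 1 -> eps * eps = 1 -> near_corners o e eps h eta p c ->
  exists e' (eps' : R), [/\ e'.1 ^+ 2 + e'.2 ^+ 2 = 1, eps' * eps' = 1 &
    near_corners o e' eps' h eta p (fun i => ((c i).1 (+) f, (c i).2 (+) g))].
Proof.
move=> e1 ee near.
have S (b : bool) : sgb b * sgb b = 1 by case: b; rewrite /sgb ?mulrNN mulr1.
have N (b : bool) (r : R) : `|sgb b * r| = `|r|.
  by case: b; rewrite /sgb ?mulN1r ?normrN ?mul1r.
have A (b b' : bool) : sgb (b (+) b') = - (sgb b' * sgb b) by case: b b' => [] []; rewrite /sgb /=; ring.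
exists (- sgb f * e.1, - sgb f * e.2), (sgb f * sgb g * eps); split.
- by rewrite /= !exprMn -mulrDr e1 sqrrN expr2 S mulr1.
- transitivity ((sgb f * sgb f) * (sgb g * sgb g) * (eps * eps)); first by ring.
  by rewrite !S ee !mulr1.
move=> i; have [h1 h2] := near i; rewrite /= !A.
have -> : frameX o (- sgb f * e.1, - sgb f * e.2) (p i) - - (sgb f * sgb (c i).1) * h =
  - (sgb f * (frameX o e (p i) - sgb (c i).1 * h)) by rewrite /frameX /=; ring.
have -> : frameY o (- sgb f * e.1, - sgb f * e.2) (sgb f * sgb g * eps) (p i) - - (sgb g * sgb (c i).2) * h =
  - (sgb g * ((sgb f * sgb f) * frameY o e eps (p i) - sgb (c i).2 * h)) by rewrite /frameY /=; ring.
by rewrite S mul1r !normrN !N.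
Qed.

Lemma near_corners_swap o e (eps h eta : R) p c :
  e.1 ^+ 2 + e.2 ^+ 2 = 1 -> eps * eps = 1 -> near_corners o e eps h eta p c ->
  exists e' (eps' : R), [/\ e'.1 ^+ 2 + e'.2 ^+ 2 = 1, eps' * eps' = 1 &
    near_corners o e' eps' h eta p (fun i => ((c i).2, (c i).1))].
Proof.
move=> e1 ee near; exists (- eps * e.2, eps * e.1), (- eps); split.
- transitivity ((eps * eps) * (e.1 ^+ 2 + e.2 ^+ 2)); first by rewrite /=; ring.
  by rewrite ee e1 mulr1.
- by rewrite mulrNN.
move=> i; have [h1 h2] := near i; split => /=.
  have -> : frameX o (- eps * e.2, eps * e.1) (p i) = frameY o e eps (p i) by rewrite /frameX /frameY /=; ring.
  exact: h2.
have -> : frameY o (- eps * e.2, eps * e.1) (- eps) (p i) = (eps * eps) * frameX o e (p i).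
  by rewrite /frameX /frameY /=; ring.
by rewrite ee mul1r.
Qed.

(** Vertices 0 and 2 are near one side of the square and 1 and 3 near the opposite
    one, so the line through 0 and 2 does not separate 1 from 3. *)
Lemma opposite_turns (x0 y0 x1 y1 x2 y2 x3 y3 s t h : R) : 0 < h -> s * s = 1 -> t * t = 1 ->
  `|x0 - s * h| <= h / 20 -> `|x2 - s * h| <= h / 20 ->
  `|x1 + s * h| <= h / 20 -> `|x3 + s * h| <= h / 20 ->
  `|y0 - t * h| <= h / 20 -> `|y2 + t * h| <= h / 20 ->
  `|y1| <= h + h / 20 -> `|y3| <= h + h / 20 ->
  ((x1 - x0) * (y2 - y0) - (y1 - y0) * (x2 - x0)) *
  ((x3 - x2) * (y0 - y2) - (y3 - y2) * (x0 - x2)) <= 0.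
Proof.
move=> h0 ss tt; have ss' := ss; have tt' := tt.
have sgn (r : R) : r * r = 1 -> r = 1 \/ r = -1 by rewrite -expr2; exact: sqr1_sign.
have prod (a a' u w : R) : 19 / 10 * h <= a -> 19 / 10 * h <= a' ->
    `|u| <= 21 / 10 * h -> `|w| <= 1 / 10 * h -> 0 <= a * a' - u * w.
  clear -h0 => ha ha' hu hw.
  have h1 : (19 / 10 * h) * (19 / 10 * h) <= a * a' by apply: ler_pM => //; lra.
  have h2 : u * w <= (21 / 10 * h) * (1 / 10 * h).
    by apply: (le_trans (ler_norm _)); rewrite normrM; apply: ler_pM.
  have h3 : 0 < h * h by rewrite mulr_gt0.
  lra.
move=> hx0 hx2 hx1 hx3 hy0 hy2 hy1 hy3.
rewrite -[leLHS]mul1r -[1 in leLHS]mulr1 -{1}ss -tt -oppr_ge0.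
set D := (X in - X); have -> : - D =
  ((- (s * (x1 - x0))) * (- (t * (y2 - y0))) - (t * (y1 - y0)) * (s * (x2 - x0))) *
  ((- (s * (x3 - x2))) * (t * (y0 - y2)) - (t * (y3 - y2)) * (s * (x2 - x0))).
  by rewrite /D; ring.
move: hx0 hx1 hx2 hx3 hy0 hy1 hy2 hy3 prod h0 => /ler_normlP[? ?] /ler_normlP[? ?] /ler_normlP[? ?]
  /ler_normlP[? ?] /ler_normlP[? ?] /ler_normlP[? ?] /ler_normlP[? ?] /ler_normlP[? ?] prod h0.
clear ss tt D.
by apply: mulr_ge0; apply: prod; rewrite ?ler_norml; case: (sgn _ ss') (sgn _ tt') => ? [] ?; subst s t; lra.
Qed.

(** Neither diagonal separates the other two vertices, against [simple_split]. *)
Lemma simple_no_bowtie o e (eps h eta : R) p c : simple_polygon p -> 0 < h -> eta <= h / 20 ->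
  e.1 ^+ 2 + e.2 ^+ 2 = 1 -> eps * eps = 1 -> near_corners o e eps h eta p c ->
  (c q2).1 = (c q0).1 -> (c q1).1 = ~~ (c q0).1 -> (c q3).1 = ~~ (c q0).1 ->
  (c q2).2 = ~~ (c q0).2 -> (c q3).2 = ~~ (c q1).2 -> False.
Proof.
move=> sp h0 eh e1 ee near c21 c11 c31 c22 c32.
have O a b d := frame_orient1 o e eps a b d e1.
have [n0x n0y] := near q0; have [n1x n1y] := near q1; have [n2x n2y] := near q2; have [n3x n3y] := near q3.
rewrite c11 in n1x; rewrite c21 in n2x; rewrite c31 in n3x; rewrite c22 in n2y; rewrite c32 in n3y.
have S (b : bool) : sgb b * sgb b = 1 by case: b; rewrite /sgb ?mulrNN mulr1.
have N (b : bool) r : `|r - sgb (~~ b) * h| <= eta -> `|r + sgb b * h| <= h / 20.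
  by move=> hr; apply: le_trans eh; move: hr; case: b; rewrite /sgb /= ?mulN1r ?mul1r ?opprK.
have P (b : bool) r : `|r - sgb b * h| <= eta -> `|r - sgb b * h| <= h / 20.
  by move=> hr; exact: le_trans eh.
have B (b : bool) r : `|r - sgb b * h| <= eta -> `|r| <= h + h / 20.
  by rewrite !ler_norml => /andP[]; move: eh h0; case: b; rewrite /sgb; clear; lra.
have M (b : bool) r : `|r - sgb b * h| <= eta -> `|r - - sgb (~~ b) * h| <= h / 20.
  by move=> hr; apply: le_trans eh; move: hr; case: b; rewrite /sgb /= ?opprK.
have M' (b : bool) r : `|r - sgb b * h| <= eta -> `|r + - sgb b * h| <= h / 20.
  by move=> hr; apply: le_trans eh; move: hr; rewrite mulNr.
have prodE a b d a' b' d' : orient a b d * orient a' b' d' = (eps * orient a b d) * (eps * orient a' b' d').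
  by rewrite mulrACA ee mul1r.
case: (simple_split p sp); rewrite prodE ?(mulrC (eps * orient (p q3) _ _)) !O ltNge => /negP; apply.
  exact: (opposite_turns _ _ _ _ _ _ _ _ _ _ _ h0 (S (c q0).1) (S (c q0).2) (P _ _ n0x) (P _ _ n2x)
    (N _ _ n1x) (N _ _ n3x) (P _ _ n0y) (N _ _ n2y) (B _ _ n1y) (B _ _ n3y)).
have SN : (- sgb (c q0).1) * (- sgb (c q0).1) = 1 by rewrite mulrNN S.
have n1x' : `|frameX o e (p q1) - - sgb (c q0).1 * h| <= h / 20 by rewrite mulNr opprK; exact: N.
have n3x' : `|frameX o e (p q3) - - sgb (c q0).1 * h| <= h / 20 by rewrite mulNr opprK; exact: N.
exact: (opposite_turns _ _ _ _ _ _ _ _ _ _ _ h0 SN (S (c q1).2) n1x' n3x'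
    (M' _ _ n2x) (M' _ _ n0x) (P _ _ n1y) (N _ _ n3y) (B _ _ n2y) (B _ _ n0y)).
Qed.

Definition corner (j : 'I_4) : bool * bool :=
  ((j == q0) || (j == q3), (j == q0) || (j == q1)).

Lemma corner_inj : injective corner.
Proof. by apply: ord4P; apply: ord4P. Qed.

Lemma square_corner o e (eps h : R) q j : square_in_frame o e eps h q ->
  frameX o e (q j) = sgb (corner j).1 * h /\ frameY o e eps (q j) = sgb (corner j).2 * h.
Proof.
move=> [[X0 Y0] [X1 Y1] [X2 Y2] [X3 Y3]]; move: j; apply: ord4P;
  by rewrite ?X0 ?Y0 ?X1 ?Y1 ?X2 ?Y2 ?X3 ?Y3 /corner /sgb /= ?mulN1r ?mul1r.
Qed.

(** Reversing axes puts vertex 0 near the corner with signs +, +. Four of the six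
    possible arrangements of the other vertices are bow-ties, possibly after an
    exchange of the axes; such an exchange also maps the last two to each other. *)
Lemma cyclic_labelling o e (eps h eta : R) p c : simple_polygon p -> 0 < h -> eta <= h / 20 ->
  e.1 ^+ 2 + e.2 ^+ 2 = 1 -> eps * eps = 1 -> injective c -> near_corners o e eps h eta p c ->
  exists e' (eps' : R), [/\ e'.1 ^+ 2 + e'.2 ^+ 2 = 1, eps' * eps' = 1 &
    near_corners o e' eps' h eta p corner].
Proof.
move=> sp h0 eh e1 ee ci near.
have [e' [eps' [{}e1 {}ee {}near]]] := near_corners_flip o e eps h eta p c (~~ (c q0).1) (~~ (c q0).2) e1 ee near.
set c' := (fun i => _) in near.
have {}ci : injective c'.
  by move=> i j [/addIb h1 /addIb h2]; apply: ci; rewrite (surjective_pairing (c i)) (surjective_pairing (c j)) h1 h2.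
have c0 : c' q0 = (true, true) by rewrite /c' !addbN !addbb.
clearbody c'.
have d i j : i != j -> c' i != c' j by rewrite (inj_eq ci).
have := d q0 q1 isT; have := d q0 q2 isT; have := d q0 q3 isT; have := d q1 q2 isT.
have := d q1 q3 isT; have := d q2 q3 isT; clear d.
have straight := simple_no_bowtie o e' eps' h eta p c' sp h0 eh e1 ee near.
have [e2 [eps2 [e21 ee2 near2]]] := near_corners_swap o e' eps' h eta p c' e1 ee near.
have turned := simple_no_bowtie o e2 eps2 h eta p _ sp h0 eh e21 ee2 near2.
move: straight turned; rewrite /= c0.
case E1 : (c' q1) => [[] []]; case E2 : (c' q2) => [[] []]; case E3 : (c' q3) => [[] []] //= straight turned _ _ _ _ _ _;
  try (by exfalso; apply: straight); try (by exfalso; apply: turned).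
- exists e2, eps2; split => // i; have := near2 i; move: i.
  by apply: ord4P; rewrite /= ?c0 ?E1 ?E2 ?E3.
- exists e', eps'; split => // i; have := near i; move: i.
  by apply: ord4P; rewrite ?c0 ?E1 ?E2 ?E3.
Qed.

(** No vertex is near two corners, so choosing a vertex near each corner is a
    bijection. *)
Lemma near_corners_label o e (eps h eta : R) p q : simple_polygon p -> 0 < h -> eta <= h / 20 ->
  e.1 ^+ 2 + e.2 ^+ 2 = 1 -> eps * eps = 1 -> square_in_frame o e eps h q ->
  (forall j : 'I_4, exists i : 'I_4,
    `|frameX o e (p i) - frameX o e (q j)| <= eta /\
    `|frameY o e eps (p i) - frameY o e eps (q j)| <= eta) ->
  exists e' (eps' : R), [/\ e'.1 ^+ 2 + e'.2 ^+ 2 = 1, eps' * eps' = 1 &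
    near_corners o e' eps' h eta p corner].
Proof.
move=> sp h0 eh e1 ee sq near; have [f Hf] := choice near.
have corn j := square_corner o e eps h q j sq.
have fi : injective f.
  move=> j j' E; have [hx hy] := Hf j; have [] := Hf j'; rewrite -E => hx' hy'.
  apply: corner_inj; rewrite (surjective_pairing (corner j)) (surjective_pairing (corner j')).
  have sep (r : R) (b b' : bool) : `|r - sgb b * h| <= eta -> `|r - sgb b' * h| <= eta -> b = b'.
    move=> /ler_normlP[] + + /ler_normlP[]; move: eh h0; case: b b' => [] [] //=; rewrite /sgb; clear; lra.
  move: hx hy hx' hy'; have [-> ->] := corn j; have [-> ->] := corn j' => hx hy hx' hy'.
  by rewrite (sep _ _ _ hx hx') (sep _ _ _ hy hy').
apply: (cyclic_labelling o e eps h eta p (corner \o invF fi)) => //.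
  by move=> i i' /corner_inj /(can_inj (f_invF fi)).
move=> i; have := Hf (invF fi i); rewrite f_invF; have [-> ->] := corn (invF fi i).
by [].
Qed.
End Labelling.

(** * The adapted frame and the local maximum *)

Section Normalisation.
Context {R : realType}.
Implicit Types (o e x y : R * R) (p q : 'I_4 -> R * R).

(** The vertices are o + s a + r d + s r g with signs s, r; the condition is that the
    second coordinate of the vector a and the first of the vector d are the same b. *)
Definition normal_position o e (eps a d b g1 g2 : R) p : Prop :=
  [/\ frameX o e (p q0) = a + b + g1 /\ frameY o e eps (p q0) = b + d + g2,
      frameX o e (p q1) = - a + b - g1 /\ frameY o e eps (p q1) = - b + d - g2,
      frameX o e (p q2) = - a - b + g1 /\ frameY o e eps (p q2) = - b - d + g2 &
      frameX o e (p q3) = a - b - g1 /\ frameY o e eps (p q3) = b - d - g2].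

(** C and S are the normalised P and Q. *)
Lemma small_rotation (P Q : R) : 0 < P -> exists C S : R,
  [/\ C ^+ 2 + S ^+ 2 = 1, C * Q = S * P, `|C| <= 1, `|S| <= 1 &
      P * (1 - C) <= `|Q| /\ P * `|S| <= `|Q|].
Proof.
move=> P0; pose N := Num.sqrt (P ^+ 2 + Q ^+ 2).
have NN : N ^+ 2 = P ^+ 2 + Q ^+ 2 by rewrite sqr_sqrtr// addr_ge0 ?sqr_ge0.
have N0' : 0 <= N by exact: sqrtr_ge0.
have PN : P <= N by rewrite -(@ler_pXn2r _ 2)// ?nnegrE ?(ltW P0)// NN lerDl sqr_ge0.
have QN : `|Q| <= N by rewrite -(@ler_pXn2r _ 2)// ?nnegrE// NN real_normK ?num_real// lerDr sqr_ge0.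
have NPQ : N <= P + `|Q|.
  rewrite -(@ler_pXn2r _ 2)// ?nnegrE ?addr_ge0 ?(ltW P0)// NN sqrrD real_normK ?num_real//.
  by rewrite lerD2r lerDl mulrn_wge0// mulr_ge0// ltW.
have N0 : 0 < N by apply: lt_le_trans PN.
have n0 : N != 0 by rewrite lt0r_neq0.
have N1 (z : R) : `|z| <= N -> `|z / N| <= 1.
  by move=> hz; rewrite normrM normfV (gtr0_norm N0) ler_pdivrMr// mul1r.
have PP : `|P| <= N by rewrite gtr0_norm.
exists (P / N), (Q / N); split.
- by rewrite !exprMn -mulrDl -NN -exprMn mulfV// expr1n.
- by rewrite mulrAC [RHS]mulrAC (mulrC P).
- exact: N1.
- exact: N1.
have QS : `|Q / N| = `|Q| / N by rewrite normrM normfV (gtr0_norm N0).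
split.
  apply: (@le_trans _ _ (N * (1 - P / N))).
    by rewrite ler_wpM2r// subr_ge0; have := N1 _ PP; rewrite ler_norml => /andP[].
  by rewrite mulrBr mulr1 mulrC mulfVK// lerBlDl.
rewrite QS mulrA ler_pdivrMr// mulrC ler_wpM2l//.
Qed.

(** The origin is the centroid. Equality of the two off-diagonal coefficients is
    linear in the cosine and sine of the rotation, and the coefficients of that
    equation make the angle of order eta / h. *)
Lemma normal_frame o e (eps h eta : R) p : 0 < h -> eta <= h / 20 ->
  e.1 ^+ 2 + e.2 ^+ 2 = 1 -> eps * eps = 1 -> near_corners o e eps h eta p corner ->
  exists o' e' (a d b g1 g2 : R),
  [/\ e'.1 ^+ 2 + e'.2 ^+ 2 = 1, normal_position o' e' eps a d b g1 g2 p,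
      `|a - h| <= 4 * eta /\ `|d - h| <= 4 * eta, `|b| <= 4 * eta &
      `|g1| <= 4 * eta /\ `|g2| <= 4 * eta].
Proof.
move=> h0 eh e1 ee near.
have [n0x n0y] := near q0; have [n1x n1y] := near q1; have [n2x n2y] := near q2; have [n3x n3y] := near q3.
rewrite /corner /sgb /= ?mul1r ?mulN1r in n0x n0y n1x n1y n2x n2y n3x n3y.
have [X EX] : exists X, X = fun i => frameX o e (p i) by eexists.
have [Y EY] : exists Y, Y = fun i => frameY o e eps (p i) by eexists.
have EX' i : frameX o e (p i) = X i by rewrite EX.
have EY' i : frameY o e eps (p i) = Y i by rewrite EY.
rewrite !EX' in n0x n1x n2x n3x; rewrite !EY' in n0y n1y n2y n3y.
pose A1 := (X q0 - X q1 - X q2 + X q3) / 4; pose A2 := (Y q0 - Y q1 - Y q2 + Y q3) / 4.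
pose D1 := (X q0 + X q1 - X q2 - X q3) / 4; pose D2 := (Y q0 + Y q1 - Y q2 - Y q3) / 4.
pose G1 := (X q0 - X q1 + X q2 - X q3) / 4; pose G2 := (Y q0 - Y q1 + Y q2 - Y q3) / 4.
have [hA1 hA2] : `|A1 - h| <= eta /\ `|A2| <= eta.
  move: n0x n1x n2x n3x n0y n1y n2y n3y; rewrite /A1 /A2 !ler_norml; clear; lra.
have [hD1 hD2] : `|D1| <= eta /\ `|D2 - h| <= eta.
  move: n0x n1x n2x n3x n0y n1y n2y n3y; rewrite /D1 /D2 !ler_norml; clear; lra.
have [hG1 hG2] : `|G1| <= eta /\ `|G2| <= eta.
  move: n0x n1x n2x n3x n0y n1y n2y n3y; rewrite /G1 /G2 !ler_norml; clear; lra.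
have eta0 : 0 <= eta by apply: le_trans hA2.
have P0 : h <= A1 + D2 by move: hA1 hD2 eh h0; rewrite !ler_norml; clear; lra.
have hQ : `|A2 - D1| <= 2 * eta by move: hA2 hD1; rewrite !ler_norml; clear; lra.
have [C [S [CS rot C1' S1 [hC hS]]]] := small_rotation (A1 + D2) (A2 - D1) (lt_le_trans h0 P0).
have {}hC : h * (1 - C) <= 2 * eta.
  apply: le_trans hQ; apply: le_trans hC; rewrite ler_wpM2r// subr_ge0.
  by move: C1'; rewrite ler_norml => /andP[].
have {}hS : `|h * S| <= 2 * eta.
  by rewrite normrM (gtr0_norm h0); apply: le_trans hQ; apply: le_trans hS; rewrite ler_wpM2r.
have CM z : `|z| <= eta -> `|C * z| <= eta by move=> hz; rewrite normrM -[leRHS]mul1r ler_pM.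
have SM z : `|z| <= eta -> `|S * z| <= eta by move=> hz; rewrite normrM -[leRHS]mul1r ler_pM.
have hC0 : 0 <= h * (1 - C).
  by rewrite mulr_ge0 ?(ltW h0)// subr_ge0; move: C1'; rewrite ler_norml => /andP[].
pose o' : R * R := (((p q0).1 + (p q1).1 + (p q2).1 + (p q3).1) / 4, ((p q0).2 + (p q1).2 + (p q2).2 + (p q3).2) / 4).
pose e' : R * R := (C * e.1 - S * eps * e.2, C * e.2 + S * eps * e.1).
have FX i : frameX o' e' (p i) = C * (X i - (X q0 + X q1 + X q2 + X q3) / 4) + S * (Y i - (Y q0 + Y q1 + Y q2 + Y q3) / 4).
  by rewrite EX EY /frameX /frameY /o' /e' /=; field.
have FY i : frameY o' e' eps (p i) = C * (Y i - (Y q0 + Y q1 + Y q2 + Y q3) / 4) - S * (X i - (X q0 + X q1 + X q2 + X q3) / 4).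
  transitivity (C * (Y i - (Y q0 + Y q1 + Y q2 + Y q3) / 4) - S * (eps * eps) * (X i - (X q0 + X q1 + X q2 + X q3) / 4)).
    by rewrite EX EY /frameX /frameY /o' /e' /=; field.
  by rewrite ee mulr1.
exists o', e', (C * A1 + S * A2), (C * D2 - S * D1), (C * D1 + S * D2), (C * G1 + S * G2), (C * G2 - S * G1).
have bE : C * D1 + S * D2 = C * A2 - S * A1 by move: rot; clear; lra.
split.
- rewrite /e' /=; transitivity ((C ^+ 2 + (eps * eps) * S ^+ 2) * (e.1 ^+ 2 + e.2 ^+ 2)); first by ring.
  by rewrite ee e1 mul1r mulr1.
- rewrite /normal_position !FX !FY.
  by split; (split; [rewrite /A1 /A2 /D1 /D2 /G1 /G2 | rewrite bE /A1 /A2 /D1 /D2 /G1 /G2]; field).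
- have := CM _ hA1; have := SM _ hA2; have := CM _ hD2; have := SM _ hD1.
  by rewrite !ler_norml; move: hC hC0; clear; lra.
- have := CM _ hD1; have := SM _ hD2; move: hS; rewrite !ler_norml; clear; lra.
- have := CM _ hG1; have := SM _ hG2; have := SM _ hG1; have := CM _ hG2; move: eta0; rewrite !ler_norml; clear; lra.
Qed.
End Normalisation.

Theorem theorem1 (R : realType) (A alpha : R) (p0 : 'I_4 -> R * R)
    (hA : 0 < A) (halpha : alpha < 0)
    (hsq : square p0) (harea0 : area (polygon_interior p0) = A%:E) :
  exists2 delta : R, 0 < delta &
    forall p : 'I_4 -> R * R,
      simple_polygon p ->
      area (polygon_interior p) = A%:E ->
      (hausdorff_dist_iso (polygon_interior p) (polygon_interior p0)
         < delta%:E)%E ->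
      (robin_eigenvalue p alpha <= robin_eigenvalue p0 alpha)%E.
Proof.
have [L L0 dist0] := square_distancesP p0 hsq.
have [sp0 _ _] := hsq.
have [w0 [e0 [eps0 [e01 ee0 sq0]]]] := square_frame L p0 L0 dist0.
pose h := L / 2; have h0 : 0 < h by rewrite divr_gt0.
(* H = 2kh with k tanh (k h) = - alpha *)
have c0 : 0 < 2 * h * - alpha by rewrite !mulr_gt0 ?oppr_gt0.
have [H H0 HT] := robin_T_root _ c0.
pose k := H / (2 * h); have hn : h != 0 by rewrite lt0r_neq0.
have k0 : 0 < k by rewrite divr_gt0 ?mulr_gt0.
have kh : 2 * (k * h) = H by rewrite /k; field.
have kT : k * robin_T H = - alpha.
  by rewrite /k mulrAC HT; field.
have len i : side_length p0 i = 2 * h by rewrite /side_length dist0.1 /h; field.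
have [EA low] := robin_lower_square w0 e0 eps0 h k A p0 h0 k0 e01 ee0 sq0 len harea0.
rewrite kh kT opprK in low.
have [d1 d10 up] := robin_upper_near_square H H0.
(* h / 20 serves the cyclic order, d1 / (8 * k) the bounds 4 * eta scaled by 2k *)
pose eta := Num.min (h / 20) (d1 / (8 * k)).
have eta0 : 0 < eta by rewrite lt_min !divr_gt0// mulr_gt0.
have eta1 : eta <= h / 20 by rewrite ge_min lexx.
have eta2 : 2 * k * (4 * eta) <= d1.
  rewrite (_ : 2 * k * (4 * eta) = eta * (8 * k)); last by ring.
  have k8 : 0 < 8 * k by rewrite mulr_gt0.
  by rewrite -(ler_pdivlMr _ _ k8) /eta ge_min lexx orbT.
exists (eta / 3); first by rewrite divr_gt0.
move=> p sp areap /ereal_inf_lt [_ [T iT <-] hT].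
have distT := isometry_square_distances T L p0 iT dist0.
have [w [e [eps [e1 ee sqT]]]] := square_frame L (T \o p0) L0 distT.
have vn := vertex_near_corner T w e eps w0 e0 eps0 h (eta / 3) p p0 h0 e1 ee e01 ee0 iT sq0 sqT sp0 sp hT.
have e3 : 3 * (eta / 3) = eta by field.
rewrite e3 in vn.
have [e' [eps' [e1' ee' near]]] := near_corners_label w e eps h eta p (T \o p0) sp h0 eta1 e1 ee sqT vn.
have [w2 [e2 [a [d [b [g1 [g2 [e21 [[X0 Y0] [X1 Y1] [X2 Y2] [X3 Y3]] [ha hd] hb [hg1 hg2]]]]]]]]] :=
  normal_frame w e' eps' h eta p h0 eta1 e1' ee' near.
apply: le_trans low.
have small z : `|z| <= 4 * eta -> `|2 * k * z| <= d1.
  move=> hz; have k2 : 0 < 2 * k by rewrite mulr_gt0.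
  by apply: le_trans eta2; rewrite normrM (gtr0_norm k2) ler_wpM2l// ltW.
have kA : k ^+ 2 * A = H ^+ 2 by rewrite EA -kh; ring.
have := up w2 e2 eps' k A _ _ _ _ _ p k0 e21 ee' hA kA areap _ _ _ _ _ _ _ _
  (small _ ha) (small _ hd) (small _ hb) (small _ hg1) (small _ hg2).
rewrite kT opprK X0 Y0 X1 Y1 X2 Y2 X3 Y3 -kh; apply; ring.
Qed.
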